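(* Assume (H1), (H2), (H3) and that $(X_k)_{k\ge1}$ is generated by the subsampling scheme (both spelled out in the context), i.e. with $q_k=(1-\lambda_k)f_k^*+\lambda_kq_0$ for all $k\ge1$, where $f_k^*$ is the bootstrap kernel estimate. If there exists $\epsilon>0$ such that $$a_n^2\,\frac{n}{\ell_n}+a_n+h_n^4\ll\lambda_n^{1+\epsilon}\ll1,$$ and if $g:\mathbb R^d\to\mathbb R$ is a (measurable) function with $\int g^2q_0<\infty$, then, as $n\to\infty$, $$\sqrt n\left(\sum_{k=1}^nW_{n,k}\,g(X_k)-\int gf\right)\ \text{ converges in distribution to }\ \mathcal N\big(0,V(f,g)\big),$$ where $V(f,g)=\int g^2f-\big(\int gf\big)^2$.
   Context: Let $f_U:\mathbb R^d\to[0,\infty)$ be measurable with $0<\int f_U<\infty$ (all integrals are with respect to Lebesgue measure), and $f=f_U/\int f_U$. Sequences (deterministic): $(h_k)_{k\ge1}$ is positive and bounded; $(\lambda_k)_{k\ge1}\subset(0,1]$ is nonincreasing; $(\ell_k)_{k\ge1}$ are integers with $1\le\ell_k\le k$, nondecreasing; $a_n=\sqrt{\log(n)/(nh_n^d)}$. For nonnegative sequences, $u_n\ll v_n$ means $u_n/v_n\to0$. $K_h(u)=K(u/h)/h^d$. Subsampling scheme: $X_1$ has (deterministic) density $q_0$, and $W_1=f_U(X_1)/q_0(X_1)$. For $k=1,2,\dots$: with $W_{k,i}=W_i/\sum_{j=1}^kW_j$, $i=1,\dots,k$, and conditionally on everything generated so far, draw $X_{k,1}^*,\dots,X_{k,\ell_k}^*$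 independent and identically distributed from the discrete distribution $\mathbb P_k=\sum_{i=1}^kW_{k,i}\delta_{X_i}$; set $f_k^*(x)=\ell_k^{-1}\sum_{i=1}^{\ell_k}K_{h_k}(x-X_{k,i}^* )$ and $q_k=(1-\lambda_k)f_k^*+\lambda_kq_0$; then, conditionally on everything generated so far (including the bootstrap samples), draw $X_{k+1}$ with density $q_k$ and set $W_{k+1}=f_U(X_{k+1})/q_k(X_{k+1})$. Assumptions: (H1) $f$ is a probability density on $\mathbb R^d$, twice continuously differentiable with bounded second derivatives. (H2) $q_0$ is a probability density on $\mathbb R^d$; for every $\eta\in(0,1]$ there is $c_\eta>0$ with $f(x)^\eta\le c_\eta q_0(x)$ for all $x\in\mathbb R^d$; and there are $C_0,r_0>0$ with $q_0(x)\le C_0(1+\|x\|)^{-r_0}$ for all $x$. (H3) $K:\mathbb R^d\to[0,\infty)$ is a Lipschitz probability density with $\int uK(u)\,du=0$, $\int\|u\|^2K(u)\,du<\infty$, and there are $C_K,r_K>0$ with $K(x)\le C_K(1+\|x\|)^{-r_K}$ for all $x$. *)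

(* Defs.v *)
From HB Require Import structures.
From mathcomp Require Import all_boot all_order all_algebra.
From mathcomp Require Import all_classical all_reals all_analysis.
From mathcomp Require Import measurable_realfun lra.

Set Implicit Arguments.
Unset Strict Implicit.
Unset Printing Implicit Defensive.

Import Order.TTheory GRing.Theory Num.Theory.
Import numFieldNormedType.Exports.

Local Open Scope classical_set_scope.
Local Open Scope ring_scope.

(* 'rV[R]_d carries the product sigma-algebra; it contains the open sets of
   the library's topology (open_measurable_rV), hence is the Borel one. *)
Definition rV_display : measure_display. Proof. exact. Qed.

Section measurable_rV.
Context {R : realType} (d : nat).

Let coord_rV (i : 'I_d) (v : 'rV[R]_d) : measurableTypeR R := v ord0 i.

Let rV_set0 : g_sigma_preimage coord_rV set0.
Proof. exact: sigma_algebra0. Qed.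

Let rV_setC A : g_sigma_preimage coord_rV A -> g_sigma_preimage coord_rV (~` A).
Proof. exact: sigma_algebraC. Qed.

Let rV_bigcup (F : (set 'rV[R]_d)^nat) :
  (forall i, g_sigma_preimage coord_rV (F i)) ->
  g_sigma_preimage coord_rV (\bigcup_i F i).
Proof. exact: sigma_algebra_bigcup. Qed.

HB.instance Definition _ := @isMeasurable.Build rV_display
  'rV[R]_d (g_sigma_preimage coord_rV) rV_set0 rV_setC rV_bigcup.

Lemma measurable_coord_rV (i : 'I_d) :
  measurable_fun setT (fun v : 'rV[R]_d => v ord0 i).
Proof.
move=> _ Y mY; rewrite setTI; apply: sub_sigma_algebra => /=.
rewrite -bigcup_seq/=; exists i => /=; first by rewrite mem_index_enum.
by exists Y => //; rewrite setTI.
Qed.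

Lemma measurable_fun_rV d' (T : measurableType d') (f : T -> 'rV[R]_d) :
  (forall i, measurable_fun setT (fun x => f x ord0 i)) -> measurable_fun setT f.
Proof.
move=> mf _ Y mY; rewrite setTI.
suff : g_sigma_preimage (fun i => coord_rV i \o f) (f @^-1` Y).
  apply: smallest_sub; first exact: sigma_algebra_measurable.
  rewrite -bigcup_seq/= => A [i _ [B mB <-]].
  exact: (mf i measurableT B mB).
by rewrite g_sigma_preimage_comp; exists Y => //; rewrite setTI.
Qed.

Lemma open_measurable_rV (U : set 'rV[R]_d) : open U -> measurable U.
Proof.
move=> oU.
pose box (pn : 'rV[rat]_d * nat) := \bigcap_(i in [set: 'I_d])
  ((fun v : 'rV[R]_d => v ord0 i) @^-1`
   `]ratr (pn.1 ord0 i) - pn.2.+1%:R^-1, ratr (pn.1 ord0 i) + pn.2.+1%:R^-1[).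
pose F pn := [set v | box pn v /\ box pn `<=` U].
have mF pn : measurable (F pn).
  have [bU|bU] := pselect (box pn `<=` U); last first.
    by rewrite (_ : F pn = set0)//; apply/seteqP; split => // v [].
  rewrite (_ : F pn = box pn); last by apply/seteqP; split => // v [].
  apply: fin_bigcap_measurable => // i _.
  rewrite -[X in measurable X]setTI; apply: measurable_coord_rV => //.
rewrite (_ : U = \bigcup_pn F pn).
  by apply: countable_bigcupT_measurable => //; exact: countableP.
apply/seteqP; split => [v Uv|v [pn _ [bv bU]]]; last exact: bU.
have /nbhs_ballP[e /= e0 eU] : nbhs v U by exact: open_nbhs_nbhs.
pose n := Num.truncn (2 / e).
have n0 : 0 < n.+1%:R^-1 :> R by rewrite invr_gt0.
have ne : 2 * n.+1%:R^-1 <= e.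
  rewrite ler_pdivrMr// mulrC -ler_pdivrMr// ltW//.
  by rewrite truncnS_gt// divr_ge0// ltW.
have /choice[p pP] (i : 'I_d) : exists q : rat,
    ratr q \in `]v ord0 i - n.+1%:R^-1, v ord0 i + n.+1%:R^-1[.
  by apply: rat_in_itvoo; rewrite ltrD2l gt0_cp.
exists (\row_i p i, n) => //; split.
  move=> i _ /=; rewrite mxE in_itv/=.
  have := pP i; rewrite in_itv/= => /andP[p1 p2].
  by rewrite ltrBlDr p2 -ltrBlDr p1.
move=> w bw; apply: eU; split => // i j; rewrite ord1.
rewrite /ball/= ltr_distl.
have := bw j Logic.I; rewrite /= mxE in_itv/= => /andP[w1 w2].
have := pP j; rewrite in_itv/= => /andP[p1 p2].
move: n0 ne w1 w2 p1 p2; set z := n.+1%:R^-1; move: z => z.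
rewrite (_ : 0 = ord0) //.
move: (v ord0 j) (w ord0 j) (ratr _) => x y q *.
apply/andP; split; lra.
Qed.

End measurable_rV.

Section lebesgue_rV.
Context {R : realType}.

Definition cons_rV d (p : measurableTypeR R * 'rV[R]_d) : 'rV[R]_d.+1 :=
  \row_i (if unlift ord0 i is Some j then p.2 ord0 j else p.1).

Let uncons_rV d (v : 'rV[R]_d.+1) : measurableTypeR R * 'rV[R]_d :=
  (v ord0 ord0, \row_j v ord0 (lift ord0 j)).

Lemma measurable_cons_rV d : measurable_fun setT (@cons_rV d).
Proof.
apply: measurable_fun_rV => i.
under eq_fun do rewrite mxE.
case: unliftP => [j _|_]; last exact: measurable_fst.
exact: (measurableT_comp (measurable_coord_rV j) measurable_snd).
Qed.

Let measurable_uncons_rV d : measurable_fun setT (@uncons_rV d).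
Proof.
apply/measurable_fun_pairP; split; first exact: measurable_coord_rV.
apply: measurable_fun_rV => i /=.
under eq_fun do rewrite mxE.
exact: measurable_coord_rV.
Qed.

Let cons_rVK d : cancel (@cons_rV d) (@uncons_rV d).
Proof.
case=> x v; congr pair; first by rewrite mxE unlift_none.
by apply/rowP => j; rewrite !mxE liftK.
Qed.

(* lebesgue_rV d is the d-fold product of lebesgue_measure, built coordinate by
   coordinate; see lebesgue_rV_box. *)
Definition lebesgue_cons d (mu : {sigma_finite_measure set 'rV[R]_d -> \bar R}) :=
  pushforward (lebesgue_measure \x mu)%E (@cons_rV d).

Section lebesgue_cons_measure.
Variables (d : nat) (mu : {sigma_finite_measure set 'rV[R]_d -> \bar R}).

Let lebesgue_cons0 : lebesgue_cons mu set0 = 0%E.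
Proof. by rewrite /lebesgue_cons /pushforward preimage_set0 measure0. Qed.

Let lebesgue_cons_ge0 A : (0 <= lebesgue_cons mu A)%E.
Proof. exact: (measure_ge0 (lebesgue_measure \x mu)%E). Qed.

Let lebesgue_cons_sigma_additive : semi_sigma_additive (lebesgue_cons mu).
Proof.
apply: measure_semi_sigma_additive; exact: measurable_cons_rV.
Qed.

HB.instance Definition _ := isMeasure.Build _ _ _ (lebesgue_cons mu)
  lebesgue_cons0 lebesgue_cons_ge0 lebesgue_cons_sigma_additive.

Let lebesgue_cons_sigma_finite : sigma_finite setT (lebesgue_cons mu).
Proof.
have /sigma_finiteP[F [FT ndF Foo]] := sigma_finiteT (@lebesgue_measure R).
have /sigma_finiteP[G [GT ndG Goo]] := sigma_finiteT mu.
exists (fun n => @uncons_rV d @^-1` (F n `*` G n)).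
  rewrite -preimage_bigcup (_ : \bigcup_n _ = setT) ?preimage_setT//.
  apply/seteqP; split=> // -[x v] _.
  have [n _ Fnx] : (\bigcup_n F n) x by rewrite -FT.
  have [k _ Gkv] : (\bigcup_n G n) v by rewrite -GT.
  exists (maxn n k) => //; split => /=.
    by move: x Fnx; exact/subsetPset/ndF/leq_maxl.
  by move: v Gkv; exact/subsetPset/ndG/leq_maxr.
move=> n; have [mF Fnoo] := Foo n; have [mG Gnoo] := Goo n; split.
  rewrite -[X in measurable X]setTI; apply: measurable_uncons_rV => //.
  exact: measurableX.
rewrite /lebesgue_cons /pushforward -comp_preimage.
rewrite (_ : _ \o _ = idfun); last by apply/funext => p; exact: cons_rVK.
by rewrite preimage_id product_measure1E// lte_mul_pinfty// ge0_fin_numE.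
Qed.

HB.instance Definition _ := Measure_isSigmaFinite.Build _ _ _ (lebesgue_cons mu)
  lebesgue_cons_sigma_finite.
End lebesgue_cons_measure.

Fixpoint lebesgue_rV d : {sigma_finite_measure set 'rV[R]_d -> \bar R} :=
  if d is d'.+1 then lebesgue_cons (lebesgue_rV d') else \d_(0 : 'rV[R]_0).

Lemma lebesgue_rV_box d (a b : 'I_d -> R) : (forall i, a i <= b i) ->
  lebesgue_rV d [set v | forall i, v ord0 i \in `]a i, b i]] =
  (\prod_(i < d) (b i - a i))%:E.
Proof.
elim: d a b => [|d IH] a b ab.
  by rewrite big_ord0 /= diracE mem_set//= => -[].
rewrite big_ord_recl /= /lebesgue_cons /pushforward.
pose A : set (measurableTypeR R) := `]a ord0, b ord0]%classic.
pose B := [set v : 'rV[R]_d |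
  forall i, v ord0 i \in `]a (lift ord0 i), b (lift ord0 i)]].
have -> : @cons_rV d @^-1` [set v | forall i, v ord0 i \in `]a i, b i]] =
    A `*` B.
  apply/seteqP; split => -[x v] /=.
    move=> H; split; first by have := H ord0; rewrite mxE unlift_none.
    by move=> i; have := H (lift ord0 i); rewrite mxE liftK.
  by move=> [xab vab] i; rewrite mxE; case: unliftP => [j|] ->.
have mB : measurable B.
  rewrite (_ : B = \bigcap_(i in setT)
      ((fun v : 'rV[R]_d => v ord0 i) @^-1`
       `]a (lift ord0 i), b (lift ord0 i)]%classic)).
    apply: fin_bigcap_measurable => // i _.
    by rewrite -[X in measurable X]setTI; exact: measurable_coord_rV.
  by apply/seteqP; split => v /= vab i; [move=> _|]; exact: vab.
rewrite product_measure1E//=; last exact: measurable_itv.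
rewrite IH// lebesgue_measure_itv /= lte_fin EFinM.
by have := ab ord0; case: ltgtP => // -> _; rewrite subrr mul0e.
Qed.

End lebesgue_rV.

Section densities.
Context {R : realType} {d : nat}.
Implicit Types (f q K g : 'rV[R]_d -> R).
Local Notation mu := (@lebesgue_rV R d).

(* The library's norm `|x| on 'rV[R]_d is the sup norm. *)
Definition enorm (x : 'rV[R]_d) : R := Num.sqrt (\sum_i x ord0 i ^+ 2).

Definition is_density q :=
  [/\ measurable_fun setT q, forall x, 0 <= q x &
      (\int[mu]_x (q x)%:E = 1)%E].

Definition partial (i : 'I_d) f : 'rV[R]_d -> R :=
  fun x => 'D_(delta_mx ord0 i) f x.

Definition partial_derivable (i : 'I_d) f :=
  forall x, derivable f x (delta_mx ord0 i).

Definition C2 f :=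
  (forall i, partial_derivable i f /\ continuous (partial i f)) /\
  (forall i j, partial_derivable j (partial i f) /\
               continuous (partial j (partial i f))).

Definition bounded_second_derivatives f :=
  exists M : R, forall i j x, `|partial j (partial i f) x| <= M.

Definition polynomial_tail q :=
  exists C r : R, [/\ 0 < C, 0 < r & forall x, q x <= C * (1 + enorm x) `^ (- r)].

Definition smooth_target f := [/\ is_density f, C2 f & bounded_second_derivatives f].

Definition reference_density f q0 :=
  [/\ is_density q0,
      forall eta : R, 0 < eta <= 1 ->
        exists2 c : R, 0 < c & forall x, f x `^ eta <= c * q0 x &
      polynomial_tail q0].

Definition smoothing_kernel K :=
  [/\ is_density K,
      exists L : R, forall x y, `|K x - K y| <= L * enorm (x - y),
      forall i, (\int[mu]_u (u ord0 i * K u)%:E = 0)%E,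
      (\int[mu]_u (enorm u ^+ 2 * K u)%:E < +oo)%E &
      polynomial_tail K].

Definition rescale K (h : R) : 'rV[R]_d -> R :=
  fun u => K (h^-1 *: u) / h ^+ d.

Definition asymptotic_variance f g : R :=
  \int[mu]_x (g x ^+ 2 * f x) - (\int[mu]_x (g x * f x)) ^+ 2.

End densities.

Section probability_notions.
Context {R : realType} {disp : measure_display} {Omega : measurableType disp}.
Variable P : probability Omega R.

(* p is, on the event D, a version of the conditional probability of E given
   the sub-sigma-algebra F. *)
Definition cond_prob_on (F : set (set Omega)) (D E : set Omega)
    (p : Omega -> \bar R) :=
  (forall U : set (\bar R), measurable U -> F (D `&` p @^-1` U)) /\
  (forall A, F A -> A `<=` D -> (P (A `&` E) = \int[P]_(w in A) p w)%E).

(* v is the variance, whereas normal_prob takes the standard deviation; moreover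
   normal_prob m 0 is not the Dirac mass. *)
Definition normal_law (m v : R) : probability (measurableTypeR R) R :=
  if v == 0 then (@dirac _ (measurableTypeR R) m R : probability _ _)
  else normal_prob m (Num.sqrt v).

Definition cvg_in_distribution (Z : nat -> Omega -> R)
    (nu : probability (measurableTypeR R) R) :=
  (forall n, measurable_fun setT (Z n)) /\
  (forall phi : R -> R, continuous phi -> (exists M : R, forall x, `|phi x| <= M) ->
    (\int[P]_w (phi (Z n w))%:E)%E @[n --> \oo] --> (\int[nu]_x (phi x)%:E)%E).

End probability_notions.

Definition much_smaller {R : realType} (u v : nat -> R) :=
  u n / v n @[n --> \oo] --> (0 : R).

Section subsampling.
Context {R : realType} {d : nat} {disp : measure_display}
  {Omega : measurableType disp} {P : probability Omega R}.
Variables (fU q0 K : 'rV[R]_d -> R) (h lam : nat -> R) (ell : nat -> nat).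
(* Sequences are indexed from 1, X 0, Xs 0, h 0, lam 0, ell 0 being irrelevant;
   the bootstrap sample of step k is Xs k 0, ..., Xs k (ell k).-1. *)
Variables (X : nat -> {RV P >-> 'rV[R]_d}) (Xs : nat -> nat -> {RV P >-> 'rV[R]_d}).

Definition bootstrap_kde (k : nat) (w : Omega) (x : 'rV[R]_d) : R :=
  (ell k)%:R^-1 * \sum_(i < ell k) rescale K (h k) (x - Xs k i w).

Definition sampling_density (k : nat) (w : Omega) (x : 'rV[R]_d) : R :=
  if k is 0 then q0 x
  else (1 - lam k) * bootstrap_kde k w x + lam k * q0 x.

Definition weight (k : nat) (w : Omega) : R :=
  fU (X k w) / sampling_density k.-1 w (X k w).

Definition weight_sum (n : nat) (w : Omega) : R :=
  \sum_(1 <= j < n.+1) weight j w.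

Definition nweight (n k : nat) (w : Omega) : R := weight k w / weight_sum n w.

Definition weighted_empirical (k : nat) (w : Omega) (B : set 'rV[R]_d) : \bar R :=
  (\sum_(1 <= i < k.+1) (nweight k i w)%:E * \d_(X i w) B)%E.

(* sigma-algebra generated by X_1, ..., X_k and the bootstrap samples of steps
   1, ..., m *)
Definition history (k m : nat) : set (set Omega) :=
  <<s (\bigcup_(j in [set j | (1 <= j <= k)%N])
         preimage_set_system setT (X j) measurable) `|`
      (\bigcup_(j in [set j | (1 <= j <= m)%N])
         \bigcup_(i in `I_(ell j))
           preimage_set_system setT (Xs j i) measurable) >>.

(* Given the past, the draws of step k are i.i.d. with law weighted_empirical k,
   stated on rectangles. That law is a probability only where weight_sum k > 0
   (otherwise it is 0/0): nothing is required of the draws of step k on the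
   event where all the weights so far vanish. *)
Definition bootstrap_step (k : nat) :=
  forall B : nat -> set 'rV[R]_d, (forall i, measurable (B i)) ->
  cond_prob_on P (history k k.-1) [set w | 0 < weight_sum k w]
    (\bigcap_(i in `I_(ell k)) Xs k i @^-1` B i)
    (fun w => \prod_(i < ell k) weighted_empirical k w (B i))%E.

Definition sampling_step (k : nat) :=
  forall B : set 'rV[R]_d, measurable B ->
  cond_prob_on P (history k k) setT (X k.+1 @^-1` B)
    (fun w => \int[lebesgue_rV d]_(x in B) (sampling_density k w x)%:E)%E.

(* history 0 0 is trivial, so sampling_step 0 says that X_1 has density q0. *)
Definition subsampling_scheme :=
  (forall k, (1 <= k)%N -> bootstrap_step k) /\ (forall k, sampling_step k).

Definition weighted_estimate (g : 'rV[R]_d -> R) (n : nat) (w : Omega) : R :=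
  \sum_(1 <= k < n.+1) nweight n k w * g (X k w).

End subsampling.

(* Main.v *)
(* Normalise fU to f; this changes neither the scheme nor the estimate. Put
   W_k = f(X_k) / q_{k-1}(X_k), g0 = g - \int g f and S_n = \sum_k W_k g0(X_k), so
   that the error is S_n / \sum_k W_k. Given the past, X_{k+1} has density q_k,
   hence W_{k+1} u(X_{k+1}) has conditional mean \int u f: S_n is a martingale
   and \sum_k (W_k - 1) is one too, with second moment at most C n / lam_n, so
   that \sum_k W_k / n tends to 1.
   The conditional variance of W_{k+1} g0(X_{k+1}) is \int g0^2 f^2 / q_k. On the
   event \sum_{j <= k} W_j >= k / 2, the mean of (f*_k - f)^2 is bounded uniformly in
   x by C (1 / (l_k h_k^d) + 1 / (k lam_k h_k^d) + h_k^4), because the conditional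
   variance of the bootstrap is controlled by the weighted empirical law and
   the bias by Taylor's formula. With q_k >= lam_k q0 where q_k < f / 2 (an event whose
   probability Chebyshev's inequality bounds) and f^eta <= c q0, this shows that
   E \int g0^2 |f^2 / q_k - f| tends to 0. A martingale central limit theorem for the
   test functions cos(t x + a), Slutsky's lemma and Levy's continuity theorem,
   here through approximation by polynomials in sin(t x), conclude. *)

Require Import Defs.
From HB Require Import structures.
From mathcomp Require Import all_boot all_order all_algebra.
From mathcomp Require Import all_classical all_reals all_analysis.
From mathcomp Require Import measurable_realfun ring lra.

Set Implicit Arguments.
Unset Strict Implicit.
Unset Printing Implicit Defensive.

Import Order.TTheory GRing.Theory Num.Theory.
Import numFieldNormedType.Exports.

Local Open Scope classical_set_scope.
Local Open Scope ring_scope.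

(** By Tonelli the expected variance defect is \int g0^2 E|f^2/q_k - f|, so a mean-square bound on
    q_k - f at each x, uniform in x, is what has to be proved. The obstacle is that g0^2 is
    integrable only against q0: every bound must carry a factor q0. Where q_k < f/2 the integrand
    can reach f^2/(lam_k q0); Chebyshev's probability 4D/f^2, raised to the power 1 - eta, leaves
    f^(2 eta) <= (c q0)^2, hence a term of order q0 D^(1 - eta)/lam_k. As D is at most of order
    lam_k^(1 + eps), with eps capped at 1, this vanishes for small eta: here the exponent 1 + eps
    and the freedom of eta in (H2) meet. Elsewhere the small bound 2 sqrt D has no factor q0, and
    its minimum with 3 c1 q0 is handled by dominated convergence. Conditioning is done without
    kernels: the past is a measurable space of its own, and conditional laws become joint laws
    determined on rectangles, or weighted image laws. The limit theorem follows suit: increments are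
    tested only against cosines of the past sum, so L^1 convergence of the conditional variances is
    enough. *)

Section real_sequences.
Context {R : realType}.

Lemma cvg0_le (u v : nat -> R) : (\forall n \near \oo, 0 <= u n <= v n) ->
  v n @[n --> \oo] --> (0 : R) -> u n @[n --> \oo] --> (0 : R).
Proof.
move=> uv v0; apply: (squeeze_cvgr (f := fun=> 0) (h := v)) => //.
exact: cvg_cst.
Qed.

Lemma powR_cvg0 (u : nat -> R) (s : R) : 0 < s -> (\forall n \near \oo, 0 <= u n) ->
  u n @[n --> \oo] --> (0 : R) -> u n `^ s @[n --> \oo] --> (0 : R).
Proof.
move=> s0 u0 cu; apply/cvgr0Pnorm_lt => e e0.
have e1 : 0 < e `^ s^-1 by exact: powR_gt0.
near=> n; have un0 : 0 <= u n by near: n.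
rewrite ger0_norm ?powR_ge0//.
have -> : e = (e `^ s^-1) `^ s by rewrite -powRrM mulVf ?lt0r_neq0// powRr1 ?ltW.
rewrite gt0_ltr_powR//.
  by rewrite nnegrE powR_ge0.
rewrite -[u n]ger0_norm//; near: n.
by move/cvgr0Pnorm_lt : cu; exact.
Unshelve. all: by end_near. Qed.

Lemma powR_cvg0_inv (u : nat -> R) (s : R) : 0 < s -> (\forall n \near \oo, 0 <= u n) ->
  u n `^ s @[n --> \oo] --> (0 : R) -> u n @[n --> \oo] --> (0 : R).
Proof.
move=> s0 u0 cu; have s1 : 0 < s^-1 by rewrite invr_gt0.
have us0 : \forall n \near \oo, 0 <= u n `^ s by near=> n; exact: powR_ge0.
have H := powR_cvg0 s1 us0 cu.
apply: (cvg0_le _ H); near=> n; have un0 : 0 <= u n by near: n.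
by rewrite un0/= -powRrM mulfV ?lt0r_neq0// powRr1.
Unshelve. all: by end_near. Qed.

Lemma mean_cvg (u : nat -> R) (l : R) : u n @[n --> \oo] --> l ->
  n%:R^-1 * \sum_(k < n) u k @[n --> \oo] --> l.
Proof.
move=> /cesaro; rewrite -(cvg_shiftS (fun n => n%:R^-1 * \sum_(k < n) u k : R)).
rewrite /arithmetic_mean /= => h; apply: cvg_trans h.
by apply: near_eq_cvg; apply: nearW => n; rewrite /= /series/= big_mkord.
Qed.

End real_sequences.

Lemma Rintegral_sum d (T : measurableType d) (R : realType) (mu : {measure set T -> \bar R})
    (I : Type) (s : seq I) (F : I -> T -> R) :
  (forall i, mu.-integrable setT (EFin \o F i)) ->
  \int[mu]_x (\sum_(i <- s) F i x) = \sum_(i <- s) \int[mu]_x F i x.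
Proof.
move=> iF; elim: s => [|i s IH].
  by under eq_Rintegral do rewrite big_nil; rewrite big_nil /Rintegral integral0.
under eq_Rintegral do rewrite big_cons.
rewrite big_cons RintegralD// ?IH//.
rewrite (_ : EFin \o _ = fun x => (\sum_(j <- s) (F j x)%:E)%E); last first.
  by apply/funext => x; rewrite /= sumEFin.
by apply: integrable_sum => // j _; exact: iF.
Qed.

(** * Conditional laws given by a density *)

Section density_measure.
Context d (T : measurableType d) (R : realType) (mu : {measure set T -> \bar R}).
Import HBNNSimple.
Local Open Scope ereal_scope.

(** The proofs that q is measurable and nonnegative are arguments, so that the measure structure
    declared below can be inferred from the term itself. *)
Definition mdensity (q : T -> R) of measurable_fun setT q &
  (forall x, (0 <= q x)%R) := fun A => \int[mu]_(x in A) (q x)%:E.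

Variables (q : T -> R) (mq : measurable_fun setT q) (q0 : forall x, (0 <= q x)%R).

Let mqE : measurable_fun setT (EFin \o q).
Proof. exact/measurable_EFinP. Qed.

Let mdensity0 : mdensity mq q0 set0 = 0.
Proof. by rewrite /mdensity integral_set0. Qed.

Let mdensity_ge0 A : 0 <= mdensity mq q0 A.
Proof. by apply: integral_ge0 => x _; rewrite lee_fin. Qed.

Let mdensity_sigma_additive : semi_sigma_additive (mdensity mq q0).
Proof.
move=> F mF tF mUF; rewrite /mdensity ge0_integral_bigcup//; last 2 first.
- exact: measurable_funTS.
- by move=> x _; rewrite lee_fin.
by apply: is_cvg_ereal_nneg_natsum => n _; apply: integral_ge0 => x _; rewrite lee_fin.
Qed.

HB.instance Definition _ := isMeasure.Build _ _ _ (mdensity mq q0)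
  mdensity0 mdensity_ge0 mdensity_sigma_additive.

(** Monotone convergence along simple approximations of f, on both sides, reduces the identity to
    indicators, where it is the definition of the measure. *)
Lemma ge0_integral_mdensity (f : T -> \bar R) :
  measurable_fun setT f -> (forall x, 0 <= f x) ->
  \int[mdensity mq q0]_x f x = \int[mu]_x (f x * (q x)%:E).
Proof.
move=> mf f0; pose f_ := nnsfun_approx measurableT mf.
transitivity (limn (fun n => \int[mdensity mq q0]_x (f_ n x)%:E)).
  rewrite -monotone_convergence//=.
  - apply: eq_integral => x _; apply/esym/cvg_lim => //=.
    exact: cvg_nnsfun_approx.
  - by move=> n; apply: measurableT_comp.
  - by move=> n x _; rewrite lee_fin.
  - by move=> x _ a b ab; rewrite lee_fin//; exact/lefP/nd_nnsfun_approx.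
transitivity (limn (fun n => \int[mu]_x ((f_ n x)%:E * (q x)%:E))); last first.
  rewrite -monotone_convergence//=.
  - apply: eq_integral => x _; rewrite limeMr//.
      by congr (_ * _); apply/cvg_lim => //; exact: cvg_nnsfun_approx.
    by apply: ereal_nondecreasing_is_cvgn => a b ab; rewrite lee_fin; exact/lefP/nd_nnsfun_approx.
  - by move=> n; apply: emeasurable_funM => //; exact: measurableT_comp.
  - by move=> n x _; rewrite mule_ge0// lee_fin.
  - move=> x _ a b ab; apply: lee_wpmul2r; rewrite lee_fin//.
    exact/lefP/nd_nnsfun_approx.
congr (limn _); apply/funext => n.
transitivity (\sum_(k \in range (f_ n))
    \int[mdensity mq q0]_x (k * \1_(f_ n @^-1` [set k]) x)%:E).
  under eq_integral do rewrite fimfunE -fsumEFin//.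
  rewrite ge0_integral_fsum//.
  - by move=> y; exact/measurable_EFinP/measurable_funM.
  - by move=> y x _; rewrite nnfun_muleindic_ge0.
transitivity (\int[mu]_x (\sum_(k \in range (f_ n))
    ((k * \1_(f_ n @^-1` [set k]) x)%:E * (q x)%:E))); last first.
  apply: eq_integral => x _; rewrite [in RHS]fimfunE -fsumEFin//.
  rewrite ge0_mule_fsuml// => r; exact: nnfun_muleindic_ge0.
rewrite ge0_integral_fsum//; last 2 first.
- by move=> r; apply: emeasurable_funM => //; exact/measurable_EFinP/measurable_funM.
- by move=> r x _; apply: mule_ge0; rewrite ?lee_fin// -lee_fin EFinM nnfun_muleindic_ge0.
apply: eq_fsbigr => r _; rewrite integralZl_indic_nnsfun//.
(* The membership of r in the range has been dropped; for negative r the preimage under a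
   nonnegative function is empty and both sides vanish. *)
have [r0|r0] := leP 0%R r; last first.
  rewrite preimage_nnfun0//.
  under eq_integral do rewrite indic0.
  rewrite integral0 mule0; under eq_integral do rewrite indic0 mulr0 mul0e.
  by rewrite integral0.
under [RHS]eq_integral do rewrite EFinM -muleA.
rewrite [RHS]ge0_integralZl//; last first.
- by move=> x _; rewrite mule_ge0// lee_fin.
- by apply: emeasurable_funM => //; exact/measurable_EFinP.
congr (_ * _); rewrite integral_indic// setIT /= /mdensity integral_mkcond.
apply: eq_integral => x _; rewrite patchE indicE; case: ifP => _.
  by rewrite mul1e.
by rewrite mul0e.
Qed.

End density_measure.

(** Rectangles form a generating pi-system, and finiteness of [m1] lets the constant sequence [setT]
    serve as the exhausting sequence. *)
Lemma measure_unique_rect d1 d2 (T1 : measurableType d1) (T2 : measurableType d2)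
    (R : realType) (m1 m2 : {measure set (T1 * T2) -> \bar R}) :
  (m1 setT < +oo)%E ->
  (forall A B, measurable A -> measurable B -> m1 (A `*` B) = m2 (A `*` B)) ->
  forall C, measurable C -> m1 C = m2 C.
Proof.
move=> m1oo m12 C mC.
apply: (@measure_unique _ R _ [set A `*` B | A in measurable & B in measurable]
  (fun=> setT)) => //.
- exact: measurable_prod_measurableType.
- move=> _ _ [A1 mA1 [B1 mB1 <-]] [A2 mA2 [B2 mB2 <-]].
  exists (A1 `&` A2); first exact: measurableI.
  by exists (B1 `&` B2); [exact: measurableI|rewrite setXI].
- by move=> _; exists setT => //; exists setT => //; rewrite setXTT.
- by rewrite bigcup_const//; exists 0%N.
- by move=> _ [A mA [B mB <-]]; exact: m12.
Qed.

(** * Sub-sigma-algebras as measurable spaces *)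

Section sub_sigma_algebra.
Context d (T : measurableType d) (G : set (set T)).
Hypothesis GT : G `<=` measurable.

Lemma g_sigma_algebra_measurable (A : set (g_sigma_algebraType G)) :
  measurable A -> @measurable _ T A.
Proof. by apply: smallest_sub => //; exact: sigma_algebra_measurable. Qed.

Lemma measurable_fun_g_sigma d' (T' : measurableType d')
  (f : T -> T') :
  measurable_fun setT (f : g_sigma_algebraType G -> T') -> measurable_fun setT f.
Proof.
move=> mf _ Y mY; rewrite setTI; apply: g_sigma_algebra_measurable.
by rewrite -[X in measurable X]setTI; exact: mf.
Qed.

Lemma measurable_id_g_sigma : measurable_fun setT (id : T -> g_sigma_algebraType G).
Proof. by move=> _ Y mY; rewrite setTI; exact: g_sigma_algebra_measurable. Qed.

End sub_sigma_algebra.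

Section conditional_law.
Context d (T : measurableType d) (R : realType) (P : probability T R).
Context d' (E : measurableType d') (nu : {sigma_finite_measure set E -> \bar R}).
Variables (G : set (set T)) (GT : G `<=` measurable).
Variables (Y : T -> E) (mY : measurable_fun setT Y).
Variable q : g_sigma_algebraType G * E -> R.
Hypotheses (mq : measurable_fun setT q) (q0 : forall z, 0 <= q z).
Hypothesis lawY : forall A B, <<s G >> A -> measurable B ->
  (P (A `&` Y @^-1` B) = \int[P]_(w in A) \int[nu]_(x in B) (q (w, x))%:E)%E.
Local Open Scope ereal_scope.

(** As a map into the sub-sigma-algebra, the identity has for law the restriction of P to [<<s G>>].
    The conditional density of Y thus becomes the density of the joint law of (identity, Y) with
    respect to the product of that restriction with [nu]. *)
Let idG : T -> g_sigma_algebraType G := id.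
Let midG := @isMeasurableFun.Build _ _ _ _ idG (measurable_id_g_sigma GT).
Let idRV : {RV P >-> g_sigma_algebraType G} := HB.pack idG midG.

Let pY (w : T) : g_sigma_algebraType G * E := (w, Y w).
Let mpY : measurable_fun setT pY.
Proof.
by apply/measurable_fun_pairP; split => //; exact: measurable_id_g_sigma.
Qed.
Let mfpY := @isMeasurableFun.Build _ _ _ _ pY mpY.
Let pYRV : {RV P >-> (g_sigma_algebraType G * E)%type} := HB.pack pY mfpY.

Let m2 := mdensity (distribution P idRV \x nu) mq q0.

(** On a rectangle this is [lawY] once the inner integrals are restricted to A and B;
    [measure_unique_rect] extends it to the product sigma-algebra. *)
Let dist_m2 C : measurable C -> distribution P pYRV C = m2 C.
Proof.
move=> mC.
apply: (@measure_unique_rect _ _ _ _ _ (distribution P pYRV) m2) => // [|A B mA mB].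
  rewrite [ltLHS](_ : _ = 1) ?ltry//; exact: probability_setT.
transitivity (P (A `&` Y @^-1` B)) => //.
rewrite lawY// /m2 /mdensity.
pose qAB := (fun z => (q z)%:E) \_ (A `*` B).
have mqAB : measurable_fun setT qAB.
  apply/(measurable_restrictT _ (measurableX mA mB)).
  exact/measurable_funTS/measurable_EFinP.
have qAB0 z : 0 <= qAB z by apply: erestrict_ge0 => {}z _; rewrite lee_fin.
pose iq (w : T) := \int[nu]_x qAB (w, x).
have miq := measurable_fun_fubini_tonelli_F (m2 := nu) _ mqAB qAB0.
transitivity (\int[P]_w iq w).
  rewrite integral_mkcond; apply: eq_integral => w _; rewrite patchE /iq.
  case: ifPn => wA.
    rewrite integral_mkcond; apply: eq_integral => x _; rewrite /qAB !patchE.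
    by rewrite in_setX wA.
  rewrite [RHS]integral0_eq// => x _.
  by rewrite /qAB patchE in_setX (negbTE wA).
rewrite [RHS]integral_mkcond -/qAB fubini_tonelli1// ge0_integral_distribution//.
by move=> w; apply: integral_ge0.
Qed.

(** The test function may involve the past as well as Y: under the joint law this is a plain
    integral, which Tonelli splits. *)
Lemma ge0_integral_cond_law (psi : g_sigma_algebraType G * E -> \bar R) :
  measurable_fun setT psi -> (forall z, 0 <= psi z) ->
  \int[P]_w psi (w, Y w) = \int[P]_w \int[nu]_x (psi (w, x) * (q (w, x))%:E).
Proof.
move=> mpsi psi0.
transitivity (\int[distribution P pYRV]_z psi z).
  by rewrite ge0_integral_distribution.
rewrite (eq_measure_integral m2); last by move=> C mC _; exact: dist_m2.
rewrite ge0_integral_mdensity//.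
have mpq : measurable_fun setT (fun z => psi z * (q z)%:E).
  by apply: emeasurable_funM => //; exact/measurable_EFinP.
have pq0 z : 0 <= psi z * (q z)%:E by rewrite mule_ge0// lee_fin.
rewrite fubini_tonelli1// ge0_integral_distribution//.
- exact: measurable_fun_fubini_tonelli_F.
- by move=> w; apply: integral_ge0.
Qed.

Lemma integral_cond_law (psi : g_sigma_algebraType G * E -> R) :
  measurable_fun setT psi ->
  \int[P]_w \int[nu]_x (`|psi (w, x)| * q (w, x))%:E < +oo ->
  P.-integrable setT (fun w => (psi (w, Y w))%:E) /\
  \int[P]_w (psi (w, Y w))%:E = \int[P]_w \int[nu]_x (psi (w, x) * q (w, x))%:E.
Proof.
move=> mpsi poo.
have mpsiY : measurable_fun setT (fun w => psi (w, Y w)).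
  exact: (measurableT_comp mpsi mpY).
have iY : P.-integrable setT (fun w => (psi (w, Y w))%:E).
  apply/integrableP; split; first exact/measurable_EFinP.
  rewrite (ge0_integral_cond_law (psi := fun z => `|psi z|%:E))//.
  by apply/measurable_EFinP; exact: measurableT_comp.
split => //.
have mpq : measurable_fun setT (fun z => (psi z * q z)%:E).
  by apply/measurable_EFinP; exact: measurable_funM.
have ipq : (distribution P idRV \x nu).-integrable setT (fun z => (psi z * q z)%:E).
  apply/integrable12ltyP => //.
  rewrite ge0_integral_distribution//=.
  - rewrite (_ : \int[P]_x _ = \int[P]_w \int[nu]_x (`|psi (w, x)| * q (w, x))%:E)//.
    apply: eq_integral => w _; apply: eq_integral => x _.
    by rewrite /= normrM (ger0_norm (q0 _)).
  - apply: (measurable_fun_fubini_tonelli_F (m2 := nu) (fun z => `|(psi z * q z)%:E|)) => //.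
    exact: measurableT_comp.
  - by move=> w; exact: integral_ge0.
transitivity (\int[distribution P pYRV]_z (psi z)%:E).
  rewrite integral_distribution//; exact/measurable_EFinP.
rewrite (eq_measure_integral m2); last by move=> C mC _; exact: dist_m2.
transitivity (\int[distribution P idRV \x nu]_z (psi z * q z)%:E).
  have qK z : (psi z * q z)%:E = (psi z)%:E * (q z)%:E by [].
  (* The density formula is available for nonnegative functions, so positive and negative parts are
     treated apart; the factor q passes through both because it is nonnegative. *)
  rewrite integralE [RHS]integralE !ge0_integral_mdensity//.
  - congr (_ - _); apply: eq_integral => z _.
      rewrite !funeposE qK -[0 in RHS](mul0e (q z)%:E) -maxe_pMl//.
      by rewrite lee_fin.
    by rewrite !funenegE qK -mulNe -[0 in RHS](mul0e (q z)%:E) -maxe_pMl// lee_fin.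
  - exact/measurable_funeneg/measurable_EFinP.
  - exact/measurable_funepos/measurable_EFinP.
rewrite -integral12_prod_meas1//.
have iF := integrable_fubini_F ipq.
have mF := measurable_int _ iF.
rewrite integral_distribution//; apply/integrableP; split.
  by apply: measurableT_comp => //; exact: measurable_id_g_sigma.
move/integrableP : iF => [_]; rewrite ge0_integral_distribution//.
exact: measurableT_comp.
Qed.

End conditional_law.

(** * Fourier transform of the Gaussian law *)

Section integrable_EFin.
Context d (T : measurableType d) (R : realType) (mu : {measure set T -> \bar R}).
Implicit Types f g h : T -> R.

Lemma integrable_le_norm f g : measurable_fun setT f -> (forall x, `|f x| <= g x) ->
  mu.-integrable setT (EFin \o g) -> mu.-integrable setT (EFin \o f).
Proof.
move=> mf fg; apply: le_integrable => //; first exact/measurable_EFinP.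
by move=> x _ /=; rewrite lee_fin (le_trans (fg x))// ler_norm.
Qed.

Lemma integrable_bounded_mul h g C : measurable_fun setT h ->
  (forall x, `|h x| <= C) -> mu.-integrable setT (EFin \o g) ->
  mu.-integrable setT (EFin \o (fun x => h x * g x)).
Proof.
move=> mh h1 ig.
have mg : measurable_fun setT g by apply/measurable_EFinP/(measurable_int _ ig).
have : mu.-integrable setT (fun x => C%:E * (`|g x|)%:E)%E.
  by apply: integrableZl => //; exact: integrable_norm.
move/(@le_integrable _ _ _ _ _ _ (EFin \o (fun x => h x * g x))); apply => //.
  exact/measurable_EFinP/measurable_funM.
move=> x _ /=; rewrite lee_fin normrM (le_trans _ (ler_norm _))// ler_wpM2r//.
Qed.

Lemma integrable_addr f g : mu.-integrable setT (EFin \o f) ->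
  mu.-integrable setT (EFin \o g) -> mu.-integrable setT (EFin \o (fun x => f x + g x)).
Proof. by move=> If Ig; exact: (integrableD measurableT If Ig). Qed.

Lemma integrable_subr f g : mu.-integrable setT (EFin \o f) ->
  mu.-integrable setT (EFin \o g) -> mu.-integrable setT (EFin \o (fun x => f x - g x)).
Proof. by move=> If Ig; exact: (integrableB measurableT If Ig). Qed.

Lemma integrable_mulrl c f : mu.-integrable setT (EFin \o f) ->
  mu.-integrable setT (EFin \o (fun x => c * f x)).
Proof. exact: (integrable_bounded_mul (h := fun=> c) (C := `|c|)). Qed.

End integrable_EFin.

Lemma measurable_cos_affine d (T : measurableType d) (R : realType) (Y : T -> R) (a b : R) :
  measurable_fun setT Y -> measurable_fun setT (fun w => cos (a * Y w + b)).
Proof.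
move=> mY; apply: (measurableT_comp (continuous_measurable_fun (@continuous_cos R))).
by apply: measurable_funD => //; exact: measurable_funM.
Qed.

Section probability_integral.
Context d (T : measurableType d) (R : realType) (P : probability T R).
Implicit Types (Y Z : T -> R) (a b c : R).

Lemma integrable_probability_cst c : P.-integrable setT (EFin \o (fun=> c)).
Proof. exact: finite_measure_integrable_cst. Qed.

Lemma Rintegral_probability_cst c : \int[P]_w c = c.
Proof. by rewrite /Rintegral integral_cst//= (@probability_setT _ _ _ P) mule1. Qed.

Lemma bounded_integrable Z c : measurable_fun setT Z -> (forall w, `|Z w| <= c) ->
  P.-integrable setT (EFin \o Z).
Proof. by move=> mZ Zc; exact: (integrable_le_norm mZ Zc (integrable_probability_cst c)). Qed.

Lemma integrable_cos_affine Y a b : measurable_fun setT Y ->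
  P.-integrable setT (EFin \o (fun w => cos (a * Y w + b))).
Proof.
move=> mY; apply: (@bounded_integrable _ 1); first exact: measurable_cos_affine.
by move=> w; exact: cos_max.
Qed.

End probability_integral.

(** Integrals over [-(n+1), n+1] are increments of h and tend to the full integral by dominated
    convergence. This is integration by parts on the line, with boundary terms at infinity; n + 1
    keeps the intervals nondegenerate. *)
Lemma integral_derive_eq0 (R : realType) (h h' : R -> R) :
  (forall x, is_derive x (1 : R) (h : R -> R) (h' x)) -> continuous h' ->
  (@lebesgue_measure R).-integrable setT (EFin \o h') ->
  h n.+1%:R @[n --> \oo] --> (0 : R) -> h (- n.+1%:R) @[n --> \oo] --> (0 : R) ->
  (\int[@lebesgue_measure R]_x (h' x)%:E = 0)%E.
Proof.
move=> dh ch ih hy hNy.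
have ch0 : continuous h.
  by move=> x; apply: differentiable_continuous; apply/derivable1_diffP; case: (dh x).
pose I n : set R := `[- n.+1%:R, n.+1%:R]%classic.
pose f_ n : R -> \bar R := (EFin \o h') \_ (I n).
have mh' : measurable_fun setT h' by exact: continuous_measurable_fun.
have key n : (\int[@lebesgue_measure R]_x f_ n x = (h n.+1%:R - h (- n.+1%:R))%:E)%E.
  rewrite -integral_mkcond (continuous_FTC2 (F := h))//.
  - by rewrite lt_neqAle; apply/andP; split; have : 0 < n.+1%:R :> R by []; lra.
  - exact: continuous_subspaceT.
  - split.
    + by move=> x _; case: (dh x).
    + exact: cvg_at_right_filter (ch0 _).
    + exact: cvg_at_left_filter (ch0 _).
  - by move=> x _; rewrite derive1E derive_val.
have fcvg x : f_ ^~ x @ \oo --> (h' x)%:E.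
  apply: cvg_near_cst; near=> n; rewrite /f_ patchE ifT// inE /I/= in_itv/= -ler_norml.
  near: n; exists (Num.truncn `|x|) => // n /= xn.
  by rewrite (le_trans (ltW (truncnS_gt _)))// ler_nat.
have [] := @dominated_convergence _ _ _ (@lebesgue_measure R) setT measurableT
   f_ (EFin \o h') (abse \o (EFin \o h')).
- move=> n; apply/(measurable_restrictT _ (measurable_itv _)).
  exact/measurable_funTS/measurable_EFinP.
- exact/measurable_EFinP.
- by apply: aeW => x _; exact: fcvg.
- exact: integrable_abse.
- apply: aeW => x n _; rewrite /f_ patchE /=; case: ifP => // _.
  by rewrite [point](_ : _ = 0%E)// abse0 lee_fin.
move=> _ _ fint; apply: (cvg_unique _ fint) => //.
rewrite /= (_ : (fun n => _) = (fun n => (h n.+1%:R - h (- n.+1%:R))%:E)); last exact/funext.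
rewrite -[0%E]/((0 : R)%:E); apply: cvg_EFin; first exact: nearW.
by rewrite /= -[X in _ --> X](subr0 0); apply: cvgB.
Unshelve. all: end_near. Qed.

Lemma is_derive_sin_affine (R : realType) (a b x : R) :
  is_derive x (1 : R) ((fun y => sin (a * y + b)) : R -> R) (a * cos (a * x + b)).
Proof.
rewrite mulrC; apply: (is_derive1_comp (f := sin) (g := fun y => a * y + b)).
by apply: is_derive_eq; rewrite /GRing.scale/= mulr1 addr0.
Qed.

Lemma is_derive_cos_affine (R : realType) (a b x : R) :
  is_derive x (1 : R) ((fun y => cos (a * y + b)) : R -> R) (- (a * sin (a * x + b))).
Proof.
rewrite mulrC -mulNr; apply: (is_derive1_comp (f := cos) (g := fun y => a * y + b)).
by apply: is_derive_eq; rewrite /GRing.scale/= mulr1 addr0.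
Qed.

Section gaussian_fourier.
Context (R : realType) (s : R) (s0 : 0 < s).
Local Notation mu := (@lebesgue_measure R).
Local Notation p := (normal_pdf 0 s).

Let s_neq0 : s != 0. Proof. exact: lt0r_neq0. Qed.

Let pE x : p x = normal_peak s * expR (- (x ^+ 2 / (s ^+ 2 *+ 2))).
Proof.
by rewrite normal_pdfE//= /normal_fun subr0 mulNr.
Qed.

Let p_derive x : is_derive x (1 : R) (p : R -> R) (- (x / s ^+ 2) * p x).
Proof.
rewrite (_ : normal_pdf 0 s = fun x => normal_peak s * expR (- (x ^+ 2 / (s ^+ 2 *+ 2)))); last first.
  by apply/funext => y; exact: pE.
apply: is_derive_eq.
rewrite /GRing.scale/=.
field.
exact: s_neq0.
Qed.

Let norm_expR_le (t : R) : 0 <= t -> t * expR (- (t ^+ 2 / 2)) <= 2 * expR (- (t ^+ 2 / 8)).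
Proof.
move=> t0.
have -> : - (t ^+ 2 / 2) = - (t ^+ 2 / 8) + - (3 * (t ^+ 2 / 8)) by lra.
rewrite expRD mulrCA mulrC ler_pM2r ?expR_gt0//.
have h : t / 2 <= expR (t ^+ 2 / 8).
  apply: le_trans (expR_ge1Dx _); have := sqr_ge0 (t - 2); lra.
apply: (@le_trans _ _ (t * expR (- (t ^+ 2 / 8)))).
  rewrite ler_wpM2l// ler_expR; have := sqr_ge0 t; lra.
by rewrite expRN ler_pdivrMr ?expR_gt0//; lra.
Qed.

(** Chosen so that |x| p(x) is at most C times the centred Gaussian density of standard deviation 2
    s: the factor |x| is paid for by widening. The 2 comes from [norm_expR_le], the s from the
    scaling x = s t. *)
Let C := 2 * s * normal_peak s / normal_peak (2 * s).

Let s20 : 2 * s != 0. Proof. by rewrite mulf_neq0. Qed.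

Let norm_p_le x : `|x| * p x <= C * normal_pdf 0 (2 * s) x.
Proof.
rewrite pE normal_pdfE//= /normal_fun subr0 /C.
rewrite [leRHS](_ : _ = normal_peak s * s * (2 * expR (- ((`|x| / s) ^+ 2 / 8)))); last first.
  have h0 : normal_peak (2 * s) != 0 by rewrite gt_eqF// normal_peak_gt0.
  rewrite mulNr expr_div_n real_normK ?num_real//.
  rewrite (_ : x ^+ 2 / ((2 * s) ^+ 2 *+ 2) = x ^+ 2 / s ^+ 2 / 8); last by field; exact: s_neq0.
  by field.
rewrite [leLHS](_ : _ = normal_peak s * s * (`|x| / s * expR (- ((`|x| / s) ^+ 2 / 2)))); last first.
  rewrite expr_div_n real_normK ?num_real//.
  rewrite (_ : x ^+ 2 / s ^+ 2 / 2 = x ^+ 2 / (s ^+ 2 *+ 2)); last by field; exact: s_neq0.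
  by field; exact: s_neq0.
rewrite ler_wpM2l ?mulr_ge0 ?normal_peak_ge0 ?(ltW s0)//.
by apply: norm_expR_le; rewrite divr_ge0// ltW.
Qed.

Let ip : mu.-integrable setT (EFin \o p).
Proof. exact: integrable_normal_pdf. Qed.

Let mp : measurable_fun setT p. Proof. exact: measurable_normal_pdf. Qed.

Let ixp : mu.-integrable setT (EFin \o (fun x => `|x| * p x)).
Proof.
apply: (integrable_le_norm (mu := mu) (g := fun x => C * normal_pdf 0 (2 * s) x)).
- by apply: measurable_funM.
- by move=> x; rewrite ger0_norm ?mulr_ge0 ?normal_pdf_ge0.
- by apply: (integrable_bounded_mul (mu := mu) (h := fun=> C) (C := `|C|)) => //; exact: integrable_normal_pdf.
Qed.

Variable al : R.

Let mcos th : measurable_fun setT (fun x : R => cos (th * x + al)).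
Proof. exact: measurable_cos_affine. Qed.

Let msin th : measurable_fun setT (fun x : R => sin (th * x + al)).
Proof.
apply: (measurableT_comp (f := sin)); first exact: (continuous_measurable_fun (@continuous_sin R)).
by apply: measurable_funD => //; exact: measurable_funM.
Qed.

Let F th := \int[mu]_x (cos (th * x + al) * p x).

(** Differentiation under the integral sign, dominated by |x| p(x) for all frequencies at once. *)
Let F_derive th : is_derive th (1 : R) (F : R -> R)
  (\int[mu]_x (- (x * sin (th * x + al) * p x))).
Proof.
pose f (t x : R) := cos (t * x + al) * p x.
have df t x : is_derive (t : R) (1 : R) (f ^~ x : R -> R) (- (x * sin (t * x + al) * p x)).
  apply: is_derive_eq.
  rewrite /GRing.scale/=.
  by ring.
have inf t : mu.-integrable setT (EFin \o f t).
  by apply: (integrable_bounded_mul (mu := mu) (h := fun x => cos (t * x + al)) (C := 1)) => //; [exact: mcos|move=> x; exact: cos_max].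
have Ith : `]th - 1, th + 1[%classic th.
  rewrite /= in_itv/=; lra.
have fub t x : `]th - 1, th + 1[%classic t -> setT x -> `|partial1of2 f t x| <= `|x| * p x.
  move=> _ _; rewrite partial1of2E derive_val normrN !normrM (ger0_norm (normal_pdf_ge0 _ _ _)).
  by rewrite ler_wpM2r ?normal_pdf_ge0// ler_piMr// sin_max.
have G0 (x : R) : 0 <= `|x| * p x by rewrite mulr_ge0 ?normal_pdf_ge0.
split.
  by apply: (derivable_under_integral (mu := mu) (f := f) measurableT Ith (fun t _ => inf t) (fun t x _ _ => ex_derive (is_derive := df t x)) G0 ixp fub).
rewrite -derive1E (differentiation_under_integral (mu := mu) (f := f) measurableT Ith (fun t _ => inf t) (fun t x _ _ => ex_derive (is_derive := df t x)) G0 ixp fub)//.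
by apply: eq_Rintegral => x _; rewrite partial1of2E derive_val.
Qed.

Let icos th : mu.-integrable setT (EFin \o (fun x => cos (th * x + al) * p x)).
Proof.
by apply: (integrable_bounded_mul (mu := mu) (h := fun x => cos (th * x + al)) (C := 1)) => //; [exact: mcos|move=> x; exact: cos_max].
Qed.

Let ixsin th : mu.-integrable setT (EFin \o (fun x => x * sin (th * x + al) * p x)).
Proof.
apply: (integrable_le_norm (mu := mu) (g := fun x => `|x| * p x)) => //.
  by apply: measurable_funM; [apply: measurable_funM => //; exact: msin|exact: mp].
move=> x; rewrite !normrM (ger0_norm (normal_pdf_ge0 _ _ _)).
by rewrite ler_wpM2r ?normal_pdf_ge0// ler_piMr// sin_max.
Qed.

Let p_cvg0 (u : nat -> R) : (forall n, `|u n| = n.+1%:R) -> p (u n) @[n --> \oo] --> (0 : R).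
Proof.
move=> un; pose D := C * normal_peak (2 * s).
have C0 : 0 <= C by rewrite /C !mulr_ge0 ?normal_peak_ge0 ?invr_ge0 ?normal_peak_ge0 ?(ltW s0).
apply: (@squeeze_cvgr _ _ _ _ (cst 0) (fun n => D * n.+1%:R^-1)).
- near=> n; rewrite normal_pdf_ge0/= ler_pdivlMr// mulrC -un.
  rewrite (le_trans (norm_p_le _))// ler_wpM2l// normal_pdf_ub//.
- exact: cvg_cst.
- rewrite -[X in _ --> X](mulr0 D); apply: cvgMr; exact: cvg_harmonic.
Unshelve. all: end_near. Qed.

Let h' th x : R := - (x / s ^+ 2) * p x * sin (th * x + al) + th * (cos (th * x + al) * p x).

Let dh th x : is_derive (x : R) (1 : R) ((fun x => p x * sin (th * x + al)) : R -> R) (h' th x).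
Proof.
have := @is_derive_sin_affine R th al x; have := p_derive x => dp dsin.
by apply: is_derive_eq; rewrite /h' /GRing.scale/=; ring.
Qed.

Let ch' th : continuous (h' th).
Proof.
have cs : continuous (fun x : R => sin (th * x + al)).
  move=> x; apply: differentiable_continuous; apply/derivable1_diffP.
  by case: (@is_derive_sin_affine R th al x).
have cc : continuous (fun x : R => cos (th * x + al)).
  move=> x; apply: differentiable_continuous; apply/derivable1_diffP.
  by case: (@is_derive_cos_affine R th al x).
have cp : continuous p by exact: continuous_normal_pdf.
move=> x; rewrite /h'; apply: cvgD.
  apply: cvgM; last exact: cs.
  by apply: cvgM; [apply: cvgN; apply: cvgMl; exact: cvg_id|exact: cp].
by apply: cvgMr; apply: cvgM; [exact: cc|exact: cp].
Qed.

Let h'E th : h' th = fun x => - s ^- 2 * (x * sin (th * x + al) * p x) + th * (cos (th * x + al) * p x).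
Proof. by apply/funext => x; rewrite /h'; ring. Qed.

(** [h' th] is the derivative of p(x) sin(th x + al), so its integral vanishes; since p' = - x p /
    s^2, this expresses the sine integral through F. *)
Let by_parts th : \int[mu]_x (- (x * sin (th * x + al) * p x)) = - (s ^+ 2 * th) * F th.
Proof.
have ih : mu.-integrable setT (EFin \o h' th).
  rewrite h'E.
  exact: (integrableD (mu := mu) measurableT (integrable_mulrl (- s ^- 2) (ixsin th)) (integrable_mulrl th (icos th))).
have h0 : \int[mu]_x h' th x = 0.
  rewrite /Rintegral (integral_derive_eq0 (dh th))//.
  - apply: (@squeeze_cvgr _ _ _ _ (fun n => - p n.+1%:R) (fun n => p n.+1%:R)).
    + apply: nearW => n; rewrite -ler_norml normrM ger0_norm ?normal_pdf_ge0//.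
      by rewrite ler_piMr ?normal_pdf_ge0// sin_max.
    + have /cvgN := @p_cvg0 (fun n => n.+1%:R) (fun n => ger0_norm (ler0n _ _)).
      by rewrite oppr0.
    + by apply: p_cvg0 => n; rewrite ger0_norm.
  - apply: (@squeeze_cvgr _ _ _ _ (fun n => - p (- n.+1%:R)) (fun n => p (- n.+1%:R))).
    + apply: nearW => n; rewrite -ler_norml normrM ger0_norm ?normal_pdf_ge0//.
      by rewrite ler_piMr ?normal_pdf_ge0// sin_max.
    + have /cvgN := @p_cvg0 (fun n => - n.+1%:R) (fun n => etrans (normrN _) (ger0_norm (ler0n _ _))).
      by rewrite oppr0.
    + by apply: p_cvg0 => n; rewrite normrN ger0_norm.
transitivity (\int[mu]_x (s ^+ 2 * h' th x - s ^+ 2 * th * (cos (th * x + al) * p x))).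
  apply: eq_Rintegral => x _; rewrite /h'; field; exact: s_neq0.
rewrite RintegralB//; [|exact: integrable_mulrl|exact: integrable_mulrl].
by rewrite RintegralZl// RintegralZl// h0 mulr0 sub0r mulNr.
Qed.

(** The two preceding facts give F' = - s^2 th F, so F(th) exp(s^2 th^2 / 2) is constant, equal to
    F(0) = cos al. The phase al treats the cosine and sine transforms together. *)
Lemma gaussian_fourier th : \int[mu]_x (cos (th * x + al) * p x) = cos al * expR (- (s ^+ 2 * th ^+ 2 / 2)).
Proof.
have dG t : is_derive (t : R) (1 : R) ((fun t => F t * expR (s ^+ 2 * t ^+ 2 / 2)) : R -> R) 0.
  have := F_derive t; rewrite by_parts => dF.
  apply: is_derive_eq.
  rewrite /GRing.scale/=; by field.
have := is_derive_0_is_cst th 0 dG.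
rewrite expr0n /= mulr0 mul0r expR0 mulr1 => FE.
rewrite expRN.
have -> : \int[mu]_x (cos (th * x + al) * p x) = F th by [].
have F0 : F 0 = cos al.
  rewrite /F; under eq_Rintegral do rewrite mul0r add0r.
  rewrite RintegralZl// /Rintegral integral_normal_pdf mulr1//.
by rewrite -F0 -FE mulfK// gt_eqF// expR_gt0.
Qed.

End gaussian_fourier.

(** * A martingale central limit theorem *)

(** The mean value theorem raises the order by one; the factor 1/(m + 1) that integration would give
    is sacrificed. *)
Lemma ler_norm_power (R : realType) (C : R) m (g g' : R -> R) :
  (forall x, is_derive x (1 : R) (g : R -> R) (g' x)) -> g 0 = 0 ->
  (forall x, 0 <= x -> `|g' x| <= C * x ^+ m) ->
  forall x, 0 <= x -> `|g x| <= C * x ^+ m.+1.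
Proof.
move=> dg g0 g'C x x0.
have C0 : 0 <= C.
  by have := g'C 1 ler01; rewrite expr1n mulr1; exact: le_trans.
have cg : continuous g.
  by move=> y; apply: differentiable_continuous; apply/derivable1_diffP; case: (dg y).
have [c] := MVT_segment x0 (fun y _ => dg y) (continuous_subspaceT cg).
rewrite in_itv/= => /andP[c0 cx]; rewrite g0 !subr0 => ->.
rewrite normrM (ger0_norm x0) exprSr mulrA ler_wpM2r// (le_trans (g'C _ c0))//.
by rewrite ler_wpM2l// lerXn2r.
Qed.

Section trig_taylor.
Context (R : realType).
Implicit Types x a b : R.

Let sin_le x : 0 <= x -> `|sin x| <= x.
Proof.
move=> x0; have := @ler_norm_power R 1 0 sin cos _ _ _ x x0.
rewrite mul1r expr1; apply => // [|y _]; first exact: sin0.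
by rewrite mulr1 cos_max.
Qed.

Let onem_cos_le x : 0 <= x -> `|1 - cos x| <= x ^+ 2.
Proof.
move=> x0; have := @ler_norm_power R 1 1 (fun y => 1 - cos y) sin _ _ _ x x0.
rewrite mul1r; apply => // [y||y y0].
- by apply: is_derive_eq; rewrite /GRing.scale/=; ring.
- by rewrite cos0 subrr.
- by rewrite mul1r expr1 sin_le.
Qed.

Let onem_cos_le2 x : `|1 - cos x| <= 2.
Proof. have := cos_max x; rewrite !ler_norml => /andP[? ?]; lra. Qed.

Let dsubsin x : is_derive x (1 : R) (fun y => y - sin y : R) (1 - cos x).
Proof. exact: is_derive_eq. Qed.

Let subr_sin_le x : 0 <= x -> `|x - sin x| <= x ^+ 3.
Proof.
move=> x0; have := @ler_norm_power R 1 2 (fun y => y - sin y) (fun y => 1 - cos y) dsubsin _ _ x x0.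
rewrite mul1r; apply => // [|y y0]; first by rewrite sin0 subr0.
by rewrite mul1r onem_cos_le.
Qed.

Let subr_sin_le1 x : 0 <= x -> `|x - sin x| <= 2 * x.
Proof.
move=> x0; have := @ler_norm_power R 2 0 (fun y => y - sin y) (fun y => 1 - cos y) dsubsin _ _ x x0.
by apply => // [|y y0]; rewrite ?sin0 ?subr0// mulr1.
Qed.

Let subr_sin_le2 x : 0 <= x -> `|x - sin x| <= 2 * x ^+ 2.
Proof.
move=> x0; have [x1|x1] := leP x 1.
  apply: (le_trans (subr_sin_le x0)); rewrite exprS; nra.
apply: (le_trans (subr_sin_le1 x0)); nra.
Qed.

Let dcos2 x : is_derive x (1 : R) (fun y => cos y - 1 + y ^+ 2 / 2 : R) (x - sin x).
Proof. by apply: is_derive_eq; rewrite /GRing.scale/=; field. Qed.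

Let cos2_le m C x : (forall y, 0 <= y -> `|y - sin y| <= C * y ^+ m) ->
  0 <= x -> `|cos x - 1 + x ^+ 2 / 2| <= C * x ^+ m.+1.
Proof.
move=> h x0; apply: (ler_norm_power dcos2) => //.
by rewrite cos0 expr0n /= mul0r addr0 subrr.
Qed.

(** The left-hand side is cos a (cos b - 1 + b^2/2) + sin a (b - sin b). The minimum prepares
    Lindeberg's truncation: cubic for small b, quadratic for large b, where each of the two summands
    costs 2 b^2. *)
Lemma cosD_taylor a b : `|cos (a + b) - cos a + b * sin a + b ^+ 2 / 2 * cos a|
  <= 4 * Num.min (b ^+ 2) (`|b| ^+ 3).
Proof.
rewrite cosD [X in `|X|](_ : _ = cos a * (cos b - 1 + b ^+ 2 / 2) + sin a * (b - sin b)); last by ring.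
apply: (le_trans (ler_normD _ _)); rewrite !normrM.
have -> : `|cos b - 1 + b ^+ 2 / 2| = `|cos `|b| - 1 + `|b| ^+ 2 / 2|.
  by rewrite real_normK ?num_real//; case: (ger0P b) => // _; rewrite cosN.
have -> : `|b - sin b| = `| `|b| - sin `|b| |.
  by case: (ger0P b) => // _; rewrite sinN -opprD normrN.
rewrite -[b ^+ 2]real_normK ?num_real//.
have := normr_ge0 b; move: `|b| => {}b b0.
have h1 : `|cos a| * `|cos b - 1 + b ^+ 2 / 2| <= `|cos b - 1 + b ^+ 2 / 2|.
  by rewrite ler_piMl// cos_max.
have h2 : `|sin a| * `|b - sin b| <= `|b - sin b|.
  by rewrite ler_piMl// sin_max.
apply: (le_trans (lerD h1 h2)).
have [|] := leP (b ^+ 2) (b ^+ 3) => _.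
  have := @cos2_le 1 2 b subr_sin_le1 b0; have := subr_sin_le2 b0; lra.
have := @cos2_le 2 2 b subr_sin_le2 b0; have := subr_sin_le b0; nra.
Qed.

Lemma expRN_taylor x : 0 <= x -> `|expR (- x) - 1 + x| <= x ^+ 2.
Proof.
move=> x0; have := @ler_norm_power R 1 1 (fun y => expR (- y) - 1 + y) (fun y => 1 - expR (- y)) _ _ _ x x0.
rewrite mul1r; apply => [y||y y0].
- by apply: is_derive_eq; rewrite /GRing.scale/=; ring.
- by rewrite oppr0 expR0 subrr addr0.
- have := expR_ge1Dx (- y); have : expR (- y) <= 1 by rewrite -expR0 ler_expR oppr_le0.
  by move=> h1 h2; rewrite mul1r expr1 ger0_norm; lra.
Qed.

End trig_taylor.

Section martingale_clt.
Context d (T : measurableType d) (R : realType) (P : probability T R).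
Variables (xi : nat -> T -> R) (v : R) (e : nat -> R).
Hypotheses (mxi : forall k, measurable_fun setT (xi k)) (v0 : 0 <= v).
Hypothesis xi2 : forall k, P.-integrable setT (EFin \o (fun w => xi k w ^+ 2)).
Let S k w := \sum_(i < k) xi i w.
(* Orthogonality to the functions cos(t S_k + al) of the past is all that is used
   of the martingale property; likewise for the conditional variances. *)
Hypothesis xi_centered : forall k t al,
  \int[P]_w (cos (t * S k w + al) * xi k w) = 0.
Hypothesis xi_var : forall k t al,
  `|\int[P]_w (cos (t * S k w + al) * (xi k w ^+ 2 - v))| <= e k.
Hypothesis e_cvg0 : e n @[n --> \oo] --> 0.

Definition tail_square (c x : R) := if c < `|x| then x ^+ 2 else 0.

Hypothesis lindeberg : forall c, 0 < c ->
  n%:R^-1 * \sum_(k < n) \int[P]_w tail_square (c * Num.sqrt n%:R) (xi k w)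
    @[n --> \oo] --> (0 : R).

Let mS k : measurable_fun setT (S k).
Proof. by apply: measurable_sum => i. Qed.

Let mcosS t al k : measurable_fun setT (fun w => cos (t * S k w + al)).
Proof. exact: measurable_cos_affine. Qed.

Let ixi k : P.-integrable setT (EFin \o xi k).
Proof.
apply: (integrable_le_norm (g := fun w => 1 + xi k w ^+ 2)) => //.
  move=> w; have := sqr_ge0 (`|xi k w| - 1).
  have := normr_ge0 (xi k w).
  rewrite -(real_normK (num_real (xi k w))); nra.
apply: integrable_addr => //; exact: integrable_probability_cst.
Qed.

Let icst c := integrable_probability_cst P c.

Let mtail c k : measurable_fun setT (fun w => tail_square c (xi k w)).
Proof.
apply: measurable_fun_ifT => //; last exact: measurable_funX.
by apply: measurable_fun_ltr => //; exact: measurableT_comp.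
Qed.

Let itail c k : P.-integrable setT (EFin \o (fun w => tail_square c (xi k w))).
Proof.
apply: (integrable_le_norm (g := fun w => xi k w ^+ 2)) => // w.
rewrite /tail_square; case: ifP => _; last by rewrite normr0 sqr_ge0.
by rewrite ger0_norm// sqr_ge0.
Qed.

Let ixi2v k : P.-integrable setT (EFin \o (fun w => xi k w ^+ 2 - v)).
Proof. exact: integrable_subr. Qed.

Let Exi2 k : \int[P]_w (xi k w ^+ 2) <= v + e k.
Proof.
have := xi_var k 0 0.
under eq_Rintegral do rewrite mul0r addr0 cos0 mul1r.
rewrite RintegralB// Rintegral_probability_cst.
by move/(le_trans (ler_norm _)); lra.
Qed.

Let Q t al k := \int[P]_w cos (t * S k w + al).

(** Second-order expansion of the cosine at the past sum: the linear term vanishes by [xi_centered],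
    in the quadratic one xi^2 becomes v at the cost e k, and what remains multiplies the expectation
    by 1 - u, that is by exp(- u) up to u^2, with u = v t^2/(2 n). The frequency r stays fixed while
    k runs, so that steps can be chained. *)
Let step t al k n c r : (0 < n)%N -> 0 < c -> r = t / Num.sqrt n%:R ->
  `|Q r al k.+1 - expR (- (v * t ^+ 2 / 2 / n%:R)) * Q r al k| <=
  n%:R^-1 * (t ^+ 2 / 2 * e k + 4 * `|t| ^+ 3 * c * (v + e k)
    + 4 * t ^+ 2 * \int[P]_w tail_square (c * Num.sqrt n%:R) (xi k w)
    + (v * t ^+ 2 / 2) ^+ 2 / n%:R).
Proof.
move=> n0 c0 rE.
have sn0 : 0 < Num.sqrt n%:R :> R by rewrite sqrtr_gt0 ltr0n.
have r2 : r ^+ 2 = t ^+ 2 / n%:R by rewrite rE expr_div_n sqr_sqrtr.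
have r3 : `|r| ^+ 3 * Num.sqrt n%:R = `|t| ^+ 3 / n%:R.
  rewrite rE normrM normfV (gtr0_norm sn0) exprMn exprVn -{3}(sqr_sqrtr (ler0n R n)).
  by field; rewrite gt_eqF.
pose u := v * t ^+ 2 / 2 / n%:R.
have u0 : 0 <= u by rewrite !divr_ge0// mulr_ge0// sqr_ge0.
pose X w := r * S k w + al.
pose rho w := cos (X w + r * xi k w) - cos (X w) + r * xi k w * sin (X w)
   + (r * xi k w) ^+ 2 / 2 * cos (X w).
pose A1 w := cos (r * S k w + (al - pi / 2)) * xi k w.
pose A2 w := cos (X w) * (xi k w ^+ 2 - v).
(* The sine is a cosine of shifted phase, hence covered by the hypothesis on cosines with arbitrary
   al. *)
have sinX w : sin (X w) = cos (r * S k w + (al - pi / 2)).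
  by rewrite addrA -/(X w) cosB cos_pihalf sin_pihalf mulr0 add0r mulr1.
have uE : r ^+ 2 * v / 2 = u by rewrite r2 /u; ring.
pose q := 1 - u - expR (- u).
have key w : cos (r * S k.+1 w + al) - expR (- u) * cos (X w) =
   rho w - r * A1 w - r ^+ 2 / 2 * A2 w + q * cos (X w).
  rewrite /rho /A1 /A2 /q /S big_ord_recr/= -/(S k w) mulrDr -addrA [r * xi k w + al]addrC addrA.
  rewrite -/(X w) -sinX; move: (expR (- u)) => y; rewrite -uE.
  by field.
have mX : measurable_fun setT X by apply: measurable_funD => //; exact: measurable_funM.
have msinX : measurable_fun setT (fun w => sin (X w)) by under eq_fun do rewrite sinX; exact: mcosS.
have icos al' j : P.-integrable setT (EFin \o (fun w => cos (r * S j w + al'))).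
  exact: integrable_cos_affine.
have iA1 : P.-integrable setT (EFin \o A1).
  by apply: (integrable_bounded_mul (C := 1)) => // w; exact: cos_max.
have iA2 : P.-integrable setT (EFin \o A2).
  by apply: (integrable_bounded_mul (C := 1)) => //; [exact: mcosS|move=> w; exact: cos_max].
(* Beyond the level c sqrt n the quadratic bound of [cosD_taylor] is used; below it the cubic one,
   with one factor |xi| replaced by c sqrt n. *)
pose B w := 4 * (r ^+ 2 * tail_square (c * Num.sqrt n%:R) (xi k w)
                 + `|r| ^+ 3 * (c * Num.sqrt n%:R) * xi k w ^+ 2).
have rhoB w : `|rho w| <= B w.
  apply: (le_trans (cosD_taylor _ _)); rewrite /B ler_pM2l// /tail_square.
  have h2 := mulr_ge0 (exprn_ge0 3 (normr_ge0 r)) (mulr_ge0 (mulr_ge0 (ltW c0) (ltW sn0)) (sqr_ge0 (xi k w))).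
  case: ltP => [h|h].
    by rewrite ge_min exprMn lerDl -mulrA h2.
  rewrite ge_min mulr0 add0r normrM; apply/orP; right; rewrite exprMn.
  rewrite -[leRHS]mulrA ler_wpM2l ?exprn_ge0// exprS real_normK ?num_real//.
  by rewrite ler_wpM2r// sqr_ge0.
have iB : P.-integrable setT (EFin \o B).
  by apply: integrable_mulrl; apply: integrable_addr; exact: integrable_mulrl.
have irho : P.-integrable setT (EFin \o rho).
  apply: (integrable_le_norm (g := B)) => //.
  apply: measurable_funD; last first.
    apply: measurable_funM; last exact: mcosS.
    apply: measurable_funM => //.
    by apply: measurable_funX; exact: measurable_funM.
  apply: measurable_funD; last by apply: measurable_funM => //; exact: measurable_funM.
  apply: measurable_funB; last exact: mcosS.
  apply: (measurableT_comp (f := cos)); first exact: (continuous_measurable_fun (@continuous_cos R)).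
  by apply: measurable_funD => //; exact: measurable_funM.
have -> : Q r al k.+1 - expR (- u) * Q r al k =
  \int[P]_w rho w - r ^+ 2 / 2 * \int[P]_w A2 w + q * Q r al k.
  rewrite /Q -(RintegralZl (expR (- u)) measurableT (icos al k)).
  rewrite -RintegralB//; last exact: integrable_mulrl.
  under eq_Rintegral do rewrite key.
  have i2 : P.-integrable setT (EFin \o (fun w => rho w - r * A1 w)).
    by apply: integrable_subr => //; exact: integrable_mulrl.
  have i3 : P.-integrable setT (EFin \o (fun w => rho w - r * A1 w - r ^+ 2 / 2 * A2 w)).
    by apply: integrable_subr => //; exact: integrable_mulrl.
  rewrite RintegralD//; last exact: (integrable_mulrl q (icos al k)).
  rewrite RintegralB//; last exact: integrable_mulrl.
  rewrite RintegralB//; last exact: integrable_mulrl.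
  rewrite (RintegralZl q measurableT (icos al k)) (RintegralZl r measurableT iA1).
  by rewrite (RintegralZl (r ^+ 2 / 2) measurableT iA2) xi_centered mulr0 subr0.
have hr : `|\int[P]_w rho w| <= 4 * (r ^+ 2 * \int[P]_w tail_square (c * Num.sqrt n%:R) (xi k w)
       + `|t| ^+ 3 / n%:R * c * (v + e k)).
  apply: (le_trans (le_normr_Rintegral measurableT irho)).
  apply: (le_trans (le_Rintegral measurableT (integrable_norm irho) iB (fun w _ => rhoB w))).
  rewrite /B RintegralZl//; last by apply: integrable_addr; exact: integrable_mulrl.
  rewrite ler_pM2l// RintegralD//; [|exact: integrable_mulrl|exact: integrable_mulrl].
  rewrite !RintegralZl// lerD2l -r3.
  rewrite [leRHS](_ : _ = `|r| ^+ 3 * (c * Num.sqrt n%:R) * (v + e k)); last by ring.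
  by rewrite ler_wpM2l// !mulr_ge0 ?exprn_ge0// ltW.
have hA2 : `|\int[P]_w A2 w| <= e k by exact: xi_var.
have hQ : `|Q r al k| <= 1.
  apply: (le_trans (le_normr_Rintegral measurableT (icos al k))).
  rewrite -[leRHS](Rintegral_probability_cst P); apply: le_Rintegral => //.
    exact: integrable_norm (icos al k).
  by move=> w _; exact: cos_max.
have hq : `|q| <= u ^+ 2.
  by rewrite -normrN (_ : - q = expR (- u) - 1 + u) ?expRN_taylor// /q; ring.
apply: (le_trans (ler_normD _ _)); apply: (le_trans (lerD (ler_normB _ _) (lexx _))).
have h1 : `|r ^+ 2 / 2 * \int[P]_w A2 w| <= t ^+ 2 / n%:R / 2 * e k.
  by rewrite r2 normrM ler_pM// ger0_norm// !divr_ge0// sqr_ge0.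
have h2 : `|q * Q r al k| <= u ^+ 2 * 1 by rewrite normrM ler_pM.
apply: (le_trans (lerD (lerD hr h1) h2)).
rewrite r2 le_eqVlt; apply/orP; left; apply/eqP; rewrite /u.
by field; rewrite pnatr_eq0 -lt0n.
Qed.

Let Q0 t al : Q t al 0 = cos al.
Proof.
rewrite /Q /S; under eq_Rintegral do rewrite big_ord0 mulr0 add0r.
exact: Rintegral_probability_cst.
Qed.

Let bnd t c n := t ^+ 2 / 2 * (n%:R^-1 * \sum_(k < n) e k) +
  4 * `|t| ^+ 3 * c * (v + n%:R^-1 * \sum_(k < n) e k) +
  4 * t ^+ 2 * (n%:R^-1 * \sum_(k < n) \int[P]_w tail_square (c * Num.sqrt n%:R) (xi k w)) +
  (v * t ^+ 2 / 2) ^+ 2 / n%:R.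

(** The factors exp(- u) are at most 1, so the one-step errors are not amplified and simply add up;
    over n steps the factors multiply to exp(- v t^2/2). *)
Let sum_steps t al n c : (0 < n)%N -> 0 < c ->
  `|Q (t / Num.sqrt n%:R) al n - expR (- (v * t ^+ 2 / 2)) * cos al| <= bnd t c n.
Proof.
move=> n0 c0; set r := t / _.
have nn0 : n%:R != 0 :> R by rewrite pnatr_eq0 -lt0n.
pose u := v * t ^+ 2 / 2 / n%:R.
have u0 : 0 <= u by rewrite !divr_ge0// mulr_ge0// sqr_ge0.
pose D k := n%:R^-1 * (t ^+ 2 / 2 * e k + 4 * `|t| ^+ 3 * c * (v + e k)
    + 4 * t ^+ 2 * \int[P]_w tail_square (c * Num.sqrt n%:R) (xi k w)
    + (v * t ^+ 2 / 2) ^+ 2 / n%:R).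
have H k : `|Q r al k - expR (- (u *+ k)) * cos al| <= \sum_(j < k) D j.
  elim: k => [|k IH].
    by rewrite big_ord0 mulr0n oppr0 expR0 mul1r Q0 subrr normr0.
  rewrite big_ord_recr/= mulrS opprD expRD.
  rewrite (_ : _ - _ = expR (- u) * (Q r al k - expR (- (u *+ k)) * cos al) +
    (Q r al k.+1 - expR (- u) * Q r al k)); last by ring.
  apply: (le_trans (ler_normD _ _)); apply: lerD; last exact: step.
  rewrite normrM (le_trans _ IH)// ler_piMl// ger0_norm ?expR_ge0//.
  by rewrite -expR0 ler_expR oppr_le0.
have -> : v * t ^+ 2 / 2 = u *+ n by rewrite -[RHS]mulr_natr /u divfK.
apply: (le_trans (H n)); rewrite /D /bnd -mulr_sumr !big_split/=.
rewrite -!mulr_sumr big_split/= !sumr_const card_ord.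
rewrite le_eqVlt; apply/orP; left; apply/eqP.
rewrite -(mulr_natr v n) -(mulr_natr n%:R^-1 n).
move: (\sum_(i < n) e i) (\sum_(i < n) _) => x y; by field.
Qed.

(** For a fixed level c every term of [bnd] tends to 0 except 4 |t|^3 c v, which is then made small
    through c. *)
Theorem martingale_clt t al :
  \int[P]_w cos (t * (S n w / Num.sqrt n%:R) + al) @[n --> \oo] -->
    cos al * expR (- (v * t ^+ 2 / 2)).
Proof.
have e_mean := mean_cvg e_cvg0.
have inv_cvg : n%:R^-1 @[n --> \oo] --> (0 : R).
  by rewrite -(cvg_shiftS (fun n => n%:R^-1 : R)); exact: cvg_harmonic.
have bnd_cvg c : 0 < c -> bnd t c n @[n --> \oo] --> 4 * `|t| ^+ 3 * c * v.
  move=> c0.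
  rewrite (_ : 4 * `|t| ^+ 3 * c * v = t ^+ 2 / 2 * 0 + 4 * `|t| ^+ 3 * c * (v + 0) + 4 * t ^+ 2 * 0 + (v * t ^+ 2 / 2) ^+ 2 * 0); last by ring.
  apply: cvgD; last by apply: cvgMr.
  apply: cvgD; last by apply: cvgMr; exact: lindeberg.
  apply: cvgD; first exact: cvgMr.
  by apply: cvgMr; apply: cvgD => //; exact: cvg_cst.
apply/cvgrPdist_lt => eps eps0.
pose K := 4 * `|t| ^+ 3 * v.
have K0 : 0 <= K by rewrite /K !mulr_ge0// exprn_ge0.
pose c := eps / (2 * (K + 1)).
have c0 : 0 < c by rewrite /c divr_gt0// mulr_gt0// ltr_wpDl.
have Kc : 4 * `|t| ^+ 3 * c * v < eps.
  rewrite (_ : _ * _ = K * c); last by rewrite /K; ring.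
  rewrite /c mulrA ltr_pdivrMr ?mulr_gt0 ?ltr_wpDl//.
  by nra.
near=> n.
have n0 : (0 < n)%N by near: n; exists 1%N.
rewrite distrC mulrC.
have -> : \int[P]_w cos (t * (S n w / Num.sqrt n%:R) + al) = Q (t / Num.sqrt n%:R) al n.
  by apply: eq_Rintegral => w _; congr (cos (_ + _)); rewrite mulrA mulrAC.
apply: (le_lt_trans (sum_steps t al n0 c0)).
near: n.
have /cvgrPdist_lt/(_ (eps - 4 * `|t| ^+ 3 * c * v)) := bnd_cvg c c0.
rewrite subr_gt0 => /(_ Kc); apply: filterS => n.
by rewrite ltr_norml => /andP[h1 h2]; lra.
Unshelve. all: end_near. Qed.

End martingale_clt.

(** * Convergence in distribution from convergence of cosines *)

Section bernstein.
Context (R : realType).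
Implicit Types (phi : nat -> R) (y : R).

(* The n-th Bernstein polynomial with weights phi, by Pascal's recursion. *)
Fixpoint bernstein (n : nat) (phi : nat -> R) : {poly R} :=
  if n is m.+1 then 'X * bernstein m (fun k => phi k.+1) + (1 - 'X) * bernstein m phi
  else (phi 0)%:P.

Lemma bernsteinS n phi y : (bernstein n.+1 phi).[y] =
  y * (bernstein n (fun k => phi k.+1)).[y] + (1 - y) * (bernstein n phi).[y].
Proof. by rewrite /= !hornerE. Qed.

Lemma bernstein_le n phi phi' y : 0 <= y <= 1 ->
  (forall k, (k <= n)%N -> phi k <= phi' k) ->
  (bernstein n phi).[y] <= (bernstein n phi').[y].
Proof.
move=> /andP[y0 y1]; elim: n phi phi' => [|n IH] phi phi' le_phi.
  by rewrite /= !hornerE le_phi.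
rewrite !bernsteinS; apply: lerD; apply: ler_wpM2l => //.
- by apply: IH => k kn; exact: le_phi.
- by rewrite subr_ge0.
- by apply: IH => k kn; apply: le_phi; exact: leqW.
Qed.

(** These are the mean n y and variance n y (1 - y) of the binomial law. The free centre c makes the
    induction work: shifting k to k + 1 is shifting c to c - 1. *)
Lemma bernstein_quadratic n (a b c : R) y :
  (bernstein n (fun k => a + b * (k%:R - c) ^+ 2)).[y] =
  a + b * (n%:R * (y * (1 - y)) + (n%:R * y - c) ^+ 2).
Proof.
elim: n c => [|n IH] c; first by rewrite /= !hornerE; ring.
rewrite bernsteinS IH.
rewrite (_ : (fun k => a + b * (k.+1%:R - c) ^+ 2) = fun k => a + b * (k%:R - (c - 1)) ^+ 2); last first.
  by apply/funext => k; rewrite -natr1; ring.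
by rewrite IH -natr1; ring.
Qed.

(** Compactness of [a, b] in its covering form, the parameter being dl tending to 0 from the
    right. *)
Lemma uniform_continuity_itv (psi : R -> R) (a b : R) : continuous psi ->
  forall e, 0 < e -> exists2 dl, 0 < dl &
    forall x y, a <= x <= b -> `|x - y| < dl -> `|psi x - psi y| <= e.
Proof.
move=> cpsi e e0.
have /compact_near_coveringP/(_ _ (0 : R)^'+
   (fun dl x => forall y, `|x - y| < dl -> `|psi x - psi y| <= e)) :=
   @segment_compact R a b.
move=> /(_ _ _)[].
  move=> x xab.
  have e20 : 0 < e / 2 by rewrite divr_gt0.
  have /cvgrPdist_lt/(_ _ e20)/nbhs_ballP[eta /= eta0 heta] := cpsi x.
  have eta20 : 0 < eta / 2 by rewrite divr_gt0.
  exists (ball x (eta / 2), [set dl | dl < eta / 2]) => /=.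
    split; first exact: nbhsx_ballx.
    exact: nbhs_right_lt.
  move=> [x' dl] /= [xx' dle] y x'y.
  have h1 := heta x'; have h2 := heta y.
  rewrite (_ : psi x' - psi y = (psi x - psi y) - (psi x - psi x')); last by ring.
  apply: (le_trans (ler_normB _ _)).
  rewrite [leRHS](splitr e); apply: lerD; apply: ltW.
    apply: h2; rewrite /ball/= (_ : x - y = (x - x') + (x' - y)); last by ring.
    rewrite (le_lt_trans (ler_normD _ _))// [ltRHS](splitr eta) ltrD//.
    exact: lt_trans dle.
  apply: h1; rewrite /ball/=; apply: (lt_trans xx'); lra.
move=> dl0 /= dl0_gt0 h.
exists (dl0 / 2); first by rewrite divr_gt0.
move=> x y xab; apply: h => //=.
- rewrite sub0r normrN gtr0_norm; lra.
- by rewrite divr_gt0.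
Qed.

(** Bernstein's proof: by positivity ([bernstein_le]) it is enough to bound psi(k/n) - psi(y) by a
    quadratic in k, whose Bernstein value is known exactly. *)
Lemma weierstrass_itv01 (psi : R -> R) (B : R) : continuous psi ->
  (forall y, `|psi y| <= B) -> forall e, 0 < e -> exists p : {poly R}, forall y, 0 <= y <= 1 -> `|p.[y] - psi y| <= e.
Proof.
move=> cpsi psiB e e0; pose M := B + 1.
have hM y : `|psi y| <= M by rewrite (le_trans (psiB y))// lerDl.
have M0 : 0 < M by rewrite ltr_wpDl// (le_trans _ (psiB 0)).
have e20 : 0 < e / 2 by rewrite divr_gt0.
have [dl dl0 hdl] := uniform_continuity_itv 0 1 cpsi e20.
(* At distance at least dl the crude bound 2 M is absorbed by C times the squared distance. *)
pose C := 2 * M / dl ^+ 2.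
have C0 : 0 < C by rewrite divr_gt0 ?exprn_gt0// mulr_gt0.
pose n := (Num.truncn (C / (e / 2))).+1.
have nC : C / n%:R <= e / 2.
  by rewrite ler_pdivrMr ?ltr0n// mulrC -ler_pdivrMr// ltW// truncnS_gt.
have n0 : n%:R != 0 :> R by rewrite pnatr_eq0.
exists (bernstein n (fun k => psi (k%:R / n%:R))) => y y01.
have /andP[y0 y1] := y01.
have key k : (k <= n)%N -> `|psi (k%:R / n%:R) - psi y| <= e / 2 + C / n%:R ^+ 2 * (k%:R - n%:R * y) ^+ 2.
  move=> kn.
  have -> : C / n%:R ^+ 2 * (k%:R - n%:R * y) ^+ 2 = C * (k%:R / n%:R - y) ^+ 2 by field.
  have kn01 : 0 <= (k%:R / n%:R : R) <= 1.
    by rewrite divr_ge0//= ler_pdivrMr ?ltr0n// mul1r ler_nat.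
  have [h|h] := ltP `|k%:R / n%:R - y| dl.
    by rewrite (le_trans (hdl _ _ kn01 h))// lerDl mulr_ge0 ?sqr_ge0// ltW.
  have : 2 * M <= C * (k%:R / n%:R - y) ^+ 2.
    rewrite /C mulrAC ler_pdivlMr ?exprn_gt0// ler_pM2l ?mulr_gt0//.
    by rewrite -[leRHS]real_normK ?num_real// ler_sqr ?nnegrE// ltW.
  have := ler_normB (psi (k%:R / n%:R)) (psi y); have := hM y; have := hM (k%:R / n%:R).
  lra.
have mom s : (bernstein n (fun k => psi y + s * (e / 2) + s * (C / n%:R ^+ 2) * (k%:R - n%:R * y) ^+ 2)).[y] =
    psi y + s * (e / 2 + C / n%:R * (y * (1 - y))).
  by rewrite bernstein_quadratic; field.
have yy : 0 <= y * (1 - y) <= 1.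
  apply/andP; split; nra.
have Cy : C / n%:R * (y * (1 - y)) <= e / 2.
  apply: le_trans nC; rewrite ler_piMr//; first by rewrite divr_ge0// ltW.
  by case/andP: yy.
rewrite ler_norml; apply/andP; split.
  rewrite -lerBlDr opprK.
  apply: (@le_trans _ _ (bernstein n (fun k => psi y + (-1) * (e / 2) + (-1) * (C / n%:R ^+ 2) * (k%:R - n%:R * y) ^+ 2)).[y]).
    rewrite mom; lra.
  apply: bernstein_le => // k kn; have := key k kn; rewrite ler_norml => /andP[+ _]; lra.
rewrite lerBlDr.
apply: (@le_trans _ _ (bernstein n (fun k => psi y + 1 * (e / 2) + 1 * (C / n%:R ^+ 2) * (k%:R - n%:R * y) ^+ 2)).[y]).
  apply: bernstein_le => // k kn; have := key k kn; rewrite ler_norml => /andP[_ +]; lra.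
rewrite mom; lra.
Qed.

End bernstein.

Lemma measurable_norm_gt (R : realType) d (T : measurableType d) (Y : T -> R) c :
  measurable_fun setT Y -> measurable [set w | c < `|Y w|].
Proof.
move=> mY; rewrite -[X in measurable X]setTI.
apply: (measurable_fun_ltr (f := fun=> c)) => //; exact: measurableT_comp.
Qed.

Section cos_to_weak.
Context (R : realType).

(** Not the hyperbolic sine: the sine rescaled into [0, 1], the interval of the Bernstein
    approximation. *)
Let sinh (x : R) := (1 + sin x) / 2.

(* On [-M, M], x is recovered from sin(th x) when th M < pi / 2; the polynomial in
   sin(th x) stays bounded on the whole line, which handles the tails. *)
Lemma sin_approx (phi : R -> R) (B M : R) : continuous phi -> (forall x, `|phi x| <= B) ->
  0 < M -> forall e, 0 < e -> exists p : {poly R}, exists th : R,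
    (forall x, `|x| <= M -> `|phi x - p.[sinh (th * x)]| <= e) /\
    (forall x, `|p.[sinh (th * x)]| <= B + e).
Proof.
move=> cphi phiB M0 e e0.
(* For |x| <= M the angle th x stays within pi/4, where asin inverts sin. *)
pose th : R := pi / 4 / M.
have th0 : 0 < th by rewrite divr_gt0// divr_gt0// pi_gt0.
pose s0 : R := sin (pi / 4).
have pi0 := pi_gt0 R.
have s01 : s0 < 1.
  rewrite -(sin_pihalf R) /s0 ltr_sin ?in_itv/=; [lra|apply/andP; split; lra..].
have s00 : 0 < s0.
  by rewrite /s0; apply: sin_gt0_pi; lra.
(* Clamping to [- s0, s0] keeps the argument of asin inside (-1, 1), where asin is continuous, and
   changes nothing when |x| <= M. *)
pose cl (y : R) := Num.max (- s0) (Num.min s0 y).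
have cl_lt y : -1 < cl y < 1.
  rewrite /cl lt_max gt_max gt_min s01/=; apply/andP; split.
    by apply/orP; left; lra.
  by rewrite andbT; lra.
have ccl : continuous cl.
  move=> y; apply: (continuous_max (f := fun=> - s0)); first exact: cst_continuous.
  by apply: (continuous_min (f := fun=> s0)); [exact: cst_continuous|exact: cvg_id].
pose psi (y : R) := phi (asin (cl (2 * y - 1)) / th).
have cpsi : continuous psi.
  move=> y.
  apply: (@continuous_comp R R R (fun y => asin (cl (2 * y - 1)) / th) phi y); last exact: cphi.
  apply: cvgMl.
  apply: (@continuous_comp R R R (fun y => cl (2 * y - 1)) asin y); last exact: continuous_asin.
  apply: (@continuous_comp R R R (fun y => 2 * y - 1) cl y); last exact: ccl.
  by apply: cvgB; [apply: cvgMr; exact: cvg_id|exact: cvg_cst].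
have [p hp] := weierstrass_itv01 cpsi (fun y => phiB _) e0.
have sh01 x : 0 <= sinh x <= 1.
  by have := sin_max x; rewrite /sinh ler_norml => /andP[h1 h2]; apply/andP; split; lra.
exists p, th; split => [x xM|x]; last first.
  have := hp _ (sh01 (th * x)); have := phiB (asin (cl (2 * (sinh (th * x)) - 1)) / th).
  rewrite -/(psi _) => h1 h2; rewrite -[X in `|X|](subrK (psi (sinh (th * x)))).
  by rewrite (le_trans (ler_normD _ _))// addrC lerD.
have -> : phi x = psi (sinh (th * x)).
  have thx : - (pi / 4) <= th * x <= pi / 4.
    rewrite -ler_norml normrM gtr0_norm// -ler_pdivlMl//.
    by rewrite (le_trans xM)// /th invfM invrK mulrAC mulVf ?mul1r// gt_eqF//; lra.
  have thx2 : th * x \in `[- (pi / 2), pi / 2].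
    by rewrite in_itv/=; apply/andP; split; lra.
  rewrite /psi /sinh mulrCA divff// mulr1 addrAC subrr add0r /cl.
  have sle (a b : R) : - (pi / 4) <= a -> a <= b -> b <= pi / 4 -> sin a <= sin b.
    move=> ha; rewrite le_eqVlt => /predU1P[->|ab hb]; first by rewrite lexx.
    by rewrite ltW// ltr_sin ?in_itv/=; [|apply/andP; split; lra..].
  have /andP[h1 h2] := thx.
  have h3 : sin (th * x) <= s0 by apply: sle.
  have h4 : - s0 <= sin (th * x) by rewrite /s0 -sinN; apply: sle.
  rewrite (min_r h3) (max_r h4).
  by rewrite sinK// mulrAC divff ?mul1r// gt_eqF.
by rewrite distrC; exact: hp.
Qed.

Let msh th : measurable_fun setT (fun x : R => sinh (th * x)).
Proof.
apply: measurable_funM => //; apply: measurable_funD => //.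
apply: (measurableT_comp (f := sin)); first exact: (continuous_measurable_fun (@continuous_sin R)).
exact: measurable_funM.
Qed.

Let sinh01 x : 0 <= sinh x <= 1.
Proof.
by have := sin_max x; rewrite /sinh ler_norml => /andP[h1 h2]; apply/andP; split; lra.
Qed.

Let horner_bounded (p : {poly R}) : exists C, forall y, 0 <= y <= 1 -> `|p.[y]| <= C.
Proof.
elim/poly_ind: p => [|p c [C hC]]; first by exists 0 => y _; rewrite horner0 normr0.
exists (C + `|c|) => y y01; rewrite hornerMXaddC (le_trans (ler_normD _ _))// lerD//.
have /andP[y0 y1] := y01.
rewrite normrM (ger0_norm y0) (le_trans _ (hC _ y01))// ler_piMr//.
Qed.

Let mhorner (p : {poly R}) th : measurable_fun setT (fun x : R => p.[sinh (th * x)]).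
Proof.
elim/poly_ind: p => [|p c IH].
  by under eq_fun do rewrite horner0; exact: measurable_cst.
under eq_fun do rewrite hornerMXaddC.
by apply: measurable_funD => //; apply: measurable_funM.
Qed.

Let mcos t al : measurable_fun setT (fun x : R => cos (t * x + al)).
Proof. exact: measurable_cos_affine. Qed.

Section approx.
Context d (T : measurableType d) (P : probability T R) (Y : T -> R).
Hypothesis mY : measurable_fun setT Y.

(** The cosine factor makes the family stable under the recursion below; t = al = 0 gives back the
    bare polynomial. *)
Let hcos (p : {poly R}) th t al y := p.[sinh (th * y)] * cos (t * y + al).

Let ihcos (p : {poly R}) th t al : P.-integrable setT (EFin \o (fun w => hcos p th t al (Y w))).
Proof.
have [C hC] := horner_bounded p.
apply: (@bounded_integrable _ _ _ _ _ C) => //.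
  by apply: (measurableT_comp (f := hcos p th t al)) => //; apply: measurable_funM.
move=> w; rewrite /hcos normrM (le_trans _ (hC _ (sinh01 (th * Y w))))//.
by rewrite ler_piMr// cos_max.
Qed.

(* Product formulas linearise powers of sin(th x) into cosines. *)
Lemma Rintegral_hornerMX (p : {poly R}) c th t al :
  \int[P]_w hcos (p * 'X + c%:P) th t al (Y w) =
  2^-1 * \int[P]_w hcos p th t al (Y w) + 4^-1 * \int[P]_w hcos p th (th + t) (al - pi / 2) (Y w)
  + 4^-1 * \int[P]_w hcos p th (th - t) (- al - pi / 2) (Y w) + c * \int[P]_w hcos 1%:P th t al (Y w).
Proof.
rewrite -!RintegralZl//.
rewrite -!RintegralD//; do ?[exact: integrable_mulrl|apply: integrable_addr].
apply: eq_Rintegral => w _; rewrite /hcos hornerMXaddC hornerC /sinh.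
set A := th * Y w; set B := t * Y w + al.
rewrite (_ : (th + t) * Y w + (al - pi / 2) = (A + B) - pi / 2); last by rewrite /A /B; ring.
rewrite (_ : (th - t) * Y w + (- al - pi / 2) = (A - B) - pi / 2); last by rewrite /A /B; ring.
by rewrite !cosBpihalf sinD sinB; field.
Qed.

(** Where |Y| <= M the integrands differ by at most e; elsewhere by at most B + (B + e), on an event
    of probability at most e. *)
Lemma Rintegral_approx (phi f : R -> R) (B M e : R) :
  measurable_fun setT phi -> measurable_fun setT f -> 0 <= e ->
  (forall x, `|phi x| <= B) -> (forall x, `|f x| <= B + e) ->
  (forall x, `|x| <= M -> `|phi x - f x| <= e) ->
  (P [set w | (M < `|Y w|)%R] <= e%:E)%E ->
  `|\int[P]_w phi (Y w) - \int[P]_w f (Y w)| <= e + (B *+ 2 + e) * e.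
Proof.
move=> mphi mf e0 phiB fB phif PM.
have B0 : 0 <= B := le_trans (normr_ge0 _) (phiB 0).
pose A := [set w | M < `|Y w|].
have mA : measurable A.
  exact: measurable_norm_gt.
have i1 : P.-integrable setT (EFin \o (fun w => phi (Y w))).
  by apply: (@bounded_integrable _ _ _ _ _ B) => //; exact: measurableT_comp.
have i2 : P.-integrable setT (EFin \o (fun w => f (Y w))).
  by apply: (@bounded_integrable _ _ _ _ _ (B + e)) => //; exact: measurableT_comp.
have iA : P.-integrable setT (EFin \o \1_A) by exact: integrable_indic.
rewrite -RintegralB//.
apply: (le_trans (le_normr_Rintegral measurableT (integrable_subr i1 i2))).
apply: (@le_trans _ _ (\int[P]_w (e + (B *+ 2 + e) * \1_A w))).
  apply: le_Rintegral => //.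
  - exact: (integrable_norm (integrable_subr i1 i2)).
  - by apply: integrable_addr; [exact: integrable_probability_cst|exact: integrable_mulrl].
  - move=> w _ /=; rewrite indicE; have [wA|wA] := boolP (w \in A).
      rewrite mulr1 mulr2n (le_trans (ler_normB _ _))//.
      rewrite (le_trans (lerD (phiB _) (fB _)))//; lra.
    rewrite mulr0 addr0; apply: phif; rewrite leNgt; apply/negP => h.
    by move/negP : wA; apply; rewrite inE.
rewrite RintegralD//; [|exact: integrable_probability_cst|exact: integrable_mulrl].
rewrite (RintegralZl (B *+ 2 + e) measurableT iA) lerD//.
  by rewrite Rintegral_probability_cst.
rewrite ler_wpM2l ?addr_ge0 ?mulrn_wge0// /Rintegral integral_indic// setIT.
rewrite -lee_fin fineK//; exact: fin_num_measure.
Qed.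

End approx.

Section levy.
Context d (T : measurableType d) (P : probability T R) (Z : nat -> T -> R).
Variable nu : probability (measurableTypeR R) R.
Hypothesis mZ : forall n, measurable_fun setT (Z n).
Hypothesis cvg_cos : forall t al, \int[P]_w cos (t * Z n w + al) @[n --> \oo] -->
  \int[nu]_x cos (t * x + al).
Hypothesis tight : forall e, 0 < e -> exists M : R,
  \forall n \near \oo, (P [set w | (M < `|Z n w|)%R] <= e%:E)%E.

(** Continuity from above along the sets |x| > n, which decrease to the empty set. *)
Let nu_tight e : 0 < e -> exists M : R, (nu [set x : R | (M < `|x|)%R] <= e%:E)%E.
Proof.
move=> e0; pose F (n : nat) := [set x : measurableTypeR R | (n%:R < `|x|)%R].
have mF n : measurable (F n).
  exact: (@measurable_norm_gt _ _ (measurableTypeR R) id).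
have capF : \bigcap_n F n = set0.
  rewrite -subset0 => x /(_ (Num.truncn `|x|).+1 Logic.I); rewrite /F /= ltNge => /negP; apply.
  exact/ltW/truncnS_gt.
have : nu \o F @ \oo --> nu (\bigcap_n F n).
  apply: nonincreasing_cvg_mu => //.
  - by rewrite ltey_eq fin_num_measure.
  - by rewrite capF.
  - move=> m n mn; apply/subsetPset => x; rewrite /F/=; apply: le_lt_trans.
    by rewrite ler_nat.
rewrite capF measure0 => /fine_cvgP[_] /cvgrPdist_lt/(_ e e0)[n _ /(_ n (leqnn n))].
rewrite sub0r normrN /= => h; exists n%:R.
change (nu (F n) <= e%:E)%E.
rewrite -(fineK (fin_num_measure nu _ (mF n))) lee_fin ltW//.
exact: le_lt_trans (ler_norm _) h.
Qed.

(** The induction runs over all frequencies and phases at once, since [Rintegral_hornerMX] changes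
    both. *)
Let cvg_poly_cos (p : {poly R}) th t al :
  \int[P]_w (p.[sinh (th * Z n w)] * cos (t * Z n w + al)) @[n --> \oo] -->
  \int[nu]_x (p.[sinh (th * x)] * cos (t * x + al)).
Proof.
elim/poly_ind: p t al => [|p c IH] t al.
  rewrite (_ : (fun n => _) = fun=> 0); last first.
    apply/funext => n; under eq_Rintegral do rewrite horner0 mul0r.
    by rewrite /Rintegral integral0.
  under eq_Rintegral do rewrite horner0 mul0r.
  rewrite (_ : \int[nu]_x 0 = 0); first exact: cvg_cst.
  by rewrite /Rintegral integral0.
have h1 : \int[P]_w ((1%:P : {poly R}).[sinh (th * Z n w)] * cos (t * Z n w + al)) @[n --> \oo] -->
    \int[nu]_x ((1%:P : {poly R}).[sinh (th * x)] * cos (t * x + al)).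
  rewrite (_ : (fun n => _) = fun n => \int[P]_w cos (t * Z n w + al)); last first.
    by apply/funext => n; under eq_Rintegral do rewrite hornerC mul1r.
  rewrite (_ : \int[nu]_x _ = \int[nu]_x cos (t * x + al))//.
  by apply: eq_Rintegral => x _; rewrite hornerC mul1r.
rewrite (Rintegral_hornerMX nu (Y := id)) //.
rewrite (eq_cvg _ _ (fun n => Rintegral_hornerMX P (mZ n) p c th t al)).
by apply: cvgD; [apply: cvgD; [apply: cvgD|]|]; apply: cvgMr; [exact: IH..|exact: h1].
Qed.

Let cvg_poly (p : {poly R}) th : \int[P]_w p.[sinh (th * Z n w)] @[n --> \oo] -->
  \int[nu]_x p.[sinh (th * x)].
Proof.
have := @cvg_poly_cos p th 0 0.
rewrite (_ : (fun n => _) = fun n => \int[P]_w p.[sinh (th * Z n w)]); last first.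
  by apply/funext => n; apply: eq_Rintegral => w _; rewrite mul0r addr0 cos0 mulr1.
rewrite (_ : \int[nu]_x _ = \int[nu]_x p.[sinh (th * x)])//.
by apply: eq_Rintegral => x _; rewrite mul0r addr0 cos0 mulr1.
Qed.

(** Three comparisons: phi with its trigonometric polynomial under P, that polynomial under P and
    under [nu], then back to phi under [nu]. Tightness controls the first and the last outside
    [-M, M]. *)
Lemma cvg_cos_in_distribution (phi : R -> R) (B : R) : continuous phi ->
  (forall x, `|phi x| <= B) ->
  (\int[P]_w (phi (Z n w))%:E)%E @[n --> \oo] --> (\int[nu]_x (phi x)%:E)%E.
Proof.
move=> cphi phiB.
have B0 : 0 <= B := le_trans (normr_ge0 _) (phiB 0).
have mphi : measurable_fun setT phi by exact: continuous_measurable_fun.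
suff H : \int[P]_w phi (Z n w) @[n --> \oo] --> \int[nu]_x phi x.
  have EP n : (\int[P]_w (phi (Z n w))%:E)%E = (\int[P]_w phi (Z n w))%:E.
    rewrite /Rintegral fineK//; apply: integrable_fin_num => //.
    by apply: (@bounded_integrable _ _ _ _ _ B) => //; exact: measurableT_comp.
  have -> : (\int[nu]_x (phi x)%:E)%E = (\int[nu]_x phi x)%:E.
    rewrite /Rintegral fineK//; apply: integrable_fin_num => //.
    exact: (@bounded_integrable _ _ _ _ _ B).
  rewrite (_ : (fun n => _) = fun n => (\int[P]_w phi (Z n w))%:E); last exact/funext.
  by apply: cvg_EFin; [exact: nearW|exact: H].
apply/cvgrPdist_le => eps eps0.
(* As e <= 1, the total error is at most e (2 (2 B + 2) + 1). *)
pose e := Num.min 1 (eps / (2 * (B *+ 2 + 2) + 1)).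
have B20 : 0 < 2 * (B *+ 2 + 2) + 1 by rewrite mulr2n; lra.
have e0 : 0 < e by rewrite lt_min ltr01 divr_gt0.
have e1 : e <= 1 by rewrite ge_min lexx.
have ee : 2 * (e + (B *+ 2 + e) * e) + e <= eps.
  have : e * (2 * (B *+ 2 + 2) + 1) <= eps by rewrite -ler_pdivlMr// ge_min lexx orbT.
  rewrite mulr2n; nra.
have [M1 hM1] := tight e0; have [M2 hM2] := nu_tight e0.
pose M := Num.max 1 (Num.max M1 M2).
have M0 : 0 < M by rewrite lt_max ltr01.
have [p [th [h1 h2]]] := sin_approx cphi phiB M0 e0.
have mp : measurable_fun setT (fun x : R => p.[sinh (th * x)]) by exact: mhorner.
have mnorm c : measurable [set x : measurableTypeR R | (c < `|x|)%R].
  exact: (@measurable_norm_gt _ _ (measurableTypeR R) id).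
have hnu : `|\int[nu]_x phi x - \int[nu]_x p.[sinh (th * x)]| <= e + (B *+ 2 + e) * e.
  apply: (@Rintegral_approx _ _ nu id _ phi (fun x => p.[sinh (th * x)]) B M) => //; first exact: ltW.
  apply: le_trans hM2; apply: le_measure; rewrite ?inE//.
  by move=> x /=; apply: le_lt_trans; rewrite !le_max lexx !orbT.
near=> n.
have hP : `|\int[P]_w phi (Z n w) - \int[P]_w p.[sinh (th * Z n w)]| <= e + (B *+ 2 + e) * e.
  apply: (@Rintegral_approx _ _ P (Z n) (mZ n) phi (fun x => p.[sinh (th * x)]) B M) => //; first exact: ltW.
  apply: (@le_trans _ _ (P [set w | (M1 < `|Z n w|)%R])); last by near: n.
  apply: le_measure; rewrite ?inE//.
  - exact: measurable_norm_gt.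
  - exact: measurable_norm_gt.
  - by move=> x /=; apply: le_lt_trans; rewrite !le_max lexx !orbT.
have hp : `|\int[nu]_x p.[sinh (th * x)] - \int[P]_w p.[sinh (th * Z n w)]| <= e.
  by near: n; have /cvgrPdist_le/(_ e e0) := @cvg_poly p th.
rewrite -[X in `|X|](subrKA (\int[nu]_x p.[sinh (th * x)])).
rewrite -(subrKA (\int[P]_w p.[sinh (th * Z n w)]) (\int[nu]_x p.[sinh (th * x)])) addrA.
apply: (le_trans (ler_normD _ _)).
apply: (le_trans (lerD (ler_normD _ _) (lexx _))); rewrite [X in _ + X]distrC.
by apply: (le_trans (lerD (lerD hnu hp) hP)); apply: le_trans ee; lra.
Unshelve. all: end_near. Qed.

End levy.
End cos_to_weak.

(** * Kernel smoothing on R^d *)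

Section lebesgue_rV_affine.
Context (R : realType).
Local Notation leb := (@lebesgue_measure R).

Let aff (x c : R) (t : measurableTypeR R) : measurableTypeR R := x + c * t.

Let maff x c : measurable_fun setT (aff x c).
Proof. by apply: measurable_funD => //; exact: measurable_funM. Qed.

Let maff_mixin x c := isMeasurableFun.Build _ _ _ _ _ (maff x c).
Let maff_pack x c : {mfun _ >-> _} := HB.pack (aff x c) (maff_mixin x c).

(** Lebesgue measure is recognised from its values on half-open intervals; a negative c exchanges
    their open and closed ends, whence the two cases. *)
Lemma ge0_integral_affine (f : R -> \bar R) (x c : R) : c != 0 ->
  measurable_fun setT f -> (forall t, (0 <= f t)%E) ->
  (\int[leb]_t f t = `|c|%:E * \int[leb]_t f (x + c * t)%R)%E.
Proof.
move=> c0 mf f0.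
have nc0 : 0 <= `|c| by [].
pose m := pushforward (mscale (NngNum nc0) leb) (maff_pack x c).
rewrite (eq_measure_integral m); last first.
  move=> A mA _; apply: lebesgue_measure_unique => // _ [[a b]] _ <-.
  change (leb `]a, b]%classic = (`|c|%:E * leb (aff x c @^-1` `]a, b]%classic))%E).
  have [cneg|cpos|c_eq0] := ltgtP c 0; last by rewrite c_eq0 eqxx in c0.
  - rewrite (_ : aff x c @^-1` _ = `[(b - x) / c, (a - x) / c[%classic); last first.
      apply/seteqP; split => t; rewrite /= /aff !in_itv/=.
        by move=> /andP[h1 h2]; rewrite ler_ndivrMr// ltr_ndivlMr//; apply/andP; split; lra.
      by rewrite ler_ndivrMr// ltr_ndivlMr// => /andP[h1 h2]; apply/andP; split; lra.
    rewrite !lebesgue_measure_itv/= !lte_fin ltr_ndivlMr// divfK// ltrD2r.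
    case: ifPn => ab; last by rewrite mule0.
    rewrite -EFinB -EFinM; congr EFin; rewrite (ltr0_norm cneg); field; exact: ltr0_neq0.
  - rewrite (_ : aff x c @^-1` _ = `](a - x) / c, (b - x) / c]%classic); last first.
      apply/seteqP; split => t; rewrite /= /aff !in_itv/=.
        by move=> /andP[h1 h2]; rewrite ltr_pdivrMr// ler_pdivlMr//; apply/andP; split; lra.
      by rewrite ltr_pdivrMr// ler_pdivlMr// => /andP[h1 h2]; apply/andP; split; lra.
    rewrite !lebesgue_measure_itv/= !lte_fin ltr_pdivlMr// divfK ?gt_eqF// ltrD2r.
    case: ifPn => ab; last by rewrite mule0.
    rewrite -EFinB -EFinM; congr EFin; rewrite (gtr0_norm cpos); field; exact: lt0r_neq0.
have mfa : measurable_fun setT (fun t : measurableTypeR R => f (x + c * t)).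
  exact: (measurableT_comp mf (maff x c)).
transitivity (\int[mscale (NngNum nc0) leb]_t f (x + c * t)%R)%E.
  by rewrite ge0_integral_pushforward.
by rewrite ge0_integral_mscale.
Qed.

Lemma ge0_integral_lebesgue_rVS d (f : 'rV[R]_d.+1 -> \bar R) :
  measurable_fun setT f -> (forall v, (0 <= f v)%E) ->
  (\int[lebesgue_rV d.+1]_v f v =
   \int[leb]_t \int[lebesgue_rV d]_v f (cons_rV (t, v)))%E.
Proof.
move=> mf f0.
have mc := @measurable_cons_rV R d.
pose mcM := isMeasurableFun.Build _ _ _ _ _ mc.
pose cM : {mfun _ >-> _} := HB.pack (@cons_rV R d) mcM.
transitivity (\int[leb \x lebesgue_rV d]_p f (cons_rV p))%E; last first.
  by rewrite fubini_tonelli1//; exact: measurableT_comp.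
rewrite (eq_measure_integral (pushforward (leb \x lebesgue_rV d)%E cM))//.
by rewrite ge0_integral_pushforward.
Qed.

Lemma ge0_integral_rV_affine d (f : 'rV[R]_d -> \bar R) (x : 'rV[R]_d) (c : R) : c != 0 ->
  measurable_fun setT f -> (forall v, (0 <= f v)%E) ->
  (\int[lebesgue_rV d]_v f v =
   (`|c| ^+ d)%:E * \int[lebesgue_rV d]_v f (x + c *: v)%R)%E.
Proof.
move=> c0.
have maffine d' (y : 'rV[R]_d') : measurable_fun setT (fun v : 'rV[R]_d' => y + c *: v).
  apply: measurable_fun_rV => i; under eq_fun do rewrite !mxE.
  by apply: measurable_funD => //; apply: measurable_funM => //; exact: measurable_coord_rV.
elim: d f x => [|d IH] f x mf f0.
  have mf' : measurable_fun setT (fun v : 'rV[R]_0 => f (x + c *: v)) by exact: (measurableT_comp mf (maffine 0 x)).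
  rewrite expr0 mul1e /= !integral_dirac//.
  by congr (_ * f _)%E; apply/rowP => -[].
have mfx : measurable_fun setT (fun v : 'rV[R]_d.+1 => f (x + c *: v)).
  exact: (measurableT_comp mf (maffine d.+1 x)).
rewrite !ge0_integral_lebesgue_rVS//.
pose x' : 'rV[R]_d := \row_j x ord0 (lift ord0 j).
have mfc t : measurable_fun setT (fun v => f (cons_rV (t, v))).
  apply: measurableT_comp => //; apply: (measurableT_comp (@measurable_cons_rV R d)).
  exact: pair1_measurable.
have mI : measurable_fun setT (fun t : measurableTypeR R => \int[lebesgue_rV d]_v f (cons_rV (t, v)))%E.
  apply: (measurable_fun_fubini_tonelli_F (m2 := lebesgue_rV d) (fun p => f (cons_rV p))) => //.
  by apply: measurableT_comp => //; exact: measurable_cons_rV.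
rewrite (ge0_integral_affine (x ord0 ord0) c0)//; last first.
  by move=> t; exact: integral_ge0.
transitivity (`|c|%:E * \int[leb]_t ((`|c| ^+ d)%:E * \int[lebesgue_rV d]_v f (x + c *: cons_rV (t, v))%R))%E.
  congr (_ * _)%E; apply: eq_integral => t _.
  rewrite (IH _ x')//; congr (_ * _)%E; apply: eq_integral => v _.
  congr f; apply/rowP => i; rewrite !mxE; case: unliftP => [j ->|->]//.
  by rewrite !mxE.
rewrite ge0_integralZl//.
- by rewrite muleA -EFinM -exprS.
- apply: (measurable_fun_fubini_tonelli_F (m2 := lebesgue_rV d) (fun p : measurableTypeR R * _ => f (x + c *: cons_rV p))) => //.
  apply: measurableT_comp => //; apply: (measurableT_comp (maffine _ x)).
  exact: measurable_cons_rV.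
- by move=> t _; exact: integral_ge0.
Qed.

End lebesgue_rV_affine.

(** * Taylor's formula through partial derivatives *)

Section taylor_rV.
Context (R : realType) (d : nat).
Implicit Types (x v : 'rV[R]_d) (f : 'rV[R]_d -> R).

Lemma is_derive_line f v y (t : R) : derivable f (y + t *: v) v ->
  is_derive t (1 : R) ((fun s => f (y + s *: v)) : R -> R) ('D_v f (y + t *: v)).
Proof.
move=> df.
have E : (fun h : R => h^-1 *: ((fun s : R => f (y + s *: v)) (h *: (1 : R) + t) - f (y + t *: v)))
   = (fun h : R => h^-1 *: (f (h *: v + (y + t *: v)) - f (y + t *: v))).
  apply/funext => h; congr (_ *: (f _ - _)).
  by rewrite -[h *: 1]/(h * 1) mulr1 scalerDl addrCA addrA.
by split; [rewrite /derivable /= E|rewrite /derive /= E].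
Qed.

Lemma MVT_line f v y : (forall z, derivable f z v) -> forall s : R,
  exists2 c : R, `|c| <= `|s| & f (y + s *: v) - f y = 'D_v f (y + c *: v) * s.
Proof.
move=> df s.
have dg t : is_derive t (1 : R) ((fun r => f (y + r *: v)) : R -> R) ('D_v f (y + t *: v)).
  exact: is_derive_line.
have cg : continuous ((fun r => f (y + r *: v)) : R -> R).
  by move=> t; apply: differentiable_continuous; apply/derivable1_diffP; case: (dg t).
have [s0|s0] := leP 0 s.
  have [c] := MVT_segment s0 (fun t _ => dg t) (continuous_subspaceT cg).
  rewrite in_itv/= scale0r addr0 subr0 => /andP[c0 cs] ->.
  by exists c => //; rewrite !ger0_norm.
have [c] := MVT_segment (ltW s0) (fun t _ => dg t) (continuous_subspaceT cg).
rewrite in_itv/= scale0r addr0 sub0r => /andP[cs c0] fE.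
exists c; first by rewrite !ler0_norm ?lerN2// ltW.
by rewrite -opprB fE mulrN opprK.
Qed.

(** Moving from x to x + v one coordinate at a time calls on the mean value theorem along the axes.
    With L the l^1 norm of v, one M L bounds the change of a partial derivative between x and the
    corner [y i], the other its change along the i-th edge. *)
Lemma taylor_rV f (M : R) :
  (forall i, partial_derivable i f) -> (forall i j, partial_derivable j (partial i f)) ->
  (forall i j x, `|partial j (partial i f) x| <= M) -> forall x v,
  `|f (x + v) - f x - \sum_i v ord0 i * partial i f x| <= 2 * M * (\sum_i `|v ord0 i|) ^+ 2.
Proof.
move=> df ddf fM x v.
(* Corners of the path: the first k coordinates are those of x + v, the others those of x. *)
pose y (k : nat) : 'rV[R]_d := \row_j (x ord0 j + v ord0 j *+ (j < k)%N).
pose L := \sum_i `|v ord0 i|.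
have ySE (i : 'I_d) : y i.+1 = y i + v ord0 i *: delta_mx ord0 i.
  apply/rowP => j; rewrite !mxE eqxx/= ltnS leq_eqVlt -addrA; congr (_ + _).
  have [->|ij] := eqVneq j i; first by rewrite eqxx ltnn mulr0n add0r mulr1.
  by rewrite val_eqE (negbTE ij)/= mulr0 addr0.
have y0 : y 0 = x by apply/rowP => j; rewrite !mxE ltn0 mulr0n addr0.
have yd : y d = x + v by apply/rowP => j; rewrite !mxE ltn_ord.
have tele (g : 'rV[R]_d -> R) k : (k <= d)%N ->
    g (y k) - g x = \sum_(i < d | (i < k)%N) (g (y i.+1) - g (y i)).
  move=> kd; rewrite -(big_ord_widen d (fun i => g (y i.+1) - g (y i)) kd).
  by rewrite -(big_mkord xpredT (fun i => g (y i.+1) - g (y i))) telescope_sumr// y0.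
have ddM i j z : `|'D_(delta_mx ord0 j) (partial i f) z| <= M := fM i j z.
(* The sign of M can be read off only when an index exists, d being possibly 0 here. *)
have M0 (i : 'I_d) : 0 <= M by exact: le_trans (fM i i x).
have L0 : 0 <= L by exact: sumr_ge0.
have vL i : `|v ord0 i| <= L by rewrite /L (bigD1 i)//= lerDl sumr_ge0.
have dpart i (k : 'I_d) : `|partial i f (y k) - partial i f x| <= M * L.
  rewrite tele; last exact: ltnW.
  apply: (le_trans (ler_norm_sum _ _ _)); rewrite /L mulr_sumr.
  rewrite big_mkcond/=; apply: ler_sum => j _; case: ifP => _; last by rewrite mulr_ge0// (M0 i).
  rewrite ySE; have [c _ ->] := MVT_line (y j) (ddf i j) (v ord0 j).
  by rewrite normrM ler_wpM2r//; exact: fM.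
have -> : f (x + v) - f x = \sum_(i < d) (f (y i.+1) - f (y i)).
  by rewrite -yd tele//; apply: eq_bigl => i; rewrite ltn_ord.
rewrite -sumrB.
apply: (le_trans (ler_norm_sum _ _ _)).
rewrite -/L (_ : 2 * M * L ^+ 2 = \sum_i 2 * M * L * `|v ord0 i|); last first.
  by rewrite -mulr_sumr -/L; ring.
apply: ler_sum => i _.
rewrite ySE; have [c cv ->] := MVT_line (y i) (df i) (v ord0 i).
rewrite mulrC -mulrBr normrM mulrC ler_wpM2r//.
rewrite -/(partial i f _).
rewrite -(subrKA (partial i f (y i))) (le_trans (ler_normD _ _))//.
rewrite [leRHS](_ : _ = M * L + M * L); last by ring.
apply: lerD => //.
have [c' _ ->] := MVT_line (y i) (ddf i i) c.
by rewrite normrM ler_pM ?normr_ge0 ?(le_trans cv)//; exact: ddM.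
Qed.

End taylor_rV.

Section enorm_lemmas.
Context (R : realType) (d : nat).
Implicit Types (v : 'rV[R]_d).

Lemma enorm_ge0 v : 0 <= enorm v. Proof. exact: sqrtr_ge0. Qed.

Lemma enorm_sqr v : enorm v ^+ 2 = \sum_i v ord0 i ^+ 2.
Proof. by rewrite sqr_sqrtr// sumr_ge0// => i _; exact: sqr_ge0. Qed.

Lemma coord_le_enorm v i : `|v ord0 i| <= enorm v.
Proof.
rewrite -ler_sqr ?nnegrE ?enorm_ge0// enorm_sqr real_normK ?num_real//.
by rewrite (bigD1 i)//= lerDl sumr_ge0// => j _; exact: sqr_ge0.
Qed.

Lemma sum_norm_sqr_le v : (\sum_i `|v ord0 i|) ^+ 2 <= d%:R ^+ 2 * enorm v ^+ 2.
Proof.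
rewrite -exprMn ler_sqr ?nnegrE ?mulr_ge0 ?enorm_ge0// ?sumr_ge0//.
apply: (@le_trans _ _ (\sum_(i < d) enorm v)).
  by apply: ler_sum => i _; exact: coord_le_enorm.
by rewrite sumr_const card_ord mulr_natl.
Qed.

Lemma measurable_enorm : measurable_fun setT (@enorm R d).
Proof.
apply: (measurableT_comp (f := Num.sqrt : R -> R) (g := fun v : 'rV[R]_d => \sum_i v ord0 i ^+ 2)).
  exact: (continuous_measurable_fun (@sqrt_continuous R)).
by apply: measurable_sum => i; apply: measurable_funX; exact: measurable_coord_rV.
Qed.

Lemma polynomial_tail_bounded (q : 'rV[R]_d -> R) : polynomial_tail q ->
  exists2 C, 0 < C & forall x, q x <= C.
Proof.
move=> [C [r [C0 r0 qC]]]; exists C => // x; rewrite (le_trans (qC x))// ler_piMr//; first exact: ltW.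
have h : 1 <= 1 + enorm x by rewrite lerDl enorm_ge0.
rewrite powRN invf_le1 ?powR_gt0 ?(lt_le_trans ltr01)//.
by rewrite -[leLHS](powRr0 (1 + enorm x)) ler_powR// ltW.
Qed.

End enorm_lemmas.

Section kernel_smoothing.
Context (R : realType) (d : nat) (K : 'rV[R]_d -> R) (HK : smoothing_kernel K).
Local Notation mu := (@lebesgue_rV R d).

Lemma kernel_measurable : measurable_fun setT K. Proof. by case: HK => -[]. Qed.
Lemma kernel_ge0 x : 0 <= K x. Proof. by case: HK => -[]. Qed.

Lemma measurable_subr_rV (x : 'rV[R]_d) : measurable_fun setT (fun y : 'rV[R]_d => x - y).
Proof.
apply: measurable_fun_rV => i; under eq_fun do rewrite !mxE.
by apply: measurable_funB => //; exact: measurable_coord_rV.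
Qed.

Lemma measurable_scale_rV (c : R) : measurable_fun setT (fun y : 'rV[R]_d => c *: y).
Proof.
apply: measurable_fun_rV => i; under eq_fun do rewrite !mxE.
by apply: measurable_funM => //; exact: measurable_coord_rV.
Qed.

Lemma measurable_rescale h : measurable_fun setT (rescale K h).
Proof.
apply: measurable_funM => //; apply: (measurableT_comp kernel_measurable).
exact: measurable_scale_rV.
Qed.

Lemma rescale_ge0 h x : 0 < h -> 0 <= rescale K h x.
Proof. by move=> h0; rewrite divr_ge0 ?kernel_ge0// exprn_ge0// ltW. Qed.

(** Substitution y = x - h u; the Jacobian h^d cancels the normalisation of the rescaled kernel. *)
Lemma ge0_integral_convolution (phi : 'rV[R]_d -> R) (h : R) x : 0 < h ->
  measurable_fun setT phi -> (forall y, 0 <= phi y) ->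
  (\int[mu]_y (rescale K h (x - y) * phi y)%:E = \int[mu]_u (K u * phi (x - h *: u))%:E)%E.
Proof.
move=> h0 mphi phi0.
have hN : - h != 0 by rewrite oppr_eq0 gt_eqF.
have hd0 : 0 < h ^+ d by rewrite exprn_gt0.
rewrite (ge0_integral_rV_affine x hN); last 2 first.
- apply/measurable_EFinP; apply: measurable_funM => //.
  by apply: (measurableT_comp (measurable_rescale h)); exact: measurable_subr_rV.
- by move=> v; rewrite lee_fin mulr_ge0// rescale_ge0.
rewrite -ge0_integralZl//.
- apply: eq_integral => u _; rewrite -EFinM; congr EFin.
  rewrite normrN (gtr0_norm h0) /rescale scaleNr opprD opprK addNKr scalerA mulVf ?gt_eqF// scale1r.
  by move: (h ^+ d) hd0 => z z0; field; rewrite gt_eqF.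
- apply/measurable_EFinP; apply: measurable_funM => //.
    apply: (measurableT_comp (measurable_rescale h)); apply: (measurableT_comp (measurable_subr_rV x)).
    by apply: measurable_fun_rV => i; under eq_fun do rewrite !mxE; apply: measurable_funD => //; apply: measurable_funM => //; exact: measurable_coord_rV.
  apply: (measurableT_comp mphi).
  by apply: measurable_fun_rV => i; under eq_fun do rewrite !mxE; apply: measurable_funD => //; apply: measurable_funM => //; exact: measurable_coord_rV.
- by move=> u _; rewrite lee_fin mulr_ge0// rescale_ge0.
Qed.

Lemma convolution_le (phi : 'rV[R]_d -> R) (h C : R) x : 0 < h -> 0 <= C ->
  measurable_fun setT phi -> (forall y, 0 <= phi y <= C) ->
  (\int[mu]_y (rescale K h (x - y) * phi y)%:E <= C%:E)%E.
Proof.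
move=> h0 C0 mphi phiC.
have phi0 y : 0 <= phi y by case/andP: (phiC y).
have mK := kernel_measurable.
rewrite ge0_integral_convolution//.
have KI : (\int[mu]_u (K u)%:E = 1)%E by case: HK => -[].
rewrite -[leRHS]mule1 -KI -ge0_integralZl//; last 2 first.
- exact/measurable_EFinP.
- by move=> u _; rewrite lee_fin kernel_ge0.
apply: ge0_le_integral => //.
- by move=> u _; rewrite lee_fin mulr_ge0 ?kernel_ge0.
- apply/measurable_EFinP; apply: measurable_funM => //; apply: (measurableT_comp mphi).
  apply: (measurableT_comp (measurable_subr_rV x)); exact: measurable_scale_rV.
- by apply/measurable_EFinP; apply: measurable_funM.
- move=> u _; rewrite -EFinM lee_fin mulrC ler_wpM2r ?kernel_ge0//.
  by case/andP: (phiC (x - h *: u)).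
Qed.

(** The linear Taylor term integrates to 0 because K is centred; the remainder is quadratic in h u
    and is integrated by the second moment of K. *)
Lemma kernel_bias (f : 'rV[R]_d -> R) (M B : R) :
  measurable_fun setT f -> (forall y, 0 <= f y <= B) ->
  (forall i, partial_derivable i f) -> (forall i j, partial_derivable j (partial i f)) ->
  (forall i j x, `|partial j (partial i f) x| <= M) ->
  exists2 C, 0 <= C & forall h x, 0 < h ->
    `|\int[mu]_u (K u * f (x - h *: u)) - f x| <= C * h ^+ 2.
Proof.
move=> mf fB df ddf fM.
have mK := kernel_measurable; have K0 := kernel_ge0.
have KI : (\int[mu]_u (K u)%:E = 1)%E by case: HK => -[].
have iK : mu.-integrable setT (EFin \o K).
  apply/integrableP; split; first exact/measurable_EFinP.
  by under eq_integral do rewrite /= ger0_norm//; rewrite KI ltry.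
have iK2 : mu.-integrable setT (EFin \o (fun u => enorm u ^+ 2 * K u)).
  apply/integrableP; split.
    by apply/measurable_EFinP; apply: measurable_funM => //; apply: measurable_funX; exact: measurable_enorm.
  rewrite (eq_integral (fun u => (enorm u ^+ 2 * K u)%:E)); first by case: HK.
  by move=> u _; rewrite /= ger0_norm// mulr_ge0// sqr_ge0.
have iKi i : mu.-integrable setT (EFin \o (fun u : 'rV[R]_d => u ord0 i * K u)).
  apply: (integrable_le_norm (g := fun u => K u + enorm u ^+ 2 * K u)).
  - by apply: measurable_funM => //; exact: measurable_coord_rV.
  - move=> u; rewrite normrM (ger0_norm (K0 u)) -[X in _ <= X + _]mul1r -mulrDl ler_wpM2r//.
    apply: (le_trans (coord_le_enorm u i)); have := sqr_ge0 (enorm u - 1).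
    have := enorm_ge0 u; nra.
  - exact: integrable_addr.
have KiE i : (\int[mu]_u (u ord0 i * K u)%:E = 0)%E by case: HK.
pose S2 := \int[mu]_u (enorm u ^+ 2 * K u).
have S20 : 0 <= S2 by apply: Rintegral_ge0 => u _; rewrite mulr_ge0 ?sqr_ge0.
exists (2 * `|M| * d%:R ^+ 2 * S2); first by rewrite !mulr_ge0// exprn_ge0.
move=> h x h0.
have ml : measurable_fun setT (fun u : 'rV[R]_d => f (x - h *: u)).
  apply: (measurableT_comp mf); apply: (measurableT_comp (measurable_subr_rV x)).
  exact: measurable_scale_rV.
have iKf : mu.-integrable setT (EFin \o (fun u => K u * f (x - h *: u))).
  apply: (integrable_le_norm (g := fun u => B * K u)).
  - exact: measurable_funM.
  - move=> u; rewrite mulrC normrM (ger0_norm (K0 u)) ler_wpM2r//.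
    by have /andP[f0 fle] := fB (x - h *: u); rewrite ger0_norm.
  - exact: integrable_mulrl.
pose lin (u : 'rV[R]_d) := \sum_i (- h * partial i f x) * (u ord0 i * K u).
have ilin : mu.-integrable setT (EFin \o lin).
  rewrite (_ : EFin \o lin = fun u => (\sum_i ((- h * partial i f x) * (u ord0 i * K u))%:E)%E); last first.
    by apply/funext => u; rewrite /= /lin -sumEFin.
  by apply: integrable_sum => // i _; exact: integrable_mulrl.
have lin0 : \int[mu]_u lin u = 0.
  rewrite /lin /Rintegral; under eq_integral do rewrite -sumEFin.
  rewrite integral_sum//; last by move=> i; exact: integrable_mulrl.
  rewrite big1// => i _; under eq_integral do rewrite EFinM.
  by rewrite (integralZl measurableT (iKi i)) KiE mule0.
pose rem (u : 'rV[R]_d) := K u * f (x - h *: u) - f x * K u - lin u.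
have irem : mu.-integrable setT (EFin \o rem).
  by apply: integrable_subr => //; apply: integrable_subr => //; exact: integrable_mulrl.
have -> : \int[mu]_u (K u * f (x - h *: u)) - f x = \int[mu]_u rem u.
  rewrite /rem RintegralB//; last by apply: integrable_subr => //; exact: integrable_mulrl.
  rewrite RintegralB//; last exact: integrable_mulrl.
  by rewrite lin0 subr0 RintegralZl// /Rintegral KI /= mulr1.
apply: (le_trans (le_normr_Rintegral measurableT irem)).
rewrite [leRHS](_ : _ = \int[mu]_u (2 * `|M| * d%:R ^+ 2 * h ^+ 2 * (enorm u ^+ 2 * K u))); last first.
  by rewrite RintegralZl// -/S2; ring.
apply: le_Rintegral => //; first exact: integrable_norm irem.
  exact: integrable_mulrl.
move=> u _ /=.
have -> : rem u = K u * (f (x + - (h *: u)) - f x - \sum_i (- (h *: u)) ord0 i * partial i f x).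
  rewrite /rem /lin !mulrBr mulr_sumr [K u * f x]mulrC; congr (_ - _).
  by apply: eq_bigr => i _; rewrite !mxE; ring.
rewrite normrM (ger0_norm (K0 u)) [leRHS](_ : _ = K u * (2 * `|M| * (d%:R ^+ 2 * (h ^+ 2 * enorm u ^+ 2)))); last by ring.
rewrite ler_wpM2l//.
apply: (le_trans (taylor_rV (M := `|M|) df ddf _ _ _)).
  by move=> i j y; rewrite (le_trans (fM i j y))// ler_norm.
rewrite ler_wpM2l ?mulr_ge0//.
have -> : h ^+ 2 * enorm u ^+ 2 = enorm (- (h *: u)) ^+ 2.
  by rewrite !enorm_sqr mulr_sumr; apply: eq_bigr => i _; rewrite !mxE sqrrN exprMn.
exact: sum_norm_sqr_le.
Qed.

End kernel_smoothing.

(** * One-step estimates *)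

Lemma measurable_fun_inv (R : realType) :
  measurable_fun setT (GRing.inv : R -> R).
Proof.
rewrite -(setUv [set (0 : R)]); apply/measurable_funU => //.
- exact: measurableC.
split; first exact: measurable_fun_set1.
apply: open_continuous_measurable_fun; first exact/closed_openC/closed_eq.
by move=> x; rewrite inE /= => /eqP x0; apply: inv_continuous.
Qed.

Section weight_deviation.
Context disp (T : measurableType disp) (R : realType) (P : probability T R).

(* Pointwise in x, with F = f x, Q = q0 x and q w the random density at x. On A, where q
   is accurate in mean square, split according to q < F / 2, an event of
   probability at most min(1, 4 D / F^2) <= (4 D / F^2)^(1 - eta). *)
Lemma weight_deviation (q : T -> R) (A : set T) (F Q lam D c1 c eta : R) :
  measurable_fun setT q -> measurable A ->
  0 <= F -> 0 <= Q -> 0 <= c1 -> F <= c1 * Q -> 0 < lam -> 0 < eta < 1 ->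
  F `^ eta <= c * Q -> (forall w, lam * Q <= q w) -> 0 < D ->
  (\int[P]_(w in A) ((q w - F) ^+ 2)%:E <= D%:E)%E ->
  (\int[P]_w (`|F ^+ 2 / q w - F|)%:E <=
    ((c1 * (c1 / lam + 1) * fine (P (~` A)) + c ^+ 2 * (4 * D) `^ (1 - eta) / lam) * Q +
     Num.min (3 * c1 * Q) (2 * Num.sqrt D))%:E)%E.
Proof.
move=> mq mA F0 Q0 c10 FQ lam0 /andP[eta0 eta1] Feta qQ D0 DA.
have sD0 : 0 < Num.sqrt D by rewrite sqrtr_gt0.
(* Apart, because Chebyshev's bound divides by F^2. *)
have [->|Fn0] := eqVneq F 0.
  rewrite [leLHS]integral0_eq; last first.
    by move=> w _; rewrite expr0n/= mul0r subr0 normr0.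
  rewrite lee_fin; apply: addr_ge0; last first.
    by rewrite le_min !mulr_ge0// ?ltW// ltW.
  apply: mulr_ge0 => //; apply: addr_ge0.
    by rewrite !mulr_ge0// ?fine_ge0// addr_ge0// divr_ge0// ltW.
  by rewrite divr_ge0 ?(ltW lam0)// mulr_ge0 ?sqr_ge0 ?powR_ge0.
have {F0 Fn0}F0 : 0 < F by rewrite lt0r Fn0.
have {}Q0 : 0 < Q.
  rewrite lt0r Q0 andbT; apply/negP => /eqP Q00; move: FQ; rewrite Q00 mulr0; lra.
have q0 w : 0 < q w by rewrite (lt_le_trans _ (qQ w))// mulr_gt0.
(* Bound off A: F^2/q <= (c1 Q)^2/(lam Q), and F <= c1 Q. *)
pose a := c1 * Q * (c1 / lam + 1).
pose b := F ^+ 2 / (lam * Q).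
pose E := A `&` [set w | q w < F / 2].
have mE : measurable E.
  apply: measurableI => //; rewrite (_ : [set w | _] = q @^-1` `]-oo, F / 2[).
    by rewrite -[X in measurable X]setTI; exact: mq.
  by apply/seteqP; split => w /=; rewrite in_itv.
have a0 : 0 <= a.
  by rewrite /a !mulr_ge0//; [lra|rewrite addr_ge0// divr_ge0// ltW].
have b0 : 0 <= b by rewrite /b divr_ge0 ?sqr_ge0// mulr_ge0// ltW.
(* Two bounds where q >= F/2 on A: the first carries Q without being small, the second is small
   without carrying Q. Their minimum keeps both virtues for a later dominated convergence. *)
pose rest w := Num.min (3 * c1 * Q) (2 * `|q w - F|).
have rest0 w : 0 <= rest w by rewrite /rest le_min !mulr_ge0// ltW.
have mrest : measurable_fun setT rest.
  apply: measurable_minr => //; apply: measurable_funM => //.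
  by apply: measurableT_comp => //; exact: measurable_funB.
have cap w : `|F ^+ 2 / q w - F| <= a * \1_(~` A) w + b * \1_E w + rest w * \1_A w.
  have Fqle : F ^+ 2 / q w <= b.
    by rewrite ler_wpM2l ?sqr_ge0// lef_pV2// posrE// mulr_gt0.
  have [wA|wA] := boolP (w \in A); last first.
    have wAc : w \in ~` A by rewrite in_setC.
    rewrite indicE wAc mulr1.
    have -> : \1_E w = 0 :> R.
      by rewrite indicE in_setI (negbTE wA).
    rewrite indicE (negbTE wA) !mulr0 !addr0.
    rewrite (le_trans (ler_normB _ _))// (gtr0_norm F0) ger0_norm ?(divr_ge0 (sqr_ge0 F) (ltW (q0 w)))//.
    rewrite /a mulrDr mulr1 lerD// (le_trans Fqle)// /b.
    rewrite ler_pdivrMr ?mulr_gt0//.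
    rewrite (_ : c1 * Q * (c1 / lam) * (lam * Q) = (c1 * Q) ^+ 2); last by field; lra.
    by rewrite ler_pXn2r// nnegrE ?mulr_ge0// ltW.
  have -> : \1_(~` A) w = 0 :> R by rewrite indicE in_setC wA.
  rewrite mulr0 add0r [\1_A w]indicE wA mulr1.
  have [qF|qF] := ltP (q w) (F / 2).
    have -> : \1_E w = 1 :> R.
      by rewrite indicE in_setI wA/= mem_set.
    rewrite mulr1.
    have qle : F <= F ^+ 2 / q w by rewrite ler_pdivlMr// expr2 ler_pM2l//; lra.
    rewrite ger0_norm ?subr_ge0//.
    have := rest0 w; lra.
  have -> : \1_E w = 0 :> R.
    by rewrite indicE in_setI wA/= memNset//=; apply/negP; rewrite -leNgt.
  rewrite mulr0 add0r /rest le_min; apply/andP; split.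
    rewrite (le_trans (ler_normB _ _))// (gtr0_norm F0) ger0_norm ?(divr_ge0 (sqr_ge0 F) (ltW (q0 w)))//.
    have : F ^+ 2 / q w <= 2 * F by rewrite ler_pdivrMr// expr2; nra.
    lra.
  rewrite (_ : F ^+ 2 / q w - F = (F / q w) * (F - q w)); last by field; exact: lt0r_neq0.
  rewrite normrM distrC ler_wpM2r// gtr0_norm ?divr_gt0// ler_pdivrMr//; lra.
pose r w := ((a * \1_(~` A) w)%:E + (b * \1_E w)%:E + (rest w * \1_A w)%:E)%E.
have mind (B : set T) : measurable B -> measurable_fun setT (\1_B : T -> R) by move=> mB; exact: measurable_indic.
have mAc : measurable (~` A) by exact: measurableC.
have -> : (((c1 * (c1 / lam + 1) * fine (P (~` A)) + c ^+ 2 * (4 * D) `^ (1 - eta) / lam) * Q +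
     Num.min (3 * c1 * Q) (2 * Num.sqrt D))%:E = (a * fine (P (~` A)))%:E + (c ^+ 2 * (4 * D) `^ (1 - eta) / lam * Q)%:E + (Num.min (3 * c1 * Q) (2 * Num.sqrt D))%:E)%E.
  by rewrite -!EFinD /a; congr (_%:E); ring.
apply: (@le_trans _ _ (\int[P]_w r w)%E).
  apply: ge0_le_integral => //.
  - apply/measurable_EFinP; apply: measurableT_comp => //.
    apply: measurable_funB => //; apply: measurable_funM => //.
    rewrite (_ : (fun w => _) = (fun y => y^-1) \o q)//; apply: measurableT_comp => //.
    exact: measurable_fun_inv.
  - rewrite /r; apply: emeasurable_funD; first apply: emeasurable_funD;
      by apply/measurable_EFinP/measurable_funM => //; exact: mind.
  - by move=> w _; rewrite /r -!EFinD lee_fin.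
have ind0 (B : set T) w : 0 <= \1_B w :> R by rewrite indicE.
rewrite /r ge0_integralD//; last 4 first.
- by move=> w _; rewrite adde_ge0// lee_fin mulr_ge0.
- by apply: emeasurable_funD; apply/measurable_EFinP/measurable_funM => //; exact: mind.
- by move=> w _; rewrite lee_fin mulr_ge0.
- by apply/measurable_EFinP/measurable_funM => //; exact: mind.
rewrite ge0_integralD//; last 4 first.
- by move=> w _; rewrite lee_fin mulr_ge0.
- by apply/measurable_EFinP/measurable_funM => //; exact: mind.
- by move=> w _; rewrite lee_fin mulr_ge0.
- by apply/measurable_EFinP/measurable_funM => //; exact: mind.
have int_ind (B : set T) (z : R) : measurable B -> 0 <= z ->
    (\int[P]_w (z * \1_B w)%:E = z%:E * P B)%E.
  move=> mB z0; under eq_integral do rewrite EFinM.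
  by rewrite ge0_integralZl_EFin// ?integral_indic ?setIT//; apply/measurable_EFinP; exact: mind.
have sqA : measurable_fun setT (fun w => ((q w - F) ^+ 2)%:E).
  by apply/measurable_EFinP/measurable_funX/measurable_funB.
rewrite !int_ind//; apply: leeD; first apply: leeD.
- by rewrite [(a * fine _)%:E]EFinM fineK// fin_num_measure.
(* Chebyshev: on E the distance from q to F exceeds F/2. *)
- have PE : (P E <= (4 * D / F ^+ 2)%:E)%E.
    have -> : (4 * D / F ^+ 2)%:E = ((4 / F ^+ 2)%:E * D%:E)%E by rewrite -EFinM; congr (_%:E); ring.
    have z0 : 0 <= 4 / F ^+ 2 by rewrite divr_ge0 ?sqr_ge0.
    apply: (@le_trans _ _ ((4 / F ^+ 2)%:E * \int[P]_(w in A) ((q w - F) ^+ 2)%:E)%E); last first.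
      by apply: lee_wpmul2l; rewrite ?lee_fin.
    rewrite -ge0_integralZl_EFin//; last first.
    - exact: measurable_funTS.
    - by move=> w _; rewrite lee_fin sqr_ge0.
    rewrite [leRHS]integral_mkcond -{1}(setIT E) -(integral_indic P measurableT mE).
    have mp : measurable_fun setT ((fun w => (4 / F ^+ 2)%:E * ((q w - F) ^+ 2)%:E) \_ A)%E.
      apply/(measurable_restrictT _ mA)/measurable_funTS.
      by apply: emeasurable_funM.
    apply: ge0_le_integral => //.
    - exact/measurable_EFinP/mind.
    - move=> w _; rewrite patchE indicE; case: ifPn => wA; last first.
        by rewrite in_setI (negbTE wA).
      rewrite in_setI wA/=; case: (boolP (w \in _)) => wE; last by rewrite -EFinM lee_fin mulr_ge0// sqr_ge0.
      move: wE; rewrite inE/= => wE.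
      rewrite -EFinM lee_fin mulrAC ler_pdivlMr ?exprn_gt0// mul1r.
      have : 0 <= (F / 2) by lra.
      by nra.
  have P1 : (P E <= 1)%E by exact: probability_le1.
  (* A probability bounded by min(1, y) is bounded by y^(1 - eta). Multiplied by b, this leaves F^(2
     eta), at most (c Q)^2. *)
  have PEm : (P E <= ((4 * D / F ^+ 2) `^ (1 - eta))%:E)%E.
    have [t1|t1] := leP 1 (4 * D / F ^+ 2).
      rewrite (le_trans P1)// lee_fin -[leLHS](powRr0 (4 * D / F ^+ 2)).
      by rewrite ler_powR// subr_ge0 ltW.
    have t0 : 0 < 4 * D / F ^+ 2 by rewrite divr_gt0 ?mulr_gt0// exprn_gt0.
    rewrite (le_trans PE)// lee_fin -{1}(powRr1 (ltW t0)).
    by rewrite ger_powR// ?t0 ?ltW//; lra.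
  apply: (@le_trans _ _ (b%:E * ((4 * D / F ^+ 2) `^ (1 - eta))%:E)%E).
    exact: lee_wpmul2l.
  rewrite -EFinM lee_fin powRM; [|lra|by rewrite invr_ge0 sqr_ge0].
  have G0 : 0 < F ^+ 2 by rewrite exprn_gt0.
  have -> : (F ^+ 2)^-1 `^ (1 - eta) = (F ^+ 2)^-1 * (F `^ eta) ^+ 2.
    rewrite -[in LHS]powR_inv1 ?sqr_ge0// -powRrM (_ : -1 * _ = -1 + eta); last by ring.
    rewrite powRD; last by rewrite (gt_eqF G0) implybT.
    rewrite powR_inv1 ?sqr_ge0//; congr (_ * _).
    have sqE (y : R) : 0 <= y -> y ^+ 2 = y `^ 2%:R by move=> y0; rewrite -(powR_mulrn 2 y0).
    by rewrite (sqE _ (ltW F0)) (sqE _ (powR_ge0 _ _)) -(powRrM F 2%:R) -(powRrM F eta) (mulrC eta).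
  rewrite /b [leLHS](_ : _ = (4 * D) `^ (1 - eta) / lam / Q * (F `^ eta) ^+ 2); last first.
    by field; rewrite !lt0r_neq0.
  rewrite [leRHS](_ : _ = (4 * D) `^ (1 - eta) / lam / Q * (c * Q) ^+ 2); last first.
    by field; rewrite !lt0r_neq0.
  rewrite ler_wpM2l//; first by rewrite !divr_ge0 ?powR_ge0// ltW.
  by rewrite ler_pXn2r// nnegrE ?powR_ge0// (le_trans _ Feta) ?powR_ge0.
- have mrA : measurable_fun setT (fun w => (rest w * \1_A w)%:E).
    by apply/measurable_EFinP/measurable_funM => //; exact: mind.
  have mrA0 w : (0 <= (rest w * \1_A w)%:E)%E by rewrite lee_fin mulr_ge0.
  rewrite [(Num.min _ _)%:E]EFin_min le_min; apply/andP; split.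
    have -> : (3 * c1 * Q)%:E = (\int[P]_w (3 * c1 * Q)%:E)%E.
      by rewrite integral_cst//= (@probability_setT _ _ _ P) mule1.
    apply: ge0_le_integral => //.
    move=> w _; rewrite lee_fin indicE /rest.
    have x0 : 0 <= 3 * c1 * Q by rewrite !mulr_ge0// ltW.
    by case: (w \in A); rewrite ?mulr0// mulr1 ge_min lexx.
  set s := Num.sqrt D in sD0 *.
  (* 2 |q - F| <= s + (q - F)^2/s with s = sqrt D, in place of the Cauchy-Schwarz inequality. *)
  apply: (@le_trans _ _ (\int[P]_w (s%:E + (s^-1)%:E * ((fun w => ((q w - F) ^+ 2)%:E) \_ A) w))%E).
    apply: ge0_le_integral => //.
    - apply: emeasurable_funD => //; apply: emeasurable_funM => //.
      by apply/(measurable_restrictT _ mA)/measurable_funTS.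
    - move=> w _; rewrite patchE indicE; case: ifPn => wA; rewrite ?mulr0 ?mule0 ?adde0 ?lee_fin ?(ltW sD0)//.
      rewrite mulr1 /rest ge_min; apply/orP; right.
      rewrite -(ler_pM2l sD0) mulrDr mulrA mulrA divff ?lt0r_neq0// mul1r.
      rewrite -(real_normK (num_real (q w - F))).
      have := sqr_ge0 (s - `|q w - F|); nra.
  rewrite ge0_integralD//; last 2 first.
  - move=> w _; rewrite mule_ge0 ?lee_fin ?invr_ge0 ?(ltW sD0)//.
    by apply: erestrict_ge0 => {}w _; rewrite lee_fin sqr_ge0.
  - apply: emeasurable_funM => //.
    by apply/(measurable_restrictT _ mA)/measurable_funTS.
  2: by move=> w _; rewrite lee_fin ltW.
  rewrite integral_cst//= (@probability_setT _ _ _ P) mule1.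
  rewrite ge0_integralZl_EFin//; last 3 first.
  - by move=> w _; apply: erestrict_ge0 => {}w _; rewrite lee_fin sqr_ge0.
  - by apply/(measurable_restrictT _ mA)/measurable_funTS.
  - by rewrite invr_ge0 ltW.
  rewrite -integral_mkcond.
  have -> : (2 * s)%:E = (s%:E + (s^-1)%:E * D%:E)%E.
    rewrite -EFinM -EFinD; congr (_%:E).
    have -> : D = s ^+ 2 by rewrite sqr_sqrtr// ltW.
    by field; exact: lt0r_neq0.
  by rewrite leeD2l// lee_wpmul2l// lee_fin invr_ge0 ltW.
Qed.

End weight_deviation.

Section integral_discrete_law.
Context d (T : measurableType d) (R : realType) (mu : {measure set T -> \bar R}).
Context d' (E : measurableType d').
Variables (n : nat) (phi : T -> R) (Y : T -> E) (psi : nat -> T -> R) (Z : nat -> T -> E).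
Hypotheses (mphi : measurable_fun setT phi) (phi0 : forall w, 0 <= phi w).
Hypotheses (mpsi : forall a, measurable_fun setT (psi a)) (psi0 : forall a w, 0 <= psi a w).
Hypotheses (mY : measurable_fun setT Y) (mZ : forall a, measurable_fun setT (Z a)).
Hypothesis lawY : forall B, measurable B ->
  (\int[mu]_w (phi w * \1_B (Y w))%:E =
   \sum_(a < n) \int[mu]_w (psi a w * \1_B (Z a w))%:E)%E.
Local Open Scope ereal_scope.

(** The image under V of the measure with density p; it ends with [Defined] so that the integral
    formula below can see through it. *)
Let image (p : T -> R) (mp : measurable_fun setT p) (p0 : forall w, (0 <= p w)%R)
  (V : T -> E) (mV : measurable_fun setT V) : {measure set E -> \bar R}.
Proof. by refine (pushforward (mdensity mu mp p0) V). Defined.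

Let integral_image (p : T -> R) (mp : measurable_fun setT p) (p0 : forall w, (0 <= p w)%R)
    (V : T -> E) (mV : measurable_fun setT V) (u : E -> \bar R) :
  measurable_fun setT u -> (forall x, 0 <= u x) ->
  \int[image mp p0 mV]_x u x = \int[mu]_w ((p w)%:E * u (V w)).
Proof.
move=> mu_ u0; rewrite ge0_integral_pushforward//= preimage_setT.
rewrite ge0_integral_mdensity//; last exact: measurableT_comp.
by apply: eq_integral => w _; rewrite muleC.
Qed.

(* A weighted law that agrees on sets with a sum of weighted image laws does so on
   functions: a conditional law with random discrete support is handled
   without kernels. *)
Lemma ge0_integral_discrete_law (u : E -> R) :
  measurable_fun setT u -> (forall x, (0 <= u x)%R) ->
  \int[mu]_w (phi w * u (Y w))%:E = \sum_(a < n) \int[mu]_w (psi a w * u (Z a w))%:E.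
Proof.
move=> mu_ u0.
have mEu : measurable_fun setT (EFin \o u) by exact/measurable_EFinP.
have Eu0 x : 0 <= (EFin \o u) x by rewrite lee_fin.
have <- : \int[image mphi phi0 mY]_x (EFin \o u) x = \int[mu]_w (phi w * u (Y w))%:E.
  by rewrite integral_image//; apply: eq_integral => w _; rewrite EFinM.
rewrite (eq_measure_integral (msum (fun a => image (mpsi a) (psi0 a) (mZ a)) n)).
  rewrite ge0_integral_measure_sum//; apply: eq_bigr => a _.
  by rewrite integral_image//; apply: eq_integral => w _; rewrite EFinM.
have imageE (p : T -> R) (mp : measurable_fun setT p) (p0 : forall w, (0 <= p w)%R) (V : T -> E) (mV : measurable_fun setT V) B :
    measurable B -> image mp p0 mV B = \int[mu]_w (p w * \1_B (V w))%:E.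
  move=> mB; rewrite -{1}(setIT B) -integral_indic// integral_image//.
  exact/measurable_EFinP/measurable_indic.
move=> B mB _; rewrite imageE// lawY// /msum; apply: eq_bigr => a _.
by rewrite imageE.
Qed.

End integral_discrete_law.

(** * Self-normalised sums *)

Lemma cos_lipschitz (R : realType) (x y : R) : `|cos x - cos y| <= `|x - y|.
Proof.
wlog yx : x y / y <= x.
  by move=> H; case: (leP y x) => [|/ltW] xy; [exact: H|rewrite distrC [leRHS]distrC H].
have [c _ ->] := MVT_segment yx (fun z _ => is_derive_cos z)
  (continuous_subspaceT (@continuous_cos R)).
by rewrite normrM normrN ler_piMl// sin_max.
Qed.

Section ratio.
Context d (T : measurableType d) (R : realType) (P : probability T R).
Variables (Y M Z : nat -> T -> R) (s pb : nat -> R) (C : R) (L : R -> R -> R).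
Hypotheses (mY : forall n, measurable_fun setT (Y n)) (mM : forall n, measurable_fun setT (M n))
  (mZ : forall n, measurable_fun setT (Z n)).
Hypothesis C0 : 0 < C.
Hypothesis ZE : \forall n \near \oo, forall w, 1 / 2 <= M n w -> Z n w = Y n w / M n w.
Hypothesis bad : \forall n \near \oo, (P (~` [set w | (1 / 2 <= M n w)%R]) <= (pb n)%:E)%E.
Hypothesis pb0 : pb n @[n --> \oo] --> (0 : R).
Hypothesis M2 : \forall n \near \oo, [/\ 0 < s n,
  P.-integrable setT (EFin \o (fun w => (M n w - 1) ^+ 2)) &
  \int[P]_w ((M n w - 1) ^+ 2) <= s n].
Hypothesis s0 : s n @[n --> \oo] --> (0 : R).
Hypothesis Y2 : \forall n \near \oo, P.-integrable setT (EFin \o (fun w => Y n w ^+ 2)) /\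
  \int[P]_w (Y n w ^+ 2) <= C.
Hypothesis Ycos : forall t al, \int[P]_w cos (t * Y n w + al) @[n --> \oo] --> L t al.

Let good n := [set w | 1 / 2 <= M n w].

Let mgood n : measurable (good n).
Proof.
rewrite (_ : good n = M n @^-1` `[1 / 2, +oo[).
  by rewrite -[X in measurable X]setTI; exact: mM.
by apply/seteqP; split => w /=; rewrite in_itv/= andbT.
Qed.

Let near_all : \forall n \near \oo, [/\ forall w, 1 / 2 <= M n w -> Z n w = Y n w / M n w,
  (P (~` good n) <= (pb n)%:E)%E,
  [/\ 0 < s n, P.-integrable setT (EFin \o (fun w => (M n w - 1) ^+ 2)) &
    \int[P]_w ((M n w - 1) ^+ 2) <= s n] &
  P.-integrable setT (EFin \o (fun w => Y n w ^+ 2)) /\ \int[P]_w (Y n w ^+ 2) <= C].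
Proof. by near=> n; split; near: n. Unshelve. all: by end_near. Qed.

Let ind_bad n : P.-integrable setT (EFin \o (\1_(~` good n) : T -> R)).
Proof.
apply: (@bounded_integrable _ _ _ _ _ 1); first by apply: measurable_indic; exact: measurableC.
by move=> w; rewrite indicE; case: (_ \in _); rewrite ?normr1 ?normr0.
Qed.

Let int_bad n : \int[P]_w \1_(~` good n) w = fine (P (~` good n)).
Proof.
rewrite /Rintegral (integral_indic P measurableT) ?setIT//; exact: measurableC.
Qed.

Let fin_bad n : P (~` good n) \is a fin_num.
Proof. by rewrite fin_num_measure//; exact: measurableC. Qed.

(** Quantitative Slutsky: where M >= 1/2, |Z - Y| <= 2 |Y| |M - 1| <= r Y^2 + (M - 1)^2/r. With r =
    sqrt s both terms have mean of order r. *)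
Lemma ratio_cos t al : \int[P]_w cos (t * Z n w + al) @[n --> \oo] --> L t al.
Proof.
suff H : (\int[P]_w cos (t * Z n w + al) - \int[P]_w cos (t * Y n w + al)) @[n --> \oo] --> (0 : R).
  rewrite -[X in _ --> X]add0r (_ : (fun n => _) = fun n =>
      (\int[P]_w cos (t * Z n w + al) - \int[P]_w cos (t * Y n w + al)) +
      \int[P]_w cos (t * Y n w + al)); last by apply/funext => n; rewrite subrK.
  exact: (cvgD H (@Ycos t al)).
have ub : 2 * pb n + `|t| * (Num.sqrt (s n) * (C + 1)) @[n --> \oo] --> (0 : R).
  have := @sqrt_continuous R 0; rewrite /continuous_at sqrtr0 => sc.
  have ss : Num.sqrt (s n) @[n --> \oo] --> (0 : R) by exact: (cvg_comp _ _ s0 sc).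
  rewrite (_ : (0 : R) = 2 * 0 + `|t| * (0 * (C + 1))); last by rewrite mul0r !mulr0 addr0.
  apply: cvgD; first by apply: cvgM => //; exact: cvg_cst.
  apply: cvgM; first exact: cvg_cst.
  by apply: cvgM => //; exact: cvg_cst.
apply: norm_cvg0; apply: (cvg0_le _ ub); near=> n.
have [ZYM Pbad [sn0 iM2 EM2] [iY2 EY2]] : [/\ forall w, 1 / 2 <= M n w -> Z n w = Y n w / M n w,
  (P (~` good n) <= (pb n)%:E)%E,
  [/\ 0 < s n, P.-integrable setT (EFin \o (fun w => (M n w - 1) ^+ 2)) &
    \int[P]_w ((M n w - 1) ^+ 2) <= s n] &
  P.-integrable setT (EFin \o (fun w => Y n w ^+ 2)) /\ \int[P]_w (Y n w ^+ 2) <= C] by near: n.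
rewrite normr_ge0/=.
have q0 : 0 < Num.sqrt (s n) by rewrite sqrtr_gt0.
set r := Num.sqrt (s n) in q0 *.
have r2 : s n = r ^+ 2 by rewrite sqr_sqrtr// ltW.
have iZ := integrable_cos_affine P t al (mZ n); have iY := integrable_cos_affine P t al (mY n).
rewrite -(RintegralB _ iZ iY)//.
have iB : P.-integrable setT (EFin \o (fun w => 2 * \1_(~` good n) w +
    `|t| * (r * Y n w ^+ 2 + r^-1 * (M n w - 1) ^+ 2))).
  apply: integrable_addr; first exact: integrable_mulrl.
  by apply: integrable_mulrl; apply: integrable_addr; exact: integrable_mulrl.
have pw w : `|cos (t * Z n w + al) - cos (t * Y n w + al)| <=
    2 * \1_(~` good n) w + `|t| * (r * Y n w ^+ 2 + r^-1 * (M n w - 1) ^+ 2).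
  have r0 : 0 <= r * Y n w ^+ 2 + r^-1 * (M n w - 1) ^+ 2.
    by apply: addr_ge0; apply: mulr_ge0; rewrite ?sqr_ge0 ?invr_ge0 ?(ltW q0).
  have [wg|wg] := boolP (w \in good n); last first.
    rewrite indicE in_setC wg/= mulr1.
    rewrite (le_trans (ler_normB _ _))//.
    have := cos_max (t * Z n w + al); have := cos_max (t * Y n w + al).
    have : 0 <= `|t| * (r * Y n w ^+ 2 + r^-1 * (M n w - 1) ^+ 2) by rewrite mulr_ge0.
    lra.
  rewrite indicE in_setC wg/= mulr0 add0r (le_trans (cos_lipschitz _ _))//.
  rewrite (_ : t * Z n w + al - _ = t * (Z n w - Y n w)); last by ring.
  rewrite normrM ler_wpM2l//.
  move: wg; rewrite inE /good/= => wg; have M0 : 0 < M n w by lra.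
  rewrite ZYM// (_ : Y n w / M n w - Y n w = Y n w * (1 - M n w) / M n w); last by field; exact: lt0r_neq0.
  rewrite normrM normfV (gtr0_norm M0) ler_pdivrMr// normrM (distrC 1).
  have rr : r^-1 * r = 1 by rewrite mulVf ?lt0r_neq0.
  rewrite -(real_normK (num_real (Y n w))) -(real_normK (num_real (M n w - 1))).
  have y0 := normr_ge0 (Y n w); have m0 := normr_ge0 (M n w - 1).
  move: (`|Y n w|) (`|M n w - 1|) y0 m0 => y m y0 m0.
  have key : 2 * (y * m) <= r * y ^+ 2 + r^-1 * m ^+ 2.
    rewrite -(ler_pM2l q0) mulrDr (mulrA r r^-1) mulfV ?lt0r_neq0// mul1r.
    by have := sqr_ge0 (r * y - m); nra.
  have k0 : 0 <= y * m by exact: mulr_ge0.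
  have M12 : 1 <= 2 * M n w by lra.
  apply: (@le_trans _ _ (2 * (y * m) * M n w)); last by rewrite ler_wpM2r// ltW.
  by nra.
apply: (le_trans (le_normr_Rintegral measurableT (integrable_subr iZ iY))).
apply: (le_trans (le_Rintegral measurableT (integrable_norm (integrable_subr iZ iY)) iB (fun w _ => pw w))).
have i1 : P.-integrable setT (EFin \o (fun w => r * Y n w ^+ 2)) by exact: integrable_mulrl.
have i2 : P.-integrable setT (EFin \o (fun w => r^-1 * (M n w - 1) ^+ 2)) by exact: integrable_mulrl.
have i3 := integrable_addr i1 i2.
rewrite (RintegralD _ (integrable_mulrl 2 (ind_bad n)) (integrable_mulrl `|t| i3))//.
rewrite (RintegralZl _ measurableT (ind_bad n)) int_bad (RintegralZl _ measurableT i3).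
rewrite (RintegralD _ i1 i2)// (RintegralZl _ measurableT iY2) (RintegralZl _ measurableT iM2).
apply: lerD; first by rewrite ler_pM2l// -lee_fin fineK.
rewrite ler_wpM2l// mulrDr mulr1; apply: lerD; first by rewrite ler_pM2l.
by rewrite ler_pdivrMl// -expr2 -r2.
Unshelve. all: by end_near. Qed.

(** Where M >= 1/2, |Z| > A forces |Y| > A/2; Chebyshev gives 4 C/A^2, which is e/2 for the chosen
    A. The other half of e pays for the bad event. *)
Lemma ratio_tight e : 0 < e ->
  exists A : R, \forall n \near \oo, (P [set w | (A < `|Z n w|)%R] <= e%:E)%E.
Proof.
move=> e0; pose A := Num.sqrt (8 * C / e); exists A.
have A0 : 0 < A by rewrite sqrtr_gt0 divr_gt0// mulr_gt0.
have A2 : A ^+ 2 = 8 * C / e by rewrite sqr_sqrtr// divr_ge0 ?mulr_ge0 ?ltW.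
have e2 : 0 < e / 2 by rewrite divr_gt0.
have /cvgr0Pnorm_lt/(_ _ e2) pe := pb0.
near=> n.
have [ZYM Pbad _ [iY2 EY2]] : [/\ forall w, 1 / 2 <= M n w -> Z n w = Y n w / M n w,
  (P (~` good n) <= (pb n)%:E)%E,
  [/\ 0 < s n, P.-integrable setT (EFin \o (fun w => (M n w - 1) ^+ 2)) &
    \int[P]_w ((M n w - 1) ^+ 2) <= s n] &
  P.-integrable setT (EFin \o (fun w => Y n w ^+ 2)) /\ \int[P]_w (Y n w ^+ 2) <= C] by near: n.
have pbe : `|pb n| < e / 2 by near: n.
pose V := [set w | A < `|Z n w|].
have mV : measurable V.
  rewrite (_ : V = (fun w => `|Z n w|) @^-1` `]A, +oo[).
    by rewrite -[X in measurable X]setTI; apply: (measurableT_comp (@normr_measurable R setT) (mZ n)).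
  by apply/seteqP; split => w /=; rewrite in_itv/= andbT.
have iV : P.-integrable setT (EFin \o (\1_V : T -> R)).
  apply: (@bounded_integrable _ _ _ _ _ 1); first exact: measurable_indic.
  by move=> w; rewrite indicE; case: (_ \in _); rewrite ?normr1 ?normr0.
have fV : P V \is a fin_num by rewrite fin_num_measure.
rewrite -/V -(fineK fV) lee_fin.
have -> : fine (P V) = \int[P]_w \1_V w by rewrite /Rintegral (integral_indic P measurableT)// setIT.
have iR := integrable_addr (ind_bad n) (integrable_mulrl (4 / A ^+ 2) iY2).
apply: (@le_trans _ _ (\int[P]_w (\1_(~` good n) w + 4 / A ^+ 2 * Y n w ^+ 2))).
  apply: le_Rintegral => // w _.
  have r0 : 0 <= 4 / A ^+ 2 * Y n w ^+ 2 by rewrite mulr_ge0 ?sqr_ge0// divr_ge0 ?sqr_ge0.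
  have [wg|wg] := boolP (w \in good n); last first.
    by rewrite [\1_(~` _) _]indicE in_setC wg/= indicE; case: (_ \in V) => /=; lra.
  rewrite [\1_(~` _) _]indicE in_setC wg/= add0r indicE; case: (boolP (w \in V)) => //= wV.
  move: wg wV; rewrite !inE /good /V /= => wg wV.
  have M0 : 0 < M n w by lra.
  have : A * M n w < `|Y n w|.
    by move: wV; rewrite ZYM// normrM normfV (gtr0_norm M0) ltr_pdivlMr.
  move=> AY; rewrite -(real_normK (num_real (Y n w))) mulrAC ler_pdivlMr ?exprn_gt0// mul1r.
  have : A / 2 <= `|Y n w|.
    by apply: (le_trans _ (ltW AY)); rewrite ler_pM2l//; lra.
  rewrite -(@ler_pXn2r _ 2) ?nnegrE ?divr_ge0 ?(ltW A0)// expr_div_n; lra.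
rewrite RintegralD//; last exact: integrable_mulrl.
rewrite int_bad RintegralZl// A2.
have h1 : fine (P (~` good n)) <= e / 2.
  rewrite -lee_fin fineK// (le_trans Pbad)// lee_fin.
  by rewrite (le_trans (ler_norm _))// ltW.
have h2 : 4 / (8 * C / e) * \int[P]_w (Y n w ^+ 2) <= e / 2.
  have -> : 4 / (8 * C / e) = e / 2 / C by field; rewrite !lt0r_neq0.
  by rewrite mulrAC ler_pdivrMr// ler_pM2l.
lra.
Unshelve. all: by end_near. Qed.

End ratio.

Lemma integral_normal_law_cos (R : realType) (v t al : R) : 0 <= v ->
  \int[normal_law 0 v]_x cos (t * x + al) = cos al * expR (- (v * t ^+ 2 / 2)).
Proof.
move=> v0; rewrite /normal_law; case: eqVneq => [->|vn0].
  rewrite /Rintegral integral_dirac//; last first.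
    by apply/measurable_EFinP; exact: measurable_cos_affine.
  by rewrite diracT mul1e/= mulr0 add0r !mul0r oppr0 expR0 mulr1.
set s := Num.sqrt v.
have s0 : 0 < s by rewrite sqrtr_gt0 lt_neqAle eq_sym vn0.
have s2 : v = s ^+ 2 by rewrite sqr_sqrtr.
rewrite s2 -(gaussian_fourier s0 al t).
set c := fun x : R => cos (t * x + al).
have mc : measurable_fun setT c by exact: measurable_cos_affine.
have ic : (normal_prob 0 s).-integrable setT (EFin \o c) by exact: integrable_cos_affine.
have p0 x : 0 <= normal_pdf 0 s x by exact: normal_pdf_ge0.
have mp : measurable_fun setT (normal_pdf 0 s) by exact: measurable_normal_pdf.
have ip : (@lebesgue_measure R).-integrable setT (EFin \o normal_pdf 0 s).
  exact: integrable_normal_pdf.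
have icp : (@lebesgue_measure R).-integrable setT (EFin \o (fun x => c x * normal_pdf 0 s x)).
  exact: (@integrable_bounded_mul _ _ R (@lebesgue_measure R) c (normal_pdf 0 s) 1 mc (fun x => cos_max _) ip).
(* Adding 1 makes the cosine nonnegative, as the density formula requires; the total masses are
   subtracted afterwards. *)
have shift : \int[normal_prob 0 s]_x (c x + 1) = \int[@lebesgue_measure R]_x ((c x + 1) * normal_pdf 0 s x).
  rewrite /Rintegral (eq_measure_integral (mdensity (@lebesgue_measure R) mp p0)); last by [].
  rewrite ge0_integral_mdensity//.
  - by apply/measurable_EFinP; exact: measurable_funD.
  - by move=> x; rewrite lee_fin /c; have := cos_geN1 (t * x + al); lra.
have i1 : (normal_prob 0 s).-integrable setT (EFin \o cst (1 : R)) by exact: integrable_probability_cst.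
move: shift; rewrite (RintegralD _ ic i1)//.
have -> : \int[normal_prob 0 s]_x cst (1 : R) x = 1 by exact: Rintegral_probability_cst.
under [RHS]eq_Rintegral do rewrite mulrDl mul1r.
rewrite (RintegralD _ icp ip)//.
have -> : \int[@lebesgue_measure R]_x normal_pdf 0 s x = 1.
  by rewrite /Rintegral integral_normal_pdf// gt_eqF.
by move=> /addIr.
Qed.

(** * The subsampling scheme *)

Section subsampling.
Context {R : realType} {d : nat} {disp : measure_display}
  {Omega : measurableType disp} {P : probability Omega R}.
Variables (f q0 K : 'rV[R]_d -> R) (h lam : nat -> R) (ell : nat -> nat).
Variables (X : nat -> {RV P >-> 'rV[R]_d}) (Xs : nat -> nat -> {RV P >-> 'rV[R]_d}).

(** The generating family of [history k m], kept apart from its sigma-algebra so that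
    [g_sigma_algebraType] can turn the past into a measurable space. *)
Definition past_generators (k m : nat) : set (set Omega) :=
  (\bigcup_(j in [set j | (1 <= j <= k)%N])
     preimage_set_system setT (X j) measurable) `|`
  (\bigcup_(j in [set j | (1 <= j <= m)%N])
     \bigcup_(i in `I_(ell j)) preimage_set_system setT (Xs j i) measurable).

Local Notation past k m := (g_sigma_algebraType (past_generators k m)).
Local Notation density := (sampling_density q0 K h lam ell Xs).
Local Notation wt := (weight f q0 K h lam ell X Xs).
Local Notation wt_sum := (weight_sum f q0 K h lam ell X Xs).
Local Notation nwt := (nweight f q0 K h lam ell X Xs).
Local Notation kde := (bootstrap_kde K h ell Xs).
Local Notation mu := (@lebesgue_rV R d).

Variable c1 : R.
Hypotheses (HK : smoothing_kernel K) (Hf : is_density f) (Hq0 : is_density q0).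
Hypotheses (c1_gt0 : 0 < c1) (fq0 : forall x, f x <= c1 * q0 x).
Hypotheses (h_gt0 : forall k, (1 <= k)%N -> 0 < h k).
Hypotheses (lam_itv : forall k, (1 <= k)%N -> 0 < lam k <= 1).
Hypotheses (lam_nincr : forall j k, (1 <= j)%N -> (j <= k)%N -> lam k <= lam j).
Hypotheses (sampling : forall k, sampling_step q0 K h lam ell X Xs k).

Let mK := kernel_measurable HK.
Let mf : measurable_fun setT f. Proof. by case: Hf. Qed.
Let mq0 : measurable_fun setT q0. Proof. by case: Hq0. Qed.
Let f0 x : 0 <= f x. Proof. by case: Hf. Qed.
Let q00 x : 0 <= q0 x. Proof. by case: Hq0. Qed.
Let mX i : measurable_fun setT (X i : Omega -> _). Proof. exact: measurable_funPT. Qed.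

Lemma past_generators_measurable k m : past_generators k m `<=` measurable.
Proof.
move=> A [[j _ [B mB <-]]|[j _ [i _ [B mB <-]]]];
  by exact: (measurable_funPT _ measurableT _ mB).
Qed.

Lemma measurable_X_past k m j : (1 <= j <= k)%N ->
  measurable_fun setT (X j : past k m -> 'rV[R]_d).
Proof.
move=> jk _ B mB; apply: sub_sigma_algebra; left; exists j => //.
by exists B.
Qed.

Lemma measurable_Xs_past k m j i : (1 <= j <= m)%N -> (i < ell j)%N ->
  measurable_fun setT (Xs j i : past k m -> 'rV[R]_d).
Proof.
move=> jm ij _ B mB; apply: sub_sigma_algebra; right; exists j => //; exists i => //.
by exists B.
Qed.

Lemma measurable_rescale_sub k (T : measurableType k) (c : R) (u v : T -> 'rV[R]_d) :
  measurable_fun setT u -> measurable_fun setT v ->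
  measurable_fun setT (fun w => rescale K c (u w - v w)).
Proof.
move=> mu mv; rewrite /rescale; apply: measurable_funM => //.
apply: (measurableT_comp mK); apply: measurable_fun_rV => i /=.
under eq_fun do rewrite !mxE.
apply: measurable_funM => //; apply: measurable_funB.
- exact: (measurableT_comp (measurable_coord_rV i) mu).
- exact: (measurableT_comp (measurable_coord_rV i) mv).
Qed.

Lemma measurable_density_past k k' m : (k <= m)%N ->
  measurable_fun setT (fun z : past k' m * 'rV[R]_d => density k z.1 z.2).
Proof.
case: k => [_|k km] /=; first exact: (measurableT_comp mq0 measurable_snd).
apply: measurable_funD; apply: measurable_funM => //; last first.
  exact: (measurableT_comp mq0 measurable_snd).
rewrite /bootstrap_kde; apply: measurable_funM => //.
apply: measurable_sum => i; apply: measurable_rescale_sub; first exact: measurable_snd.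
apply: measurableT_comp measurable_fst.
exact: measurable_Xs_past.
Qed.

Lemma measurable_density_at_past k k' m (Y : past k' m -> 'rV[R]_d) : (k <= m)%N ->
  measurable_fun setT Y ->
  measurable_fun setT (fun w : past k' m => density k w (Y w)).
Proof.
move=> km mY.
have mp : measurable_fun setT (fun w : past k' m => (w, Y w))
  by apply/measurable_fun_pairP; split; [exact: measurable_id|exact: mY].
exact: (measurableT_comp (measurable_density_past km) mp).
Qed.

Lemma measurable_weight_past k k' m : (1 <= k <= k')%N -> (k.-1 <= m)%N ->
  measurable_fun setT (wt k : past k' m -> R).
Proof.
move=> kk' km; rewrite /weight; apply: measurable_funM.
  exact: (measurableT_comp mf (measurable_X_past kk')).
apply: (measurableT_comp (@measurable_fun_inv R)).
exact: (measurable_density_at_past km (measurable_X_past kk')).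
Qed.

Lemma measurable_weight_sum_past k k' m : (k <= k')%N -> (k.-1 <= m)%N ->
  measurable_fun setT (wt_sum k : past k' m -> R).
Proof.
move=> kk' km; rewrite /weight_sum.
rewrite (_ : (fun _ => _) = (fun w => \sum_(j < k) wt j.+1 w)); last first.
  by apply/funext => w; rewrite big_add1 big_mkord.
apply: measurable_sum => j; apply: measurable_weight_past.
  by rewrite /= (leq_trans (ltn_ord j)).
by rewrite /= (leq_trans _ km)// -ltnS prednK ?(leq_ltn_trans _ (ltn_ord j)).
Qed.

Lemma measurable_nweight_past n k k' m : (1 <= k <= n)%N -> (n <= k')%N -> (n.-1 <= m)%N ->
  measurable_fun setT (nwt n k : past k' m -> R).
Proof.
move=> /andP[k0 kn] nk' nm; rewrite /nweight; apply: measurable_funM.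
  apply: measurable_weight_past; first by rewrite k0 (leq_trans kn).
  by rewrite (leq_trans _ nm)// -!subn1 leq_sub2r.
apply: (measurableT_comp (@measurable_fun_inv R)).
exact: measurable_weight_sum_past.
Qed.

Lemma measurable_weight k : (1 <= k)%N -> measurable_fun setT (wt k).
Proof.
move=> k0; apply: (measurable_fun_g_sigma (@past_generators_measurable k k.-1)).
by apply: measurable_weight_past; rewrite ?k0 /=.
Qed.

Lemma measurable_weight_sum k : measurable_fun setT (wt_sum k).
Proof.
apply: (measurable_fun_g_sigma (@past_generators_measurable k k.-1)).
exact: measurable_weight_sum_past.
Qed.

Lemma measurable_nweight n k : (1 <= k)%N -> measurable_fun setT (nwt n k).
Proof.
move=> k0; apply: measurable_funM; first exact: measurable_weight.
apply: (measurableT_comp (@measurable_fun_inv R)); exact: measurable_weight_sum.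
Qed.

Lemma measurable_density k : measurable_fun setT (fun z : Omega * 'rV[R]_d => density k z.1 z.2).
Proof.
have mp : measurable_fun setT (fun z : Omega * 'rV[R]_d => (z.1 : past 0 k, z.2)).
  apply/measurable_fun_pairP; split; last exact: measurable_snd.
  apply: (measurableT_comp (measurable_id_g_sigma (@past_generators_measurable 0 k))).
  exact: measurable_fst.
exact: (measurableT_comp (measurable_density_past (leqnn k)) mp).
Qed.

(* X_1 has density q0, which amounts to lam 0 = 1 whatever the value of lam at 0. *)
Definition density_floor (k : nat) : R := if k is 0 then 1 else lam k.

Let mwt k : measurable_fun setT (wt k.+1). Proof. exact: measurable_weight. Qed.

Lemma density_floor_itv k : 0 < density_floor k <= 1.
Proof. by case: k => [|k] /=; [rewrite ltr01 lexx|exact: lam_itv]. Qed.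

Let floor_gt0 k : 0 < density_floor k.
Proof. by have /andP[] := density_floor_itv k. Qed.

Lemma bootstrap_kde_ge0 k w x : (1 <= k)%N -> 0 <= bootstrap_kde K h ell Xs k w x.
Proof.
move=> k0; rewrite mulr_ge0// sumr_ge0// => i _.
exact: (rescale_ge0 HK _ (h_gt0 k0)).
Qed.

Lemma density_ge k w x : density_floor k * q0 x <= density k w x.
Proof.
case: k => [|k] /=; first by rewrite mul1r.
rewrite lerDr mulr_ge0 ?bootstrap_kde_ge0//.
by have /andP[_ ?] := lam_itv (ltn0Sn k); rewrite subr_ge0.
Qed.

Lemma density_ge0 k w x : 0 <= density k w x.
Proof. by rewrite (le_trans _ (density_ge k w x))// mulr_ge0// ltW. Qed.

(** Where the density vanishes so does f, by f <= c1 q0 and the floor of the density; the convention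
    y / 0 = 0 is therefore harmless. *)
Lemma ratio_mulK k w x : f x / density k w x * density k w x = f x.
Proof.
have [q0E|qn0] := eqVneq (density k w x) 0; last by rewrite divfK.
rewrite q0E mulr0; apply/eqP; rewrite eq_le f0/= (le_trans (fq0 x))//.
rewrite -(pmulr_rle0 _ (floor_gt0 k)) mulrCA pmulr_rle0//.
by rewrite -q0E density_ge.
Qed.

Lemma ratio_ge0 k w x : 0 <= f x / density k w x.
Proof. by rewrite divr_ge0 ?f0 ?density_ge0. Qed.

Lemma ratio_le k w x : f x / density k w x <= c1 / density_floor k.
Proof.
have [q0E|qn0] := eqVneq (density k w x) 0.
  by rewrite q0E invr0 mulr0 divr_ge0// ltW.
rewrite ler_pdivrMr; last by rewrite lt0r qn0 density_ge0.
rewrite (le_trans (fq0 x))// -mulrA ler_pM2l//.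
by rewrite ler_pdivlMl ?floor_gt0 ?density_ge.
Qed.

Lemma measurable_ratio_past k :
  measurable_fun setT (fun z : past k k * 'rV[R]_d => f z.2 / density k z.1 z.2).
Proof.
apply: measurable_funM; first exact: (measurableT_comp mf measurable_snd).
apply: (measurableT_comp (@measurable_fun_inv R)).
exact: measurable_density_past.
Qed.

Local Open Scope ereal_scope.

Let past_meas k := @past_generators_measurable k k.

Let mdens k := measurable_density_past (k' := k) (leqnn k).

Let dens_ge0 k (z : past k k * 'rV[R]_d) : (0 <= density k z.1 z.2)%R.
Proof. exact: density_ge0. Qed.

Let lawX k A B : <<s past_generators k k >> A -> measurable B ->
  P (A `&` X k.+1 @^-1` B) = \int[P]_(w in A) \int[mu]_(x in B) (density k w x)%:E.
Proof. by move=> FA mB; have [_ ->] := sampling k mB. Qed.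

Lemma ge0_integral_next k (psi : past k k * 'rV[R]_d -> \bar R) :
  measurable_fun setT psi -> (forall z, 0 <= psi z) ->
  \int[P]_w psi (w, X k.+1 w) = \int[P]_w \int[mu]_x (psi (w, x) * (density k w x)%:E).
Proof.
move=> mpsi psi0.
exact: (ge0_integral_cond_law (@past_meas k) (@mX k.+1) (@mdens k) (@dens_ge0 k)
  (@lawX k) mpsi psi0).
Qed.

Lemma ge0_integral_weight k (u : 'rV[R]_d -> R) :
  measurable_fun setT u -> (forall x, 0 <= u x)%R ->
  \int[P]_w (wt k.+1 w * u (X k.+1 w))%:E = \int[mu]_x (f x * u x)%:E.
Proof.
move=> mu_ u0.
rewrite (ge0_integral_next (psi := fun z => (f z.2 / density k z.1 z.2 * u z.2)%:E)).
- transitivity (\int[P]_w \int[mu]_x (f x * u x)%:E).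
    apply: eq_integral => w _; apply: eq_integral => x _.
    by rewrite -EFinM mulrAC ratio_mulK.
  by rewrite integral_cst//= (@probability_setT _ _ _ P) mule1.
- apply/measurable_EFinP/measurable_funM; first exact: measurable_ratio_past.
  exact: (measurableT_comp mu_ measurable_snd).
- by move=> z; rewrite lee_fin mulr_ge0 ?ratio_ge0.
Qed.

Lemma weight_ge0 k w : (0 <= wt k.+1 w)%R. Proof. exact: ratio_ge0. Qed.

Lemma weight_le k w : (wt k.+1 w <= c1 / density_floor k)%R. Proof. exact: ratio_le. Qed.

(** This replaces conditional expectations: the mean of a weighted term is tested against an
    integrable function Z of the past. It serves with Z equal to 1, to a partial sum and to a cosine
    of a partial sum. *)
Lemma integral_weight k (Z : past k k -> R) (u : 'rV[R]_d -> R) :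
  measurable_fun setT Z -> P.-integrable setT (EFin \o (Z : Omega -> R)) ->
  measurable_fun setT u -> \int[mu]_x (f x * `|u x|)%:E < +oo ->
  P.-integrable setT (EFin \o (fun w : Omega => Z w * (wt k.+1 w * u (X k.+1 w)))%R) /\
  (\int[P]_w (Z w * (wt k.+1 w * u (X k.+1 w))) =
    (\int[P]_w Z w) * (\int[mu]_x (f x * u x)))%R.
Proof.
move=> mZ iZ mu_ uoo.
have iu : mu.-integrable setT (EFin \o (fun x => f x * u x)%R).
  apply/integrableP; split; first exact/measurable_EFinP/measurable_funM.
  rewrite (_ : integral _ _ _ = \int[mu]_x (f x * `|u x|)%:E)//.
  by apply: eq_integral => x _; rewrite /= normrM (ger0_norm (f0 x)).
pose psi (z : past k k * 'rV[R]_d) := (Z z.1 * (f z.2 / density k z.1 z.2 * u z.2))%R.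
have mpsi : measurable_fun setT psi.
  apply: measurable_funM; first exact: (measurableT_comp mZ measurable_fst).
  apply: measurable_funM; first exact: measurable_ratio_past.
  exact: (measurableT_comp mu_ measurable_snd).
have psiE w x : (psi (w, x) * density k w x = Z w * (f x * u x))%R.
  by rewrite /psi /= -mulrA [(_ * u x * _)%R]mulrAC ratio_mulK.
have [|iV VE] := integral_cond_law (@past_meas k) (@mX k.+1) (@mdens k) (@dens_ge0 k)
  (@lawX k) mpsi.
  under eq_integral => w _.
    under eq_integral => x _.
      rewrite -[density k _ _](ger0_norm (density_ge0 k w x)) -normrM psiE normrM EFinM.
      rewrite [(`|(f x * u x)%R|)%R](_ : _ = (f x * `|u x|)%R); last by rewrite normrM (ger0_norm (f0 x)).
      over.
    rewrite ge0_integralZl_EFin//; last 2 first.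
    + by move=> x _; rewrite lee_fin mulr_ge0.
    + by apply/measurable_EFinP/measurable_funM => //; exact: measurableT_comp.
    over.
  set J := integral mu _ _.
  have J0 : 0 <= J by apply: integral_ge0 => x _; rewrite lee_fin mulr_ge0.
  have Jfin : J \is a fin_num by rewrite ge0_fin_numE.
  rewrite -(fineK Jfin) ge0_integralZr//.
  - rewrite (fineK Jfin) lte_mul_pinfty//; first exact: integral_ge0.
      rewrite ge0_fin_numE ?integral_ge0//.
    by move/integrableP : iZ => [].
  - apply/measurable_EFinP/measurableT_comp => //.
    exact/measurable_EFinP/(measurable_int _ iZ).
  - by rewrite lee_fin fine_ge0.
split; first exact: iV.
have fin : \int[mu]_x (f x * u x)%:E \is a fin_num by exact: integrable_fin_num.
rewrite /Rintegral (_ : integral P _ _ = \int[P]_w ((Z w)%:E * \int[mu]_x (f x * u x)%:E)).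
  by rewrite -[X in \int[P]_w (_ * X)](fineK fin) integralZr// fineM// integrable_fin_num.
rewrite VE; apply: eq_integral => w _; rewrite -integralZl//.
by apply: eq_integral => x _; rewrite psiE.
Qed.

Lemma integrable_weight k (u : 'rV[R]_d -> R) :
  measurable_fun setT u -> \int[mu]_x (f x * `|u x|)%:E < +oo ->
  P.-integrable setT (EFin \o (fun w => wt k.+1 w * u (X k.+1 w))%R).
Proof.
move=> mu_ uoo.
have [+ _] := @integral_weight k (cst 1%R) u (measurable_cst _)
  (integrable_probability_cst P 1%R) mu_ uoo.
by under eq_fun do rewrite mul1r.
Qed.

Local Close Scope ereal_scope.

Let if_ : mu.-integrable setT (EFin \o f).
Proof.
case: Hf => _ _ f1; apply/integrableP; split; first exact/measurable_EFinP.
under eq_integral => x _ do rewrite /= (ger0_norm (f0 x)).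
by rewrite f1 ltry.
Qed.

Let mwtu k (u : 'rV[R]_d -> R) : measurable_fun setT u ->
  measurable_fun setT (fun w => wt k.+1 w * u (X k.+1 w)).
Proof. by move=> mu_; apply: measurable_funM => //; exact: measurableT_comp (@mX k.+1). Qed.

Lemma integrable_density_mul (u : 'rV[R]_d -> R) (B : R) : measurable_fun setT u ->
  (forall x, `|u x| <= B) -> mu.-integrable setT (EFin \o (fun x => f x * u x)).
Proof.
move=> mu_ uB; under eq_fun do rewrite mulrC.
exact: (integrable_bounded_mul mu_ uB if_).
Qed.

(** One factor of the squared weight is bounded by c1 over the floor; the other turns the density of
    X into f. *)
Lemma weight_second_moment k (u : 'rV[R]_d -> R) (B : R) : measurable_fun setT u ->
  (forall x, `|u x| <= B) ->
  \int[P]_w ((wt k.+1 w * u (X k.+1 w)) ^+ 2) <=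
    c1 / density_floor k * \int[mu]_x (f x * u x ^+ 2).
Proof.
move=> mu_ uB.
have C0 : 0 <= c1 / density_floor k by rewrite divr_ge0// ltW.
have mu2 : measurable_fun setT (fun x => u x ^+ 2) by exact: measurable_funX.
have u2B x : `|u x ^+ 2| <= B ^+ 2.
  by rewrite normrX ler_pXn2r// nnegrE// (le_trans _ (uB x)).
have B0 : 0 <= B by rewrite (le_trans _ (uB 0)).
have m2 := mwtu k mu2.
have wB w : `|wt k.+1 w * u (X k.+1 w) ^+ 2| <= c1 / density_floor k * B ^+ 2.
  by rewrite normrM ler_pM// ger0_norm ?weight_ge0 ?weight_le.
have <- : \int[P]_w (wt k.+1 w * u (X k.+1 w) ^+ 2) = \int[mu]_x (f x * u x ^+ 2).
  by rewrite /Rintegral (ge0_integral_weight k mu2)// => x; exact: sqr_ge0.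
rewrite -RintegralZl//; last exact: (bounded_integrable P m2 wB).
apply: le_Rintegral => //.
- apply: (@bounded_integrable _ _ _ _ _ ((c1 / density_floor k * B) ^+ 2)).
    exact/measurable_funX/mwtu.
  move=> w; rewrite normrX ler_pXn2r// ?nnegrE ?(mulr_ge0 C0 B0)//.
  by rewrite normrM ler_pM// ger0_norm ?weight_ge0 ?weight_le.
- apply: (@bounded_integrable _ _ _ _ _ (c1 / density_floor k * (c1 / density_floor k * B ^+ 2))).
    exact: measurable_funM.
  by move=> w; rewrite normrM ler_pM// ger0_norm.
move=> w _; rewrite exprMn expr2 -mulrA.
by rewrite ler_wpM2r ?weight_le// mulr_ge0 ?weight_ge0 ?sqr_ge0.
Qed.

(** The centred summands are orthogonal to the partial sums before them, so second moments add up.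
    Boundedness of u makes every variable bounded, hence integrable. *)
Lemma weighted_sum_deviation k (u : 'rV[R]_d -> R) (B : R) : measurable_fun setT u ->
  (forall x, `|u x| <= B) ->
  \int[P]_w ((\sum_(i < k) (wt i.+1 w * u (X i.+1 w) - \int[mu]_x (f x * u x))) ^+ 2) <=
    (\sum_(i < k) c1 / density_floor i) * \int[mu]_x (f x * u x ^+ 2).
Proof.
move=> mu_ uB; set b := \int[mu]_x (f x * u x); set v := \int[mu]_x _.
pose Y i w := wt i.+1 w * u (X i.+1 w) - b.
pose S i w := \sum_(j < i) Y j w.
have B0 : 0 <= B by rewrite (le_trans _ (uB 0)).
pose C i := c1 / density_floor i * B + `|b|.
have YC i w : `|Y i w| <= C i.
  rewrite (le_trans (ler_normB _ _))// lerD2r normrM ler_pM// ger0_norm ?weight_ge0 ?weight_le//.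
have SC i w : `|S i w| <= \sum_(j < i) C j.
  by rewrite (le_trans (ler_norm_sum _ _ _))// ler_sum.
have mY i : measurable_fun setT (Y i) by apply: measurable_funB => //; exact: mwtu.
have mS i : measurable_fun setT (S i) by exact: measurable_sum.
have mSpast i : measurable_fun setT (S i : past i i -> R).
  apply: measurable_sum => j; apply: measurable_funB => //; apply: measurable_funM.
    by apply: measurable_weight_past => //=; exact: ltnW.
  apply: (measurableT_comp mu_); apply: measurable_X_past; exact: ltn_ord.
have uoo : (\int[mu]_x (f x * `|u x|)%:E < +oo)%E.
  have /integrableP[_] := integrable_density_mul mu_ uB.
  rewrite (_ : integral _ _ _ = \int[mu]_x (f x * `|u x|)%:E)%E//.
  by apply: eq_integral => x _; rewrite /= normrM (ger0_norm (f0 x)).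
have iS i : P.-integrable setT (EFin \o S i) by exact: bounded_integrable (mS i) (SC i).
have ib (Z : Omega -> R) D := @bounded_integrable _ _ _ P Z D.
have iS2 i : P.-integrable setT (EFin \o (fun w => S i w ^+ 2)).
  apply: (ib _ ((\sum_(j < i) C j) ^+ 2)); first exact: measurable_funX.
  by move=> w; rewrite normrX ler_pXn2r// nnegrE (le_trans _ (SC i w)).
have iSY i : P.-integrable setT (EFin \o (fun w => S i w * Y i w)).
  apply: (ib _ ((\sum_(j < i) C j) * C i)); first exact: measurable_funM.
  by move=> w; rewrite normrM ler_pM.
have iY2 i : P.-integrable setT (EFin \o (fun w => Y i w ^+ 2)).
  apply: (ib _ ((C i) ^+ 2)); first exact: measurable_funX.
  by move=> w; rewrite normrX ler_pXn2r// nnegrE (le_trans _ (YC i w)).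
have SY0 i : \int[P]_w (S i w * Y i w) = 0.
  have [iW E] := integral_weight (@mSpast i) (iS i) mu_ uoo.
  under eq_Rintegral do rewrite mulrBr.
  rewrite RintegralB//; last first.
    apply: (ib _ ((\sum_(j < i) C j) * `|b|)); first exact: measurable_funM.
    by move=> w; rewrite normrM ler_wpM2r.
  by rewrite E RintegralZr// ?subrr.
have Wu i : \int[P]_w (wt i.+1 w * u (X i.+1 w)) = b.
  have [_] := @integral_weight i (cst 1) u (measurable_cst _)
    (integrable_probability_cst P 1) mu_ uoo.
  under eq_Rintegral do rewrite mul1r.
  by move=> ->; rewrite (_ : Rintegral P _ _ = 1) ?mul1r//; exact: Rintegral_probability_cst.
have Y2 i : \int[P]_w (Y i w ^+ 2) <= c1 / density_floor i * v.
  apply: le_trans (weight_second_moment i mu_ uB).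
  have iWu2 : P.-integrable setT (EFin \o (fun w => (wt i.+1 w * u (X i.+1 w)) ^+ 2)).
    apply: (ib _ ((c1 / density_floor i * B) ^+ 2)); first exact/measurable_funX/mwtu.
    move=> w; rewrite normrX ler_pXn2r// ?nnegrE; last by rewrite mulr_ge0// divr_ge0// ltW.
    by rewrite normrM ler_pM// ger0_norm ?weight_ge0 ?weight_le.
  rewrite (_ : \int[P]_w (Y i w ^+ 2) =
      \int[P]_w ((wt i.+1 w * u (X i.+1 w)) ^+ 2 - ((2 * b) * (wt i.+1 w * u (X i.+1 w)) - b ^+ 2))); last first.
    by apply: eq_Rintegral => w _; rewrite /Y; ring.
  have i1 : P.-integrable setT (EFin \o (fun w => (2 * b) * (wt i.+1 w * u (X i.+1 w)))).
    exact: integrable_mulrl (integrable_weight i mu_ uoo).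
  have i2 : P.-integrable setT (EFin \o (fun _ => b ^+ 2)) by exact: integrable_probability_cst.
  rewrite RintegralB//; last exact: integrable_subr.
  rewrite RintegralB// (RintegralZl _ measurableT (integrable_weight i mu_ uoo)) Wu Rintegral_probability_cst.
  by have := sqr_ge0 b; nra.
elim: k => [|k IH].
  rewrite big_ord0 mul0r; under eq_Rintegral do rewrite big_ord0 expr0n/=.
  by rewrite /Rintegral integral0.
rewrite big_ord_recr/= mulrDl.
rewrite (_ : Rintegral _ _ _ = \int[P]_w (S k w ^+ 2 + (2 * (S k w * Y k w) + Y k w ^+ 2))); last first.
  by apply: eq_Rintegral => w _; rewrite big_ord_recr/= -/(S k w) -/(Y k w); ring.
rewrite RintegralD//; last by apply: integrable_addr => //; exact: integrable_mulrl.
rewrite RintegralD//; last exact: integrable_mulrl.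
by rewrite RintegralZl// SY0 mulr0 add0r lerD.
Qed.

Let wt0 k w : 0 <= wt k.+1 w. Proof. by apply: weight_ge0. Qed.
Let wtle k w : wt k.+1 w <= c1 / density_floor k. Proof. by apply: weight_le. Qed.

(** The mean of u under the weighted empirical law; it takes the value 0 where the weights sum to
    0. *)
Definition empirical_mean (k : nat) (u : 'rV[R]_d -> R) (w : Omega) : R :=
  \sum_(a < k) nwt k a.+1 w * u (X a.+1 w).

Lemma weight_sum_ge0 k w : 0 <= wt_sum k w.
Proof. by rewrite /weight_sum big_add1 sumr_ge0. Qed.

Lemma nweight_ge0 n k w : 0 <= nwt n k.+1 w.
Proof. by rewrite divr_ge0 ?wt0 ?weight_sum_ge0. Qed.

Lemma empirical_mean_ge0 k u w : (forall x, 0 <= u x) -> 0 <= empirical_mean k u w.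
Proof. by move=> u0; rewrite sumr_ge0// => a _; rewrite mulr_ge0 ?nweight_ge0. Qed.

Lemma sum_nweight k w : 0 < wt_sum k w -> \sum_(a < k) nwt k a.+1 w = 1.
Proof.
move=> s0; rewrite -mulr_suml -[RHS](divff (lt0r_neq0 s0)).
by rewrite /weight_sum big_add1 big_mkord.
Qed.

Lemma empirical_mean_le k u B w : 0 < wt_sum k w -> (forall x, u x <= B) ->
  empirical_mean k u w <= B.
Proof.
move=> s0 uB; rewrite -[leRHS]mul1r -(sum_nweight s0) mulr_suml ler_sum// => a _.
by rewrite ler_wpM2l ?nweight_ge0.
Qed.

Lemma weighted_empiricalE k w B :
  weighted_empirical f q0 K h lam ell X Xs k w B = (empirical_mean k \1_B w)%:E.
Proof.
rewrite /weighted_empirical big_add1 big_mkord /empirical_mean -sumEFin.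
by apply: eq_bigr => a _; rewrite diracE EFinM indicE.
Qed.

Lemma empirical_mean_setT k w : 0 < wt_sum k w -> empirical_mean k \1_setT w = 1.
Proof.
move=> s0; rewrite -(sum_nweight s0); apply: eq_bigr => a _.
by rewrite indicT mulr1.
Qed.

Lemma measurable_empirical_mean_past k u : (0 < k)%N -> measurable_fun setT u ->
  measurable_fun setT (empirical_mean k u : past k k.-1 -> R).
Proof.
move=> k0 mu_; apply: measurable_sum => a; apply: measurable_funM.
  by apply: measurable_nweight_past => //=; exact: ltn_ord.
apply: (measurableT_comp mu_); apply: measurable_X_past; exact: ltn_ord.
Qed.

Lemma measurable_empirical_mean k u : (0 < k)%N -> measurable_fun setT u ->
  measurable_fun setT (empirical_mean k u).
Proof.
move=> k0 mu_; apply: (measurable_fun_g_sigma (@past_generators_measurable k k.-1)).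
exact: measurable_empirical_mean_past.
Qed.

(** * Conditional moments of the bootstrap draws *)

Section bootstrap.
Variable k : nat.
Hypothesis k_gt0 : (0 < k)%N.
Hypothesis boot : bootstrap_step f q0 K h lam ell X Xs k.
Variable A : set Omega.
Hypothesis past_A : <<s past_generators k k.-1 >> A.
Hypothesis A_gt0 : A `<=` [set w | 0 < wt_sum k w].

Let mXs i : measurable_fun setT (Xs k i : Omega -> _). Proof. exact: measurable_funPT. Qed.
Let mnwt a : measurable_fun setT (nwt k a.+1). Proof. exact: measurable_nweight. Qed.
Let past_event A' : <<s past_generators k k.-1 >> A' -> measurable A'.
Proof. exact: (g_sigma_algebra_measurable (@past_generators_measurable k k.-1)). Qed.
Let mind (B : set Omega) : measurable B -> measurable_fun setT (\1_B : Omega -> R).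
Proof. exact: measurable_indic. Qed.
Let ind_ge0 (T : Type) (B : set T) x : 0 <= \1_B x :> R.
Proof. by rewrite indicE. Qed.

Local Open Scope ereal_scope.

Lemma sum_integral_empirical_mean (phi : Omega -> R) (u : 'rV[R]_d -> R) : measurable_fun setT phi ->
  (forall w, 0 <= phi w)%R -> measurable_fun setT u -> (forall x, 0 <= u x)%R ->
  \sum_(a < k) \int[P]_w (phi w * nwt k a.+1 w * u (X a.+1 w))%:E =
  \int[P]_w (phi w * empirical_mean k u w)%:E.
Proof.
move=> mphi phi0 mu_ u0; rewrite -ge0_integral_sum//.
- apply: eq_integral => w _; rewrite sumEFin /empirical_mean mulr_sumr.
  by congr (_%:E); apply: eq_bigr => a _; rewrite mulrA.
- move=> a; apply/measurable_EFinP; apply: measurable_funM; first exact: measurable_funM.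
  exact: (measurableT_comp mu_ (@mX a.+1)).
- by move=> a w _; rewrite lee_fin mulr_ge0// mulr_ge0// nweight_ge0.
Qed.

(** Rectangles with one nontrivial side: the others contribute total masses, equal to 1 because the
    weights do not all vanish on A. Sub-events A' are allowed so that functions of the past can
    later be integrated as well. *)
Lemma integral_bootstrap (A' : set Omega) i (u : 'rV[R]_d -> R) : <<s past_generators k k.-1 >> A' ->
  A' `<=` A -> (i < ell k)%N -> measurable_fun setT u -> (forall x, 0 <= u x)%R ->
  \int[P]_w (\1_A' w * u (Xs k i w))%:E = \int[P]_w (\1_A' w * empirical_mean k u w)%:E.
Proof.
move=> pA' A'A il mu_ u0.
have mA' := past_event pA'.
have m1A' := mind mA'; have i0 w : (0 <= \1_A' w :> R)%R by exact: ind_ge0.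
rewrite -sum_integral_empirical_mean//.
apply: (@ge0_integral_discrete_law _ _ _ P _ _ k \1_A' (Xs k i)
  (fun a w => \1_A' w * nwt k a.+1 w)%R (fun a => X a.+1)) => //.
- by move=> a; exact: measurable_funM.
- by move=> a w; rewrite mulr_ge0 ?nweight_ge0.
move=> B mB; rewrite sum_integral_empirical_mean//.
pose Bs j := if j == i then B else setT.
have mBs j : measurable (Bs j) by rewrite /Bs; case: ifP.
have [_ /(_ A' pA' (subset_trans A'A A_gt0))] := boot mBs.
rewrite (_ : A' `&` _ = A' `&` Xs k i @^-1` B); last first.
  congr (A' `&` _); apply/seteqP; split => w /=.
    by move=> /(_ i il); rewrite /Bs eqxx.
  by move=> Bw j jl; rewrite /Bs; case: eqVneq => // ->.
have mXB : measurable (Xs k i @^-1` B).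
  by rewrite -[X in measurable X]setTI; exact: (@mXs i).
rewrite -(setIT (A' `&` _)) -integral_indic//; last exact: measurableI.
move=> H; transitivity (\int[P]_w (\1_(A' `&` Xs k i @^-1` B) w)%:E).
  by apply: eq_integral => w _; rewrite indicI.
rewrite H integral_mkcond; apply: eq_integral => w _; rewrite patchE indicE.
case: ifPn => wA'; last by rewrite mul0r.
have s0 : (0 < wt_sum k w)%R by apply: A_gt0; apply: A'A; rewrite inE in wA'.
rewrite mul1r (bigD1 (Ordinal il))//= big1.
  by rewrite mule1 /Bs eqxx weighted_empiricalE.
move=> j ji; rewrite /Bs ifF; last by apply: contraNF ji => /eqP ji; apply/eqP/val_inj.
by rewrite weighted_empiricalE empirical_mean_setT.
Qed.

Let law2 i j B1 B2 : (i < ell k)%N -> (j < ell k)%N -> i != j ->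
  measurable B1 -> measurable B2 ->
  \int[P]_w (\1_A w * \1_B1 (Xs k i w) * \1_B2 (Xs k j w))%:E =
  \int[P]_w (\1_A w * empirical_mean k \1_B1 w * empirical_mean k \1_B2 w)%:E.
Proof.
move=> il jl ij mB1 mB2.
pose Bs l := if l == i then B1 else if l == j then B2 else setT.
have mBs l : measurable (Bs l) by rewrite /Bs; do 2 case: ifP => // _.
have [_ /(_ A past_A A_gt0)] := boot mBs.
rewrite (_ : A `&` _ = A `&` Xs k i @^-1` B1 `&` Xs k j @^-1` B2); last first.
  rewrite -setIA; congr (A `&` _); apply/seteqP; split => w /=.
    move=> H; split; first by have := H i il; rewrite /Bs eqxx.
    by have := H j jl; rewrite /Bs eqxx [j == i]eq_sym (negbTE ij).
  by move=> [B1w B2w] l ll; rewrite /Bs; case: eqVneq => [->//|_]; case: eqVneq => [->//|].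
have mXB l B : measurable B -> measurable (Xs k l @^-1` B).
  by move=> mB; rewrite -[X in measurable X]setTI; exact: (@mXs l).
have mA := past_event past_A.
rewrite -(setIT (_ `&` Xs k j @^-1` B2)) -integral_indic//; last first.
  by apply: measurableI; [apply: measurableI => //; exact: mXB|exact: mXB].
move=> H; transitivity (\int[P]_w (\1_(A `&` Xs k i @^-1` B1 `&` Xs k j @^-1` B2) w)%:E).
  by apply: eq_integral => w _; rewrite !indicI.
rewrite H integral_mkcond; apply: eq_integral => w _; rewrite patchE indicE.
case: ifPn => wA; last by rewrite !mul0r.
have s0 : (0 < wt_sum k w)%R by apply: A_gt0; rewrite inE in wA.
rewrite mul1r (bigD1 (Ordinal il))//= (bigD1 (Ordinal jl))/=; last first.
  by apply: contraNneq ij => -[->].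
rewrite big1.
  by rewrite mule1 /Bs eqxx [j == i]eq_sym (negbTE ij) eqxx !weighted_empiricalE EFinM.
move=> l /andP[li lj]; rewrite /Bs ifF; last by apply: contraNF li => /eqP li; apply/eqP/val_inj.
rewrite ifF; last by apply: contraNF lj => /eqP lj; apply/eqP/val_inj.
by rewrite weighted_empiricalE empirical_mean_setT.
Qed.

(** From sets to functions one draw at a time: the indicator of the first draw acts as a weight
    while the second passes to u, then u of the second draw acts as a weight for the first. *)
Lemma integral_bootstrap_pair i j (u : 'rV[R]_d -> R) : (i < ell k)%N -> (j < ell k)%N -> i != j ->
  measurable_fun setT u -> (forall x, 0 <= u x)%R ->
  \int[P]_w (\1_A w * u (Xs k i w) * u (Xs k j w))%:E =
  \int[P]_w (\1_A w * empirical_mean k u w ^+ 2)%:E.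
Proof.
move=> il jl ij mu_ u0.
have mA := past_event past_A.
have m1A := mind mA.
have memp (v : 'rV[R]_d -> R) : measurable_fun setT v -> measurable_fun setT (empirical_mean k v).
  by move=> mv; exact: measurable_empirical_mean.
have mind1 (B : set 'rV[R]_d) : measurable B -> measurable_fun setT (\1_B : _ -> R) by exact: measurable_indic.
have step B1 : measurable B1 ->
    \int[P]_w (\1_A w * \1_B1 (Xs k i w) * u (Xs k j w))%:E =
    \int[P]_w (\1_A w * empirical_mean k \1_B1 w * empirical_mean k u w)%:E.
  move=> mB1; have emp0 w : (0 <= \1_A w * empirical_mean k \1_B1 w)%R.
    by rewrite mulr_ge0// empirical_mean_ge0.
  have memp1 : measurable_fun setT (fun w => \1_A w * empirical_mean k \1_B1 w)%R.
    by apply: measurable_funM => //; exact: (memp _ (mind1 _ mB1)).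
  rewrite -sum_integral_empirical_mean//.
  apply: (@ge0_integral_discrete_law _ _ _ P _ _ k (fun w => \1_A w * \1_B1 (Xs k i w))%R (Xs k j)
    (fun a w => \1_A w * empirical_mean k \1_B1 w * nwt k a.+1 w)%R (fun a => X a.+1)) => //.
  - by apply: measurable_funM => //; exact: (measurableT_comp (mind1 _ mB1) (@mXs i)).
  - by move=> a; apply: measurable_funM.
  - by move=> a w; rewrite mulr_ge0 ?nweight_ge0.
  move=> B2 mB2; rewrite sum_integral_empirical_mean ?law2//; exact: mind1.
have memp2 : measurable_fun setT (fun w => \1_A w * empirical_mean k u w)%R.
  by apply: measurable_funM => //; exact: memp.
have emp0 w : (0 <= \1_A w * empirical_mean k u w)%R.
  by rewrite mulr_ge0// empirical_mean_ge0.
transitivity (\int[P]_w (\1_A w * u (Xs k j w) * u (Xs k i w))%:E).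
  by apply: eq_integral => w _; rewrite mulrAC.
transitivity (\int[P]_w (\1_A w * empirical_mean k u w * empirical_mean k u w)%:E); last first.
  by apply: eq_integral => w _; rewrite expr2 mulrA.
rewrite -sum_integral_empirical_mean//.
apply: (@ge0_integral_discrete_law _ _ _ P _ _ k (fun w => \1_A w * u (Xs k j w))%R (Xs k i)
    (fun a w => \1_A w * empirical_mean k u w * nwt k a.+1 w)%R (fun a => X a.+1)) => //.
- by apply: measurable_funM => //; exact: (measurableT_comp mu_ (@mXs j)).
- by move=> w; rewrite mulr_ge0.
- by move=> a; apply: measurable_funM.
- by move=> a w; rewrite mulr_ge0 ?nweight_ge0.
move=> B1 mB1; have m1 := mind1 _ mB1.
rewrite sum_integral_empirical_mean//.
under eq_integral do rewrite mulrAC.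
rewrite step//.
by apply: eq_integral => w _; rewrite mulrAC.
Qed.

(* The empirical mean is measurable with respect to the past, so it is itself
   an integrand for the conditional law of the draws. *)
Lemma integral_bootstrap_cross i (u : 'rV[R]_d -> R) : (i < ell k)%N ->
  measurable_fun setT u -> (forall x, 0 <= u x)%R ->
  \int[P]_w (\1_A w * u (Xs k i w) * empirical_mean k u w)%:E =
  \int[P]_w (\1_A w * empirical_mean k u w ^+ 2)%:E.
Proof.
move=> il mu_ u0.
have mA := past_event past_A.
have memp : measurable_fun setT (empirical_mean k u) by exact: measurable_empirical_mean.
pose idp (w : Omega) : past k k.-1 := w.
have midp : measurable_fun setT idp.
  exact: (measurable_id_g_sigma (@past_generators_measurable k k.-1)).
have m1A := mind mA.
(* A single atom, and the identity into the past in both roles of random point; on an event C of the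
   past the hypothesis is [integral_bootstrap] for the intersection of A and C. *)
rewrite (@ge0_integral_discrete_law _ _ _ P _ (past k k.-1) 1
  (fun w => \1_A w * u (Xs k i w))%R idp
  (fun=> fun w => (\1_A w * empirical_mean k u w)%R) (fun=> idp) _ _ _ _ _ _ _
  (empirical_mean k u : past k k.-1 -> R)) //.
- by rewrite big_ord1; apply: eq_integral => w _; rewrite expr2 mulrA.
- by apply: measurable_funM => //; exact: (measurableT_comp mu_ (@mXs i)).
- by move=> w; rewrite mulr_ge0.
- by move=> _; apply: measurable_funM.
- by move=> _ w; rewrite mulr_ge0// empirical_mean_ge0.
- move=> C mC; rewrite big_ord1.
  transitivity (\int[P]_w (\1_(A `&` C) w * u (Xs k i w))%:E).
    by apply: eq_integral => w _; rewrite indicI /= mulrAC.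
  rewrite integral_bootstrap//.
  - by apply: eq_integral => w _; rewrite indicI /= mulrAC.
  - exact: (@measurableI _ (past k k.-1) A C past_A mC).
- exact: measurable_empirical_mean_past.
- by move=> w; rewrite empirical_mean_ge0.
Qed.

Definition bootstrap_mean (u : 'rV[R]_d -> R) (w : Omega) : R :=
  (ell k)%:R^-1 * \sum_(i < ell k) u (Xs k i w).

Local Close Scope ereal_scope.

(** Expanding the square with l draws: the l diagonal pairs each give V (empirical mean of u^2), the
    l (l - 1) others M (squared empirical mean of u), and the cross term gives M. The total is (V -
    M)/l, and M >= 0. *)
Lemma bootstrap_variance (u : 'rV[R]_d -> R) (B : R) : (0 < ell k)%N ->
  measurable_fun setT u -> (forall x, 0 <= u x <= B) ->
  \int[P]_w (\1_A w * (bootstrap_mean u w - empirical_mean k u w) ^+ 2) <=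
  (ell k)%:R^-1 * \int[P]_w (\1_A w * empirical_mean k (fun x => u x ^+ 2) w).
Proof.
move=> l0 mu_ u0B.
have u0 x : 0 <= u x by have /andP[] := u0B x.
have uB x : u x <= B by have /andP[] := u0B x.
have B0 : 0 <= B by rewrite (le_trans (u0 0)).
have mA := past_event past_A.
have m1A := mind mA.
have mu2 : measurable_fun setT (fun x => u x ^+ 2) by exact: measurable_funX.
have memp v : measurable_fun setT v -> measurable_fun setT (empirical_mean k v).
  exact: measurable_empirical_mean.
have muXs i : measurable_fun setT (fun w => u (Xs k i w)).
  exact: (measurableT_comp mu_ (@mXs i)).
have mbar : measurable_fun setT (bootstrap_mean u).
  by apply: measurable_funM => //; exact: measurable_sum.
have A1 w : \1_A w * \1_A w = \1_A w :> R by rewrite indicE; case: (w \in A); rewrite ?mulr0 ?mulr1.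
have empB v C w : (forall x, 0 <= v x <= C) -> `|\1_A w * empirical_mean k v w| <= C.
  move=> vC; have C0 : 0 <= C by have /andP[v0] := vC 0; exact: le_trans.
  rewrite indicE; case: (boolP (w \in A)) => wA; last by rewrite mul0r normr0.
  rewrite mul1r ger0_norm; last by rewrite empirical_mean_ge0// => x; have /andP[] := vC x.
  apply: empirical_mean_le => [|x]; last by have /andP[] := vC x.
  by apply: A_gt0; rewrite inE in wA.
have u2B x : 0 <= u x ^+ 2 <= B ^+ 2 by rewrite sqr_ge0/= ler_pXn2r ?nnegrE.
have barB w : `|bootstrap_mean u w| <= B.
  rewrite ger0_norm; last by rewrite mulr_ge0// sumr_ge0.
  rewrite ler_pdivrMl ?ltr0n// -[X in X%:R](card_ord (ell k)) mulr_natl -sumr_const.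
  exact: ler_sum.
have ib (Z : Omega -> R) D := @bounded_integrable _ _ _ P Z D.
pose M := \int[P]_w (\1_A w * empirical_mean k u w ^+ 2).
pose V := \int[P]_w (\1_A w * empirical_mean k (fun x => u x ^+ 2) w).
have iM : P.-integrable setT (EFin \o (fun w => \1_A w * empirical_mean k u w ^+ 2)).
  apply: (ib _ (B ^+ 2)); first by apply: measurable_funM => //; exact/measurable_funX/memp.
  move=> w; rewrite (_ : _ * _ = (\1_A w * empirical_mean k u w) ^+ 2); last first.
    by rewrite exprMn [X in _ = X * _]expr2 A1.
  by rewrite normrX ler_pXn2r ?nnegrE// empB.
have uuV i j : (i < ell k)%N -> (j < ell k)%N ->
    \int[P]_w (\1_A w * u (Xs k i w) * u (Xs k j w)) = if i == j then V else M.
  move=> il jl; rewrite /Rintegral; case: eqVneq => [<-|ij]; last first.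
    by rewrite integral_bootstrap_pair.
  rewrite /V /Rintegral -(integral_bootstrap past_A _ il mu2)//; last by move=> x; exact: sqr_ge0.
  by congr fine; apply: eq_integral => w _; rewrite expr2 mulrA.
have iuu i j : P.-integrable setT (EFin \o (fun w => \1_A w * u (Xs k i w) * u (Xs k j w))).
  apply: (ib _ (B * B)); first by do 2 apply: measurable_funM => //.
  move=> w; rewrite ger0_norm ?mulr_ge0// ler_pM// ?mulr_ge0//.
  by rewrite indicE; case: (w \in A); rewrite ?mul1r ?mul0r.
set l := (ell k)%:R : R.
have l1 : l != 0 by rewrite pnatr_eq0 -lt0n.
have bar2 : \int[P]_w (\1_A w * bootstrap_mean u w ^+ 2) =
    l^-1 ^+ 2 * (l * (V + (l - 1) * M)).
  transitivity (\int[P]_w (l^-1 ^+ 2 *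
      \sum_(i < ell k) \sum_(j < ell k) (\1_A w * u (Xs k i w) * u (Xs k j w)))).
    apply: eq_Rintegral => w _; rewrite /bootstrap_mean exprMn mulrCA; congr (_ * _).
    rewrite expr2 big_distrlr/= mulr_sumr; apply: eq_bigr => i _.
    by rewrite mulr_sumr; apply: eq_bigr => j _; rewrite mulrA.
  have isum i : P.-integrable setT (EFin \o (fun w => \sum_(j < ell k) (\1_A w * u (Xs k i w) * u (Xs k j w)))).
    rewrite (_ : EFin \o _ = fun x => (\sum_(j < ell k) (\1_A x * u (Xs k i x) * u (Xs k j x))%:E)%E); last first.
      by apply/funext => x; rewrite /= sumEFin.
    by apply: integrable_sum => // j _; exact: iuu.
  rewrite RintegralZl//; last first.
    rewrite (_ : EFin \o _ = fun x => (\sum_(i < ell k) (\sum_(j < ell k) (\1_A x * u (Xs k i x) * u (Xs k j x)))%:E)%E); last first.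
      by apply/funext => x; rewrite /= sumEFin.
    by apply: integrable_sum => // i _; exact: isum.
  congr (_ * _); rewrite Rintegral_sum//.
  transitivity (\sum_(i < ell k) (V + (l - 1) * M)); last by rewrite sumr_const card_ord mulr_natl.
  apply: eq_bigr => i _; rewrite Rintegral_sum// (bigD1 i)//= uuV// eqxx; congr (_ + _).
  transitivity (\sum_(j < ell k | j != i) M).
    by apply: eq_bigr => j ji; rewrite uuV// eq_sym (negbTE (_ : val j != val i)).
  rewrite sumr_const cardC1 card_ord -mulr_natl; congr (_ * _).
  by rewrite -subn1 natrB.
have icr i : P.-integrable setT (EFin \o (fun w => \1_A w * u (Xs k i w) * empirical_mean k u w)).
  rewrite (_ : (fun _ => _) = (fun w => u (Xs k i w) * (\1_A w * empirical_mean k u w))); last first.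
    by apply/funext => w; ring.
  apply: (ib _ (B * B)).
    by apply: measurable_funM => //; apply: measurable_funM => //; exact: memp.
  by move=> w; rewrite normrM ler_pM ?empB// ger0_norm.
have cross : \int[P]_w (\1_A w * bootstrap_mean u w * empirical_mean k u w) = M.
  transitivity (\int[P]_w (l^-1 * \sum_(i < ell k) (\1_A w * u (Xs k i w) * empirical_mean k u w))).
    apply: eq_Rintegral => w _; rewrite -mulr_suml -mulr_sumr /bootstrap_mean -/l; ring.
  rewrite RintegralZl//; last first.
    rewrite (_ : EFin \o _ = fun x => (\sum_(i < ell k) (\1_A x * u (Xs k i x) * empirical_mean k u x)%:E)%E); last first.
      by apply/funext => x; rewrite /= sumEFin.
    by apply: integrable_sum => // i _; exact: icr.
  rewrite Rintegral_sum// (eq_bigr (fun=> M)).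
    by rewrite sumr_const card_ord -mulr_natl mulrA mulVf ?mul1r.
  by move=> i _; rewrite /Rintegral integral_bootstrap_cross.
have ib2 : P.-integrable setT (EFin \o (fun w => \1_A w * bootstrap_mean u w ^+ 2)).
  apply: (ib _ (B ^+ 2)); first by apply: measurable_funM => //; exact: measurable_funX.
  move=> w; rewrite (_ : _ * _ = (\1_A w * bootstrap_mean u w) ^+ 2); last first.
    by rewrite [RHS]exprMn (expr2 (\1_A w)) A1.
  rewrite normrX ler_pXn2r ?nnegrE// normrM -[leRHS]mul1r ler_pM//.
  by rewrite indicE; case: (w \in A); rewrite ?normr1 ?normr0.
have ibm : P.-integrable setT (EFin \o (fun w => \1_A w * bootstrap_mean u w * empirical_mean k u w)).
  rewrite (_ : (fun _ => _) = (fun w => bootstrap_mean u w * (\1_A w * empirical_mean k u w))); last first.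
    by apply/funext => w; ring.
  exact: (integrable_bounded_mul mbar barB (ib _ _ (measurable_funM m1A (memp _ mu_)) (fun w => empB u B w u0B))).
have M0 : 0 <= M by apply: Rintegral_ge0 => w _; rewrite mulr_ge0 ?sqr_ge0.
rewrite (_ : Rintegral _ _ _ = \int[P]_w (\1_A w * bootstrap_mean u w ^+ 2 -
    (2 * (\1_A w * bootstrap_mean u w * empirical_mean k u w) - \1_A w * empirical_mean k u w ^+ 2))); last first.
  by apply: eq_Rintegral => w _; ring.
rewrite RintegralB//; last by apply: integrable_subr => //; exact: integrable_mulrl.
rewrite RintegralB//; last exact: integrable_mulrl.
rewrite RintegralZl// bar2 cross -/M -/V.
rewrite (_ : _ - _ = l^-1 * V - l^-1 * M); last by field.
by rewrite gerBl mulr_ge0// invr_ge0 ler0n.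
Qed.

End bootstrap.

Let mdensity_at k x : measurable_fun setT (fun w => density k w x).
Proof.
have m1 : measurable_fun setT (fun z : Omega * 'rV[R]_d => density k z.1 z.2).
  exact: measurable_density.
exact: (measurableT_comp m1 (@pair2_measurable _ _ Omega _ x)).
Qed.

Lemma density_floor_ge i k : (i < k)%N -> lam k <= density_floor i.
Proof.
move=> ik; have k0 : (1 <= k)%N by exact: leq_ltn_trans ik.
case: i ik => [_|i ik] /=; first by have /andP[] := lam_itv k0.
by apply: lam_nincr => //; exact: ltnW.
Qed.

Lemma sum_floor_le k : (1 <= k)%N -> \sum_(i < k) c1 / density_floor i <= k%:R * (c1 / lam k).
Proof.
move=> k0; have /andP[lk0 _] := lam_itv k0.
rewrite -[k in k%:R](card_ord k) mulr_natl -sumr_const ler_sum// => i _.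
by rewrite ler_pM2l// lef_pV2 ?posrE ?density_floor_ge// (lt_le_trans lk0)// density_floor_ge.
Qed.

(** The weights have mean 1, so half of the expected sum leaves room for Chebyshev, while being an
    event of the past on which normalisation costs at most a factor 2. *)
Definition good_weights (k : nat) : set Omega := [set w | k%:R / 2 <= wt_sum k w].

Lemma wt_sumE k w : wt_sum k w = \sum_(a < k) wt a.+1 w.
Proof. by rewrite /weight_sum big_add1 big_mkord. Qed.

Lemma good_weights_past k : <<s past_generators k k.-1 >> (good_weights k).
Proof.
have -> : good_weights k = setT `&` (wt_sum k : past k k.-1 -> R) @^-1` `[k%:R / 2, +oo[.
  by rewrite setTI; apply/seteqP; split => w /=; rewrite in_itv/= andbT.
exact: (measurable_weight_sum_past (leqnn k) (leqnn _) measurableT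
  (measurable_itv `[k%:R / 2, +oo[)).
Qed.

Lemma good_weights_measurable k : measurable (good_weights k).
Proof.
apply: (g_sigma_algebra_measurable (@past_generators_measurable k k.-1)).
exact: good_weights_past.
Qed.

Lemma good_weights_gt0 k : (1 <= k)%N -> good_weights k `<=` [set w | 0 < wt_sum k w].
Proof. by move=> k0 w /=; apply: lt_le_trans; rewrite divr_gt0// ltr0n. Qed.

Lemma integrable_weight_deviation k (u : 'rV[R]_d -> R) (B b : R) : measurable_fun setT u ->
  (forall x, `|u x| <= B) ->
  P.-integrable setT (EFin \o (fun w => (\sum_(i < k) (wt i.+1 w * u (X i.+1 w) - b)) ^+ 2)).
Proof.
move=> mu_ uB; have B0 : 0 <= B by rewrite (le_trans _ (uB 0)).
apply: (@bounded_integrable _ _ _ _ _ ((\sum_(i < k) (c1 / density_floor i * B + `|b|)) ^+ 2)).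
  apply: measurable_funX; apply: measurable_sum => i; apply: measurable_funB => //.
  by apply: measurable_funM => //; exact: (measurableT_comp mu_ (@mX i.+1)).
move=> w; have c0 i : 0 <= c1 / density_floor i.
  by rewrite divr_ge0 ?(ltW c1_gt0)//; have /andP[/ltW] := density_floor_itv i.
have s0 : 0 <= \sum_(i < k) (c1 / density_floor i * B + `|b|).
  by apply: sumr_ge0 => i _; rewrite addr_ge0// mulr_ge0.
rewrite normrX ler_pXn2r ?nnegrE// (le_trans (ler_norm_sum _ _ _))// ler_sum// => i _.
by rewrite (le_trans (ler_normB _ _))// lerD2r normrM ler_pM// ger0_norm.
Qed.

Lemma weight_sum_variance k : (1 <= k)%N ->
  P.-integrable setT (EFin \o (fun w => (\sum_(a < k) (wt a.+1 w - 1)) ^+ 2)) /\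
  \int[P]_w ((\sum_(a < k) (wt a.+1 w - 1)) ^+ 2) <= k%:R * (c1 / lam k).
Proof.
move=> k0; have n1 (x : 'rV[R]_d) : `|cst (1 : R) x| <= 1 by rewrite normr1.
have m1 := @measurable_cst _ _ 'rV[R]_d R setT (1 : R).
have E w : \sum_(i < k) (wt i.+1 w * cst (1 : R) (X i.+1 w) - 1) = \sum_(i < k) (wt i.+1 w - 1).
  by apply: eq_bigr => i _; rewrite mulr1.
split.
  by have := integrable_weight_deviation k 1 m1 n1; under eq_fun do rewrite E.
have := weighted_sum_deviation k m1 n1.
have f1 : \int[mu]_x f x = 1 by case: Hf => _ _ e; rewrite /Rintegral e.
rewrite (_ : Rintegral mu _ _ = 1); last by under eq_Rintegral do rewrite mulr1.
rewrite (_ : Rintegral mu _ _ = 1); last by under eq_Rintegral do rewrite expr1n mulr1.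
under eq_Rintegral do rewrite E.
by rewrite mulr1 => /le_trans; apply; exact: sum_floor_le.
Qed.

(** Off the event the centred sum is below - k/2; Chebyshev with the variance bound k c1/lam k
    produces the factor 4. *)
Lemma bad_weights_le k : (1 <= k)%N -> (P (~` good_weights k) <= (4 * c1 / (k%:R * lam k))%:E)%E.
Proof.
move=> k0; have /andP[lk0 _] := lam_itv k0.
have kR0 : 0 < k%:R :> R by rewrite ltr0n.
have [iS H] := weight_sum_variance k0.
have mG := measurableC (good_weights_measurable k).
have mS : measurable_fun setT (fun w => (\sum_(i < k) (wt i.+1 w - 1)) ^+ 2).
  exact/measurable_EFinP/(measurable_int _ iS).
have step : ((k%:R ^+ 2 / 4)%:E * P (~` good_weights k) <= (k%:R * (c1 / lam k))%:E)%E.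
  apply: (@le_trans _ _ (\int[P]_w ((\sum_(i < k) (wt i.+1 w - 1)) ^+ 2)%:E)%E); last first.
    rewrite -(fineK (integrable_fin_num measurableT iS))// lee_fin.
  rewrite -(setIT (~` _)) -integral_indic// -ge0_integralZl_EFin//; last exact/measurable_EFinP/measurable_indic.
  apply: ge0_le_integral => //.
  - by apply: emeasurable_funM => //; exact/measurable_EFinP/measurable_indic.
  - exact/measurable_EFinP.
  - move=> w _; rewrite -EFinM lee_fin indicE; case: (boolP (w \in _)) => wG; last by rewrite mulr0 sqr_ge0.
    move: wG; rewrite inE /good_weights/= => /negP; rewrite -ltNge wt_sumE => wG.
    rewrite mulr1 sumrB sumr_const card_ord; nra.
have P01 : P (~` good_weights k) \is a fin_num by rewrite fin_num_measure.
rewrite -(fineK P01) -EFinM lee_fin in step.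
rewrite -(fineK P01) lee_fin ler_pdivlMr ?mulr_gt0//.
have := step; rewrite mulrA ler_pdivlMr// => step2.
rewrite -(ler_pM2l kR0); nra.
Qed.

(** * Mean-square error of the bootstrap density *)

Section deviation.

Variables Bf CK Cb Cq : R.
Hypotheses (ell_gt0 : forall k, (1 <= k)%N -> (0 < ell k)%N).
Hypotheses (boot : forall k, (1 <= k)%N -> bootstrap_step f q0 K h lam ell X Xs k).
Hypotheses (fB : forall x, f x <= Bf) (KB : forall x, K x <= CK) (CK_gt0 : 0 < CK).
Hypothesis bias : forall s x, 0 < s ->
  `|\int[mu]_u (K u * f (x - s *: u)) - f x| <= Cb * s ^+ 2.
Hypothesis q0fB : forall x, `|q0 x - f x| <= Cq.

Let Bf0 : 0 <= Bf. Proof. exact: le_trans (f0 0) (fB 0). Qed.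

(** The error is bootstrap noise plus self-normalised sampling error plus kernel bias, and the
    square of the sum costs a factor 3. The 6 is 3 times the 2 due to a sum of weights of at least
    k/2; the 24 is 3 times 2, from splitting the sampling error, times 4, from the square of that
    same 2. *)
Lemma kde_deviation k x v : (1 <= k)%N -> v = CK * Bf / h k ^+ d ->
  P.-integrable setT (EFin \o (fun w => \1_(good_weights k) w * (kde k w x - f x) ^+ 2)) /\
  \int[P]_w (\1_(good_weights k) w * (kde k w x - f x) ^+ 2) <=
  6 * v / (ell k)%:R + 24 * c1 / (k%:R * lam k) * (v + Bf ^+ 2) + 3 * Cb ^+ 2 * h k ^+ 4.
Proof.
move=> k0 vE; have /andP[lk0 _] := lam_itv k0.
have kR0 : 0 < k%:R :> R by rewrite ltr0n.
have hk0 := h_gt0 k0.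
have v0 : 0 <= v by rewrite vE divr_ge0 ?mulr_ge0 ?exprn_ge0// ltW.
pose u (y : 'rV[R]_d) := rescale K (h k) (x - y).
have u0 y : 0 <= u y by exact: (rescale_ge0 HK _ hk0).
have uB y : u y <= CK / h k ^+ d by rewrite ler_wpM2r// invr_ge0 exprn_ge0 ?ltW.
have nuB y : `|u y| <= CK / h k ^+ d by rewrite ger0_norm.
have mu_ : measurable_fun setT u.
  apply: (measurableT_comp (measurable_rescale HK (h k))); exact: measurable_subr_rV.
pose b := \int[mu]_y (f y * u y).
have bE : b = \int[mu]_z (K z * f (x - h k *: z)).
  rewrite /b /Rintegral -(ge0_integral_convolution HK x hk0 mf f0).
  by congr fine; apply: eq_integral => y _; rewrite mulrC.
have bB : 0 <= b <= Bf.
  rewrite Rintegral_ge0/=; last by move=> y _; rewrite mulr_ge0.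
  have fyB y : 0 <= f y <= Bf by rewrite f0 fB.
  have := convolution_le HK x hk0 Bf0 mf fyB.
  rewrite (_ : integral _ _ _ = \int[mu]_y (f y * u y)%:E)%E; last first.
    by apply: eq_integral => y _; rewrite mulrC.
  rewrite /b /Rintegral => H.
  have : (\int[mu]_y (f y * u y)%:E \is a fin_num)%E.
    by rewrite ge0_fin_numE ?(le_lt_trans H) ?ltry// integral_ge0// => y _; rewrite lee_fin mulr_ge0.
  by move/fineK => E; rewrite -E lee_fin in H.
pose v2 := \int[mu]_y (f y * u y ^+ 2).
have idm := integrable_density_mul.
have mu2 : measurable_fun setT (fun y => u y ^+ 2) by exact: measurable_funX.
have B0 : 0 <= CK / h k ^+ d by rewrite (le_trans (u0 0)).
have u2B y : `|u y ^+ 2| <= (CK / h k ^+ d) ^+ 2 by rewrite normrX ler_pXn2r ?nnegrE.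
have v20 : 0 <= v2 by apply: Rintegral_ge0 => y _; rewrite mulr_ge0 ?sqr_ge0.
(* u is at most CK/h^d, and its mean under f is at most Bf. *)
have v2v : v2 <= v.
  apply: (@le_trans _ _ (CK / h k ^+ d * b)); last first.
    by rewrite vE [leRHS]mulrAC ler_wpM2l//; case/andP: bB.
  rewrite /b -RintegralZl//; last exact: (idm _ _ mu_ nuB).
  apply: le_Rintegral => //.
  - exact: (idm _ _ mu2 u2B).
  - exact: (integrable_mulrl _ (idm _ _ mu_ nuB)).
  - by move=> y _; rewrite expr2 mulrCA ler_wpM2r// mulr_ge0.
(* The self-normalised error times the sum of weights is D1 - b D0, a combination of two centred
   sums whose second moments are controlled. *)
pose D1 w := \sum_(a < k) (wt a.+1 w * u (X a.+1 w) - b).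
pose D0 w := \sum_(a < k) (wt a.+1 w - 1).
have ED1 : \int[P]_w (D1 w ^+ 2) <= k%:R * (c1 / lam k) * v.
  have H := weighted_sum_deviation k mu_ nuB.
  apply: le_trans H _; apply: ler_pM => //; last exact: sum_floor_le.
  apply: sumr_ge0 => i _; rewrite divr_ge0 ?(ltW c1_gt0)//.
  by have /andP[/ltW] := density_floor_itv i.
have [iD0 ED0] := weight_sum_variance k0.
have iD1 := integrable_weight_deviation k b mu_ nuB.
have mG := good_weights_measurable k.
have m1G : measurable_fun setT (\1_(good_weights k) : Omega -> R) by exact: measurable_indic.
have ind0 w : 0 <= \1_(good_weights k) w :> R by rewrite indicE.
have c0 i : 0 <= c1 / density_floor i.
  by rewrite divr_ge0 ?(ltW c1_gt0)//; have /andP[/ltW] := density_floor_itv i.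
have iWu2 i : P.-integrable setT (EFin \o (fun w => wt i.+1 w * u (X i.+1 w) ^+ 2)).
  apply: (@bounded_integrable _ _ _ _ _ (c1 / density_floor i * (CK / h k ^+ d) ^+ 2)).
    by apply: measurable_funM => //; exact: (measurableT_comp mu2 (@mX i.+1)).
  by move=> w; rewrite normrM ler_pM// ger0_norm.
have emE (g : 'rV[R]_d -> R) w : empirical_mean k g w = (\sum_(a < k) (wt a.+1 w * g (X a.+1 w))) / wt_sum k w.
  by rewrite mulr_suml; apply: eq_bigr => a _; rewrite /nweight mulrAC.
have mem (g : 'rV[R]_d -> R) : measurable_fun setT g -> measurable_fun setT (empirical_mean k g).
  by move=> mg; exact: measurable_empirical_mean.
have GS w : w \in good_weights k -> k%:R / 2 <= wt_sum k w by rewrite inE.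
have k20 : 0 < k%:R / 2 :> R by rewrite divr_gt0.
have iWs : P.-integrable setT (EFin \o (fun w => \sum_(a < k) (wt a.+1 w * u (X a.+1 w) ^+ 2))).
  rewrite (_ : EFin \o _ = fun w => (\sum_(a < k) (wt a.+1 w * u (X a.+1 w) ^+ 2)%:E)%E); last first.
    by apply/funext => w; rewrite /= sumEFin.
  by apply: integrable_sum => // i _; exact: iWu2.
have EV : (ell k)%:R^-1 * \int[P]_w (\1_(good_weights k) w * empirical_mean k (fun y => u y ^+ 2) w) <=
    2 * v / (ell k)%:R.
  rewrite mulrC ler_wpM2r// ?invr_ge0//.
  have pw w : \1_(good_weights k) w * empirical_mean k (fun y => u y ^+ 2) w <=
      2 / k%:R * \sum_(a < k) (wt a.+1 w * u (X a.+1 w) ^+ 2).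
    have s0 : 0 <= \sum_(a < k) (wt a.+1 w * u (X a.+1 w) ^+ 2).
      by apply: sumr_ge0 => a _; rewrite mulr_ge0// sqr_ge0.
    have k2 : 0 <= 2 / k%:R :> R by rewrite divr_ge0.
    rewrite indicE; case: (boolP (w \in _)) => wG; last by rewrite mul0r mulr_ge0.
    rewrite mul1r emE mulrC ler_wpM2r// (_ : 2 / k%:R = (k%:R / 2)^-1); last by rewrite invf_div.
    by rewrite lef_pV2 ?posrE ?GS// (lt_le_trans k20)// GS.
  apply: (@le_trans _ _ (\int[P]_w (2 / k%:R * \sum_(a < k) (wt a.+1 w * u (X a.+1 w) ^+ 2)))).
    apply: le_Rintegral => //; last exact: integrable_mulrl.
    apply: (integrable_le_norm _ _ (integrable_mulrl (2 / k%:R) iWs)).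
      by apply: measurable_funM => //; exact: mem.
    move=> w; rewrite ger0_norm ?pw// mulr_ge0//; apply: empirical_mean_ge0 => // y; exact: sqr_ge0.
  rewrite RintegralZl// Rintegral_sum// (eq_bigr (fun=> v2)).
    rewrite sumr_const card_ord -(mulr_natl v2) mulrA divfK ?lt0r_neq0//.
    by rewrite ler_pM2l.
  move=> i _; rewrite /Rintegral (ge0_integral_weight i mu2)//.
  by move=> y; exact: sqr_ge0.
have u0B y : 0 <= u y <= CK / h k ^+ d by rewrite u0 uB.
have Eboot := bootstrap_variance k0 (boot k0)
  (@good_weights_past k) (good_weights_gt0 k0) (ell_gt0 k0) mu_ u0B.
set bm := bootstrap_mean k u in Eboot.
have kdeE w : kde k w x = bm w by [].
have mbm : measurable_fun setT bm.
  apply: measurable_funM => //; apply: measurable_sum => i.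
  exact: (measurableT_comp mu_ (@measurable_funPT _ _ _ _ (Xs k i))).
have bmB w : 0 <= bm w <= CK / h k ^+ d.
  rewrite mulr_ge0 ?sumr_ge0//= ler_pdivrMl ?ltr0n ?ell_gt0//.
  by rewrite -[X in X%:R](card_ord (ell k)) mulr_natl -sumr_const ler_sum.
pose V w := \1_(good_weights k) w * (bm w - empirical_mean k u w) ^+ 2.
have iV : P.-integrable setT (EFin \o V).
  apply: (@bounded_integrable _ _ _ _ _ ((CK / h k ^+ d) ^+ 2)).
    by apply: measurable_funM => //; apply: measurable_funX; apply: measurable_funB => //; exact: mem.
  move=> w; rewrite /V indicE; case: (boolP (w \in _)) => wG; last by rewrite mul0r normr0 sqr_ge0.
  rewrite mul1r normrX ler_pXn2r ?nnegrE//.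
  have := empirical_mean_ge0 k w u0.
  have := empirical_mean_le (lt_le_trans k20 (GS _ wG)) uB.
  have /andP[] := bmB w; rewrite ler_norml; move: (empirical_mean k u w) (bm w) => e m *.
  by apply/andP; split; lra.
pose G w := 3 * V w + (24 / k%:R ^+ 2 * (D1 w ^+ 2 + Bf ^+ 2 * D0 w ^+ 2) + 3 * Cb ^+ 2 * h k ^+ 4).
have iD : P.-integrable setT (EFin \o (fun w => D1 w ^+ 2 + Bf ^+ 2 * D0 w ^+ 2)).
  by apply: integrable_addr => //; exact: integrable_mulrl.
have iC : P.-integrable setT (EFin \o (fun w : Omega => 3 * Cb ^+ 2 * h k ^+ 4)).
  exact: integrable_probability_cst.
have iD' : P.-integrable setT (EFin \o (fun w => 24 / k%:R ^+ 2 * (D1 w ^+ 2 + Bf ^+ 2 * D0 w ^+ 2) + 3 * Cb ^+ 2 * h k ^+ 4)).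
  by apply: integrable_addr => //; exact: integrable_mulrl.
have iG : P.-integrable setT (EFin \o G) by apply: integrable_addr => //; exact: integrable_mulrl.
have pw w : \1_(good_weights k) w * (kde k w x - f x) ^+ 2 <= G w.
  have D20 : 0 <= 24 / k%:R ^+ 2 * (D1 w ^+ 2 + Bf ^+ 2 * D0 w ^+ 2).
    by rewrite mulr_ge0 ?divr_ge0 ?sqr_ge0// addr_ge0 ?sqr_ge0// mulr_ge0 ?sqr_ge0.
  have h4 : 0 <= 3 * Cb ^+ 2 * h k ^+ 4 by rewrite mulr_ge0 ?exprn_ge0 ?(ltW hk0)// mulr_ge0 ?sqr_ge0.
  rewrite /G /V kdeE indicE; case: (boolP (w \in _)) => wG; last first.
    by rewrite !mul0r mulr0 add0r addr_ge0.
  rewrite !mul1r.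
  have S0 := lt_le_trans k20 (GS _ wG).
  have eb : (empirical_mean k u w - b) * wt_sum k w = D1 w - b * D0 w.
    rewrite emE mulrBl divfK ?lt0r_neq0// /D1 /D0 !sumrB !sumr_const !card_ord wt_sumE.
    by rewrite -(mulr_natr b k); ring.
  have E2 : (empirical_mean k u w - b) ^+ 2 <= 8 / k%:R ^+ 2 * (D1 w ^+ 2 + Bf ^+ 2 * D0 w ^+ 2).
    have K2 : 0 < (k%:R / 2) ^+ 2 :> R by rewrite exprn_gt0.
    rewrite -(ler_pM2r K2) [leRHS](_ : _ = 2 * (D1 w ^+ 2 + Bf ^+ 2 * D0 w ^+ 2)); last first.
      by field; rewrite lt0r_neq0.
    apply: (@le_trans _ _ ((D1 w - b * D0 w) ^+ 2)).
      rewrite -eb [leRHS]exprMn ler_wpM2l ?sqr_ge0// ler_pXn2r ?nnegrE ?(ltW k20) ?(ltW S0)//.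
      exact: GS.
    have bb : b ^+ 2 * D0 w ^+ 2 <= Bf ^+ 2 * D0 w ^+ 2.
      by case/andP: bB => b1 b2; rewrite ler_wpM2r ?sqr_ge0// ler_pXn2r ?nnegrE.
    have := sqr_ge0 (D1 w + b * D0 w); move: bb; rewrite !sqrrD sqrrN exprMn; lra.
  have F2 : (b - f x) ^+ 2 <= Cb ^+ 2 * h k ^+ 4.
    have := bias x hk0; rewrite -bE => B1.
    rewrite -(real_normK (num_real (b - f x))) (_ : _ * _ = (Cb * h k ^+ 2) ^+ 2); last by ring.
    by rewrite ler_pXn2r ?nnegrE// (le_trans _ B1).
  rewrite (_ : 24 / k%:R ^+ 2 * _ = 3 * (8 / k%:R ^+ 2 * (D1 w ^+ 2 + Bf ^+ 2 * D0 w ^+ 2))); last by ring.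
  rewrite -(mulrA 3) (_ : bm w - f x = (bm w - empirical_mean k u w) + (empirical_mean k u w - b) + (b - f x)); last by ring.
  move: E2 F2; move: (bm w - empirical_mean k u w) (empirical_mean k u w - b) (b - f x) => p q r.
  have := sqr_ge0 (p - q); have := sqr_ge0 (q - r); have := sqr_ge0 (p - r).
  rewrite !expr2; lra.
have mL : measurable_fun setT (fun w => \1_(good_weights k) w * (kde k w x - f x) ^+ 2).
  by apply: measurable_funM => //; apply: measurable_funX; exact: measurable_funB.
have iL : P.-integrable setT (EFin \o (fun w => \1_(good_weights k) w * (kde k w x - f x) ^+ 2)).
  apply: (integrable_le_norm mL _ iG) => w.
  by rewrite ger0_norm ?pw// mulr_ge0// sqr_ge0.
split => //.
apply: (@le_trans _ _ (\int[P]_w G w)); first by apply: le_Rintegral.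
rewrite RintegralD//; last exact: integrable_mulrl.
rewrite (RintegralZl _ measurableT iV) RintegralD//; last exact: integrable_mulrl.
rewrite (RintegralZl _ measurableT iD) RintegralD//; last exact: integrable_mulrl.
rewrite (RintegralZl _ measurableT iD0) [X in _ + (_ + X)](_ : _ = 3 * Cb ^+ 2 * h k ^+ 4); last first.
  by rewrite Rintegral_probability_cst.
rewrite addrA; apply: lerD => //; apply: lerD.
  rewrite (_ : 6 * v / _ = 3 * (2 * v / (ell k)%:R)); last by ring.
  by rewrite ler_pM2l// (le_trans Eboot).
have BD : Bf ^+ 2 * \int[P]_w (D0 w ^+ 2) <= Bf ^+ 2 * (k%:R * (c1 / lam k)).
  by rewrite ler_wpM2l ?sqr_ge0.
rewrite [leRHS](_ : _ = 24 / k%:R ^+ 2 * (k%:R * (c1 / lam k) * v + Bf ^+ 2 * (k%:R * (c1 / lam k)))); last first.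
  by field; rewrite !lt0r_neq0.
by rewrite ler_wpM2l ?lerD// divr_ge0 ?sqr_ge0.
Qed.

(** Twice the bound of [kde_deviation], plus the contribution of the share lam of q0 in the
    mixture. *)
Definition deviation_bound (k : nat) : R :=
  let v := CK * Bf / h k ^+ d in
  2 * (6 * v / (ell k)%:R + 24 * c1 / (k%:R * lam k) * (v + Bf ^+ 2) + 3 * Cb ^+ 2 * h k ^+ 4) +
  2 * (lam k * Cq) ^+ 2.

Lemma density_deviation k x : (1 <= k)%N ->
  (\int[P]_(w in good_weights k) ((density k w x - f x) ^+ 2)%:E <= (deviation_bound k)%:E)%E.
Proof.
case: k => [//|k'] k0; set k := k'.+1 in k0 *.
have [iL L] := kde_deviation x k0 erefl.
have /andP[lk0 lk1] := lam_itv k0.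
have mG := good_weights_measurable k.
have mL : measurable_fun setT (fun w => \1_(good_weights k) w * (kde k w x - f x) ^+ 2).
  exact/measurable_EFinP/(measurable_int _ iL).
have mden := @mdensity_at k x.
have C2 : 0 <= 2 * (lam k * Cq) ^+ 2 by rewrite mulr_ge0// sqr_ge0.
rewrite integral_mkcond.
apply: (@le_trans _ _ (\int[P]_w (2%:E * (\1_(good_weights k) w * (kde k w x - f x) ^+ 2)%:E + (2 * (lam k * Cq) ^+ 2)%:E))%E).
  apply: ge0_le_integral => //.
  - by move=> w _; apply: erestrict_ge0 => ? _; rewrite lee_fin sqr_ge0.
  - apply/(measurable_restrictT _ mG)/measurable_funTS/measurable_EFinP.
    by apply: measurable_funX; exact: measurable_funB.
  - apply: emeasurable_funD => //; apply: emeasurable_funM => //; exact/measurable_EFinP.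
  - move=> w _; rewrite patchE indicE; case: ifPn => wG; last first.
      by rewrite mul0r mule0 add0e lee_fin.
    rewrite mul1r -EFinM -EFinD lee_fin /=.
    rewrite (_ : _ - f x = (1 - lam k) * (kde k w x - f x) + lam k * (q0 x - f x)); last by rewrite /k; ring.
    have Q1 : (lam k * (q0 x - f x)) ^+ 2 <= (lam k * Cq) ^+ 2.
      rewrite -(real_normK (num_real (lam k * (q0 x - f x)))) normrM (gtr0_norm lk0).
      have Cq0 : 0 <= Cq by rewrite (le_trans _ (q0fB x)).
      by rewrite ler_pXn2r ?nnegrE ?mulr_ge0 ?(ltW lk0)// ler_wpM2l ?(ltW lk0).
    have Q2 : ((1 - lam k) * (kde k w x - f x)) ^+ 2 <= (kde k w x - f x) ^+ 2.
      rewrite exprMn -[leRHS]mul1r ler_wpM2r ?sqr_ge0// expr_le1// ?subr_ge0//.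
      by rewrite gerBl ltW.
    move: Q1 Q2; move: ((1 - lam k) * _) (lam k * (q0 x - f x)) => p q Q1 Q2.
    have := sqr_ge0 (p - q); move: Q1 Q2; rewrite !expr2; lra.
rewrite ge0_integralD//; last 2 first.
- by move=> w _; rewrite -EFinM lee_fin mulr_ge0// mulr_ge0 ?sqr_ge0// indicE.
- by apply: emeasurable_funM => //; exact/measurable_EFinP.
rewrite ge0_integralZl_EFin//; last 2 first.
- by move=> w _; rewrite lee_fin mulr_ge0 ?sqr_ge0// indicE.
- exact/measurable_EFinP.
rewrite integral_cst//= (@probability_setT _ _ _ P) mule1.
have fin := integrable_fin_num measurableT iL.
rewrite -(fineK fin) -EFinM -EFinD lee_fin /deviation_bound lerD2r ler_pM2l//.
Qed.

Lemma weight_error k x (c eta D : R) : (1 <= k)%N -> 0 < eta < 1 ->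
  (forall y, f y `^ eta <= c * q0 y) -> 0 < D -> deviation_bound k <= D ->
  (\int[P]_w (`|f x ^+ 2 / density k w x - f x|)%:E <=
    ((c1 * (c1 / lam k + 1) * (4 * c1 / (k%:R * lam k)) +
      c ^+ 2 * (4 * D) `^ (1 - eta) / lam k) * q0 x +
     Num.min (3 * c1 * q0 x) (2 * Num.sqrt D))%:E)%E.
Proof.
move=> k0 eta01 fc D0 bD; have /andP[lk0 lk1] := lam_itv k0.
have mG := good_weights_measurable k.
have mden := @mdensity_at k x.
have lden w : lam k * q0 x <= density k w x.
  have : density_floor k * q0 x <= density k w x by apply: density_ge.
  by rewrite /density_floor; case: (k) k0.
have DA : (\int[P]_(w in good_weights k) ((density k w x - f x) ^+ 2)%:E <= D%:E)%E.
  by rewrite (le_trans (density_deviation x k0))// lee_fin.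
have := weight_deviation mden mG (f0 x) (q00 x) (ltW c1_gt0) (fq0 x) lk0 eta01 (fc x) lden D0 DA.
move=> /le_trans; apply; rewrite lee_fin lerD2r ler_wpM2r// lerD2r ler_wpM2l//.
  by rewrite mulr_ge0 ?(ltW c1_gt0)// addr_ge0// divr_ge0// ltW.
rewrite -lee_fin fineK ?bad_weights_le//.
by rewrite fin_num_measure//; exact: measurableC.
Qed.

End deviation.

(** * Central limit theorem for the weighted sums *)

Section integrand.
Variable g : 'rV[R]_d -> R.
Hypotheses (mg : measurable_fun setT g) (gq0 : (\int[mu]_x (g x ^+ 2 * q0 x)%:E < +oo)%E).

Let mg2 : measurable_fun setT (fun x => g x ^+ 2). Proof. exact: measurable_funX. Qed.
Let g20 x : 0 <= g x ^+ 2. Proof. exact: sqr_ge0. Qed.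
Let mgX k : measurable_fun setT (fun w => g (X k w) ^+ 2).
Proof. exact: (measurableT_comp mg2 (@mX k)). Qed.
Let mden k : measurable_fun setT (fun z : Omega * 'rV[R]_d => density k z.1 z.2).
Proof. exact: measurable_density. Qed.
Local Open Scope ereal_scope.

Lemma gf_lty : \int[mu]_x (f x * g x ^+ 2)%:E < +oo.
Proof.
apply: (@le_lt_trans _ _ (\int[mu]_x (c1%:E * (g x ^+ 2 * q0 x)%:E))).
  apply: ge0_le_integral => //.
  - by move=> x _; rewrite lee_fin mulr_ge0.
  - by apply/measurable_EFinP; exact: measurable_funM.
  - by apply: emeasurable_funM => //; apply/measurable_EFinP; exact: measurable_funM.
  - by move=> x _; rewrite -EFinM lee_fin mulrC mulrCA ler_wpM2l.
rewrite ge0_integralZl_EFin ?(ltW c1_gt0)//; last 2 first.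
- by move=> x _; rewrite lee_fin mulr_ge0.
- by apply/measurable_EFinP; exact: measurable_funM.
rewrite lte_mul_pinfty ?lee_fin ?(ltW c1_gt0)//.
Qed.

(** W g(X)^2 has conditional mean \int f g^2, so this L^1 quantity bounds the defect between the
    conditional second moment of W g(X) and that constant. *)
Definition square_error k : \bar R :=
  \int[P]_w (`|wt k.+1 w ^+ 2 - wt k.+1 w| * g (X k.+1 w) ^+ 2)%:E.

Lemma square_error_lty k : square_error k < +oo.
Proof.
have C0 : (0 <= c1 / density_floor k + 1)%R.
  by rewrite addr_ge0// divr_ge0 ?(ltW c1_gt0)//; have /andP[/ltW] := density_floor_itv k.
apply: (@le_lt_trans _ _ (\int[P]_w ((c1 / density_floor k + 1)%:E * (wt k.+1 w * g (X k.+1 w) ^+ 2)%:E))).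
  apply: ge0_le_integral => //.
  - by move=> w _; rewrite lee_fin mulr_ge0.
  - apply/measurable_EFinP/measurable_funM => //; apply: measurableT_comp => //.
    by apply: measurable_funB => //; exact: measurable_funX.
  - by apply: emeasurable_funM => //; apply/measurable_EFinP; exact: measurable_funM.
  - move=> w _; rewrite -EFinM lee_fin [leRHS]mulrA ler_wpM2r//.
    rewrite (le_trans (ler_normB _ _))// (ger0_norm (wt0 k w)) ger0_norm ?sqr_ge0//.
    by rewrite mulrDl mul1r lerD2r expr2 ler_wpM2r.
rewrite ge0_integralZl_EFin//; last 2 first.
- by move=> w _; rewrite lee_fin mulr_ge0.
- by apply/measurable_EFinP; exact: measurable_funM.
rewrite (ge0_integral_weight k mg2)//.
by rewrite lte_mul_pinfty ?lee_fin// gf_lty.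
Qed.

(** Integrating out X multiplies W^2 - W by the density, which yields f^2/q - f; Tonelli then moves
    the expectation inside, where the estimate at fixed x applies. *)
Lemma square_errorE k : square_error k =
  \int[mu]_x ((g x ^+ 2)%:E * \int[P]_w (`|f x ^+ 2 / density k w x - f x|)%:E).
Proof.
pose F (z : Omega * 'rV[R]_d) := (`|f z.2 ^+ 2 / density k z.1 z.2 - f z.2| * g z.2 ^+ 2)%R.
have mF : measurable_fun setT F.
  apply: measurable_funM; last exact: (measurableT_comp mg2 measurable_snd).
  apply: measurableT_comp => //; apply: measurable_funB; last exact: (measurableT_comp mf measurable_snd).
  apply: measurable_funM; first by apply: measurable_funX; exact: (measurableT_comp mf measurable_snd).
  exact: (measurableT_comp (@measurable_fun_inv R) (@mden k)).
have F0 z : 0 <= (F z)%:E by rewrite lee_fin mulr_ge0.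
transitivity (\int[P]_w \int[mu]_x (F (w, x))%:E).
  pose psi (z : past k k * 'rV[R]_d) := (`|(f z.2 / density k z.1 z.2) ^+ 2 - f z.2 / density k z.1 z.2| * g z.2 ^+ 2)%R.
  have mr : measurable_fun setT (fun z : past k k * 'rV[R]_d => f z.2 / density k z.1 z.2)%R.
    by apply: measurable_ratio_past.
  have mpsi : measurable_fun setT psi.
    apply: measurable_funM; last exact: (measurableT_comp mg2 measurable_snd).
    by apply: measurableT_comp => //; apply: measurable_funB => //; exact: measurable_funX.
  have psi0 z : (0 <= psi z)%R by rewrite mulr_ge0.
  transitivity (\int[P]_w (EFin \o psi) (w, X k.+1 w)); first by [].
  rewrite ge0_integral_next; last 2 first.
  - exact/measurable_EFinP.
  - by move=> z; rewrite /= lee_fin.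
  - apply: eq_integral => w _; apply: eq_integral => x _; rewrite /= -EFinM /psi /F /=.
    congr (_%:E); rewrite mulrAC; congr (_ * _)%R.
    have dn0 : (0 <= density k w x)%R by apply: density_ge0.
    have rE : (f x / density k w x * density k w x = f x)%R.
      by apply: ratio_mulK.
    rewrite (_ : (f x ^+ 2 / _ - f x = ((f x / density k w x) ^+ 2 - f x / density k w x) * density k w x)%R).
      by rewrite normrM (ger0_norm dn0).
    rewrite mulrBl rE (_ : ((f x / density k w x) ^+ 2 * density k w x =
      f x / density k w x * (f x / density k w x * density k w x))%R); last by ring.
    by rewrite rE; ring.
rewrite (@fubini_tonelli _ _ _ _ _ P mu (EFin \o F))//; last exact/measurable_EFinP.
apply: eq_integral => x _ /=.
rewrite -ge0_integralZl_EFin//; last first.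
  have m1 := measurableT_comp (@mden k) (@pair2_measurable _ _ Omega _ x).
  apply/measurable_EFinP/measurableT_comp => //; apply: measurable_funB => //.
  by apply: measurable_funM => //; exact: (measurableT_comp (@measurable_fun_inv R) m1).
by apply: eq_integral => w _; rewrite -EFinM mulrC.
Qed.

Section error_limit.
Local Close Scope ereal_scope.
Variables (B D : nat -> R).
Hypothesis error_le : \forall k \near \oo, forall x,
  (\int[P]_w (`|f x ^+ 2 / density k w x - f x|)%:E <=
    (B k * q0 x + Num.min (3 * c1 * q0 x) (2 * Num.sqrt (D k)))%:E)%E.
Hypotheses (B0 : \forall k \near \oo, 0 <= B k) (B_cvg0 : B k @[k --> \oo] --> (0 : R))
  (D_cvg0 : D k @[k --> \oo] --> (0 : R)).

Local Open Scope ereal_scope.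

Let Q := fine (\int[mu]_x (g x ^+ 2 * q0 x)%:E).
Let mgq : measurable_fun setT (fun x => g x ^+ 2 * q0 x)%R. Proof. exact: measurable_funM. Qed.
Let gqE : \int[mu]_x (g x ^+ 2 * q0 x)%:E = Q%:E.
Proof. by rewrite fineK// ge0_fin_numE// integral_ge0// => x _; rewrite lee_fin mulr_ge0. Qed.

(** The part of the error whose smallness comes without a factor q0; it stays below 3 c1 g^2 q0,
    which allows dominated convergence. *)
Let m k x := (g x ^+ 2 * Num.min (3 * c1 * q0 x) (2 * Num.sqrt (D k)))%R.
Let mm k : measurable_fun setT (m k).
Proof. by apply: measurable_funM => //; apply: measurable_minr => //; exact: measurable_funM. Qed.
Let m0 k x : (0 <= m k x)%R.
Proof. by rewrite mulr_ge0// le_min !mulr_ge0 ?(ltW c1_gt0) ?sqrtr_ge0. Qed.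
Let mle k x : (m k x <= 3 * c1 * (g x ^+ 2 * q0 x))%R.
Proof. by rewrite mulrCA ler_wpM2l// ge_min lexx. Qed.

Let igq : mu.-integrable setT (EFin \o (fun x => 3 * c1 * (g x ^+ 2 * q0 x))%R).
Proof.
apply: integrable_mulrl; apply/integrableP; split; first exact/measurable_EFinP.
rewrite (_ : integral _ _ _ = \int[mu]_x (g x ^+ 2 * q0 x)%:E)//.
by apply: eq_integral => x _; rewrite /= ger0_norm// mulr_ge0.
Qed.

Let m_cvg0 : (\int[mu]_x (m k x)%:E) @[k --> \oo] --> 0.
Proof.
have [|||||_ _] := @dominated_convergence _ _ R mu setT measurableT (fun k x => (m k x)%:E)
  (cst 0) (fun x => (3 * c1 * (g x ^+ 2 * q0 x))%:E).
- by move=> k; apply/measurable_EFinP.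
- exact: measurable_cst.
- apply: aeW => x _; apply/fine_cvgP; split; first exact: nearW.
  apply: (@cvg0_le _ _ (fun k => g x ^+ 2 * (2 * Num.sqrt (D k))))%R.
    by apply: nearW => k; rewrite m0/= ler_wpM2l// ge_min lexx orbT.
  rewrite -[X in _ --> X](mulr0 (g x ^+ 2)%R); apply: cvgM; first exact: cvg_cst.
  rewrite -[X in _ --> X](mulr0 2%R); apply: cvgM; first exact: cvg_cst.
  have := @sqrt_continuous R 0%R; rewrite /continuous_at sqrtr0 => sc.
  exact: (cvg_comp _ _ D_cvg0 sc).
- exact: igq.
- by apply: aeW => x k _; rewrite /= ger0_norm ?m0// lee_fin.
by rewrite (_ : \int[mu]_x cst 0 x = 0)//; exact: integral0.
Qed.

Lemma square_error_cvg0 : fine (square_error k) @[k --> \oo] --> (0 : R)%R.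
Proof.
have m_fin k : \int[mu]_x (m k x)%:E \is a fin_num.
  rewrite ge0_fin_numE; last by apply: integral_ge0 => x _; rewrite lee_fin.
  apply: (@le_lt_trans _ _ (\int[mu]_x (3 * c1 * (g x ^+ 2 * q0 x))%:E)).
    apply: ge0_le_integral => //.
    - by move=> x _; rewrite lee_fin.
    - exact/measurable_EFinP.
    - by move/measurable_int : igq.
    - by move=> x _; rewrite lee_fin.
  move/integrableP : igq => [_]; rewrite (_ : integral _ _ _ = \int[mu]_x (3 * c1 * (g x ^+ 2 * q0 x))%:E)//.
  by apply: eq_integral => x _; rewrite /= ger0_norm// (le_trans (m0 0 x)).
have mq : fine (\int[mu]_x (m k x)%:E) @[k --> \oo] --> (0 : R)%R.
  by have /fine_cvgP[_] := m_cvg0.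
apply: (@cvg0_le _ _ (fun k => B k * Q + fine (\int[mu]_x (m k x)%:E))%R); last first.
  rewrite -[X in _ --> X](addr0 (0 : R)%R); apply: cvgD => //.
  by rewrite -[X in _ --> X](mul0r Q); apply: cvgM => //; exact: cvg_cst.
near=> k.
have Bk : (0 <= B k)%R by near: k.
have ek : forall x, (\int[P]_w (`|f x ^+ 2 / density k w x - f x|)%:E <=
    (B k * q0 x + Num.min (3 * c1 * q0 x) (2 * Num.sqrt (D k)))%:E) by near: k.
have se0 : 0 <= square_error k by apply: integral_ge0 => w _; rewrite lee_fin mulr_ge0.
rewrite fine_ge0//= -lee_fin fineK; last by rewrite ge0_fin_numE ?square_error_lty.
rewrite square_errorE EFinD EFinM (fineK (m_fin k)) -gqE -ge0_integralZl_EFin//; last 2 first.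
- by move=> x _; rewrite lee_fin mulr_ge0.
- exact/measurable_EFinP.
have nn x : 0 <= \int[P]_w (`|f x ^+ 2 / density k w x - f x|)%:E by exact: integral_ge0.
rewrite -ge0_integralD//; last 4 first.
- by move=> x _; rewrite mule_ge0// lee_fin mulr_ge0.
- by apply: emeasurable_funM => //; exact/measurable_EFinP.
- by move=> x _; rewrite lee_fin.
- exact/measurable_EFinP.
apply: ge0_le_integral => //.
- by move=> x _; rewrite mule_ge0// lee_fin.
- apply: emeasurable_funM; first exact/measurable_EFinP.
  apply: (@measurable_fun_fubini_tonelli_G _ _ _ _ _ P (fun z : Omega * 'rV[R]_d => (`|f z.2 ^+ 2 / density k z.1 z.2 - f z.2|)%:E)) => //.
  apply/measurable_EFinP/measurableT_comp => //.
  apply: measurable_funB; last exact: (measurableT_comp mf measurable_snd).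
  apply: measurable_funM; first by apply: measurable_funX; exact: (measurableT_comp mf measurable_snd).
  exact: (measurableT_comp (@measurable_fun_inv R) (@mden k)).
- apply: emeasurable_funD; last exact/measurable_EFinP.
  by apply: emeasurable_funM => //; exact/measurable_EFinP.
- move=> x _; apply: (@le_trans _ _ ((g x ^+ 2)%:E * (B k * q0 x + Num.min (3 * c1 * q0 x) (2 * Num.sqrt (D k)))%:E)).
    by rewrite lee_wpmul2l// lee_fin.
  by rewrite -!EFinM -EFinD lee_fin /m mulrDr mulrCA.
Unshelve. all: by end_near. Qed.

End error_limit.

Local Close Scope ereal_scope.

Hypothesis g_centered : \int[mu]_x (f x * g x) = 0.
Let e k := fine (square_error k).
Hypothesis e_cvg0 : e k @[k --> \oo] --> (0 : R).
Hypothesis nlam2_cvg0 : (n%:R * lam n ^+ 2)^-1 @[n --> \oo] --> (0 : R).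
Let v := \int[mu]_x (f x * g x ^+ 2).

Definition weighted_term (k : nat) (w : Omega) : R := wt k.+1 w * g (X k.+1 w).
Local Notation xi := weighted_term.
Definition weighted_total (n : nat) (w : Omega) : R := \sum_(i < n) weighted_term i w.
Local Notation S := weighted_total.

Lemma measurable_weighted_term k : measurable_fun setT (xi k).
Proof. by apply: measurable_funM => //; exact: (measurableT_comp mg (@mX k.+1)). Qed.

Lemma measurable_weighted_total n : measurable_fun setT (S n).
Proof. by apply: measurable_sum => i; exact: measurable_weighted_term. Qed.

Let mSpast n : measurable_fun setT (S n : past n n -> R).
Proof.
apply: measurable_sum => j; apply: measurable_funM.
  by apply: measurable_weight_past => //=; exact: ltnW.
apply: (measurableT_comp mg); apply: measurable_X_past; exact: ltn_ord.
Qed.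

Let fg2_lty : (\int[mu]_x (f x * g x ^+ 2)%:E < +oo)%E.
Proof. by apply: gf_lty. Qed.

Let fg2n_lty : (\int[mu]_x (f x * `|g x ^+ 2|)%:E < +oo)%E.
Proof. by under eq_integral do rewrite (ger0_norm (sqr_ge0 _)). Qed.

Let v0 : 0 <= v. Proof. by rewrite Rintegral_ge0// => x _; rewrite mulr_ge0 ?sqr_ge0. Qed.

Let fg_lty : (\int[mu]_x (f x * `|g x|)%:E < +oo)%E.
Proof.
apply: (@le_lt_trans _ _ (\int[mu]_x ((f x)%:E + (f x * g x ^+ 2)%:E))%E).
  apply: ge0_le_integral => //.
  - by move=> x _; rewrite lee_fin mulr_ge0.
  - by apply/measurable_EFinP/measurable_funM => //; exact: measurableT_comp.
  - by apply: emeasurable_funD; apply/measurable_EFinP => //; exact: measurable_funM.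
  - move=> x _; rewrite -EFinD lee_fin -{2}(mulr1 (f x)) -mulrDr ler_wpM2l//.
    rewrite -(real_normK (num_real (g x))).
    have := sqr_ge0 (`|g x| - 1); have := normr_ge0 (g x); nra.
rewrite ge0_integralD//; last 4 first.
- by move=> x _; rewrite lee_fin.
- exact/measurable_EFinP.
- by move=> x _; rewrite lee_fin mulr_ge0 ?sqr_ge0.
- by apply/measurable_EFinP; exact: measurable_funM.
by case: Hf => _ _ ->; rewrite lte_add_pinfty ?ltry.
Qed.

Let iW2 k : P.-integrable setT (EFin \o (fun w => wt k.+1 w * g (X k.+1 w) ^+ 2)).
Proof. exact: (integrable_weight k mg2 fg2n_lty). Qed.

(** xi^2 is [gap] plus W g(X)^2. The second part has conditional mean exactly v, so the whole
    variance error sits in the first. *)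
Let gap k w := (wt k.+1 w ^+ 2 - wt k.+1 w) * g (X k.+1 w) ^+ 2.

Let mgap k : measurable_fun setT (gap k).
Proof.
apply: measurable_funM; last exact: (measurableT_comp mg2 (@mX k.+1)).
by apply: measurable_funB => //; exact: measurable_funX.
Qed.

Let gapn k w : `|gap k w| = `|wt k.+1 w ^+ 2 - wt k.+1 w| * g (X k.+1 w) ^+ 2.
Proof. by rewrite normrM (ger0_norm (sqr_ge0 (g (X k.+1 w)))). Qed.

Let igap k : P.-integrable setT (EFin \o gap k).
Proof.
apply/integrableP; split; first exact/measurable_EFinP.
rewrite (_ : integral _ _ _ = square_error k).
  by apply: square_error_lty.
by apply: eq_integral => w _; rewrite /= gapn.
Qed.

Let eE k : \int[P]_w `|gap k w| = e k.
Proof. by rewrite /e /square_error /Rintegral; under eq_integral do rewrite gapn. Qed.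

Let xi2E k w : xi k w ^+ 2 = gap k w + wt k.+1 w * g (X k.+1 w) ^+ 2.
Proof. by rewrite /weighted_term /gap; ring. Qed.

Let ixi2 k : P.-integrable setT (EFin \o (fun w => xi k w ^+ 2)).
Proof. under eq_fun do rewrite xi2E; exact: (integrable_addr (igap k) (iW2 k)). Qed.

Let EW2 k : \int[P]_w (wt k.+1 w * g (X k.+1 w) ^+ 2) = v.
Proof.
rewrite /Rintegral (ge0_integral_weight k mg2)//.
Qed.

Lemma weighted_term_second_moment k : \int[P]_w (xi k w ^+ 2) <= v + e k.
Proof.
under eq_Rintegral do rewrite xi2E.
rewrite RintegralD// EW2 addrC lerD2l -eE.
apply: le_Rintegral => //; last by move=> w _; exact: ler_norm.
exact: integrable_norm (igap k).
Qed.

Let mcosS k t al : measurable_fun setT (fun w : past k k => cos (t * S k w + al)).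
Proof. exact: (measurable_cos_affine t al (@mSpast k)). Qed.

Let icosS k t al : P.-integrable setT (EFin \o (fun w => cos (t * S k w + al))).
Proof. exact: (integrable_cos_affine P t al (measurable_weighted_total k)). Qed.

Let xi_centered k t al : \int[P]_w (cos (t * S k w + al) * xi k w) = 0.
Proof.
have [_ ->] := integral_weight (@mcosS k t al) (@icosS k t al) mg fg_lty.
by rewrite g_centered mulr0.
Qed.

Let xi_var k t al : `|\int[P]_w (cos (t * S k w + al) * (xi k w ^+ 2 - v))| <= e k.
Proof.
set Z := fun w => cos (t * S k w + al).
have ZB w : `|Z w| <= 1 by exact: cos_max.
have mZ : measurable_fun setT Z by exact/measurable_EFinP/(measurable_int _ (icosS k t al)).
have [iZW EZW] := integral_weight (@mcosS k t al) (@icosS k t al) mg2 fg2n_lty.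
have iZg : P.-integrable setT (EFin \o (fun w => Z w * gap k w)).
  exact: (integrable_bounded_mul mZ ZB (igap k)).
have -> : \int[P]_w (Z w * (xi k w ^+ 2 - v)) = \int[P]_w (Z w * gap k w).
  transitivity (\int[P]_w (Z w * gap k w + (Z w * (wt k.+1 w * g (X k.+1 w) ^+ 2) - Z w * v))).
    by apply: eq_Rintegral => w _; rewrite xi2E; ring.
  have iZv : P.-integrable setT (EFin \o (fun w => Z w * v)).
    by have := integrable_mulrl v (icosS k t al); under eq_fun do rewrite mulrC.
  rewrite RintegralD//; last exact: integrable_subr.
  by rewrite (RintegralB _ iZW iZv)// EZW (RintegralZr _ measurableT (icosS k t al)) subrr addr0.
rewrite (le_trans (le_normr_Rintegral _ iZg))// -eE.
apply: le_Rintegral => //.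
- exact: integrable_norm iZg.
- exact: integrable_norm (igap k).
- by move=> w _; rewrite normrM ler_piMl.
Qed.

(** For k < n the weight is at most c1/lam n, so |W g(X)| > c sqrt n implies the inequality tested
    here: the truncation no longer involves the weight. *)
Let large (c : R) n (x : 'rV[R]_d) : R :=
  if c * Num.sqrt n%:R * lam n < c1 * `|g x| then g x ^+ 2 else 0.

Let mlarge c n : measurable_fun setT (large c n).
Proof.
apply: measurable_fun_ifT => //; apply: measurable_fun_ltr => //.
by apply: measurable_funM => //; exact: measurableT_comp.
Qed.

Let large_itv c n x : 0 <= large c n x <= g x ^+ 2.
Proof. by rewrite /large; case: ifP => _; rewrite sqr_ge0 lexx. Qed.

Let large0 c n x : 0 <= large c n x. Proof. by have /andP[] := large_itv c n x. Qed.

Let ifg2 : mu.-integrable setT (fun x => (f x * g x ^+ 2)%:E).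
Proof.
apply/integrableP; split; first by apply/measurable_EFinP; exact: measurable_funM.
rewrite (_ : integral _ _ _ = \int[mu]_x (f x * g x ^+ 2)%:E)%E//.
by apply: eq_integral => x _; rewrite /= ger0_norm// mulr_ge0 ?sqr_ge0.
Qed.

(** For fixed x the threshold c sqrt n lam_n eventually exceeds c1 |g(x)|, because n lam_n^2 tends
    to infinity; f g^2 dominates. *)
Let large_cvg0 c : 0 < c -> \int[mu]_x (f x * large c n x) @[n --> \oo] --> (0 : R).
Proof.
move=> c0.
have [|||||_ _] := @dominated_convergence _ _ R mu setT measurableT (fun n x => (f x * large c n x)%:E)
  (cst 0%E) (fun x => (f x * g x ^+ 2)%:E).
- by move=> n; apply/measurable_EFinP; exact: measurable_funM.
- exact: measurable_cst.
- apply: aeW => x _; apply: cvg_near_cst.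
  have p0 : 0 < c ^+ 2 / (c1 ^+ 2 * g x ^+ 2 + 1).
    by rewrite divr_gt0 ?exprn_gt0// ltr_wpDl// mulr_ge0 ?sqr_ge0.
  have /cvgr0Pnorm_lt/(_ _ p0) H := nlam2_cvg0.
  near=> n; have n0 : (0 < n)%N by near: n; exact: nbhs_infty_gt.
  have nR : 0 < n%:R :> R by rewrite ltr0n.
  have /andP[l0 _] := lam_itv n0.
  have : `|(n%:R * lam n ^+ 2)^-1| < c ^+ 2 / (c1 ^+ 2 * g x ^+ 2 + 1) by near: n.
  have nl0 : 0 < n%:R * lam n ^+ 2 by rewrite mulr_gt0 ?exprn_gt0.
  have G0 : 0 < c1 ^+ 2 * g x ^+ 2 + 1 by rewrite ltr_wpDl// mulr_ge0 ?sqr_ge0.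
  rewrite gtr0_norm ?invr_gt0// ltr_pdivlMr// mulrC ltr_pdivrMr// => Hn.
  rewrite /large ifF ?mulr0//; apply/negbTE; rewrite -leNgt.
  have a0 : 0 <= c1 * `|g x| by rewrite mulr_ge0// ltW.
  have b0 : 0 <= c * Num.sqrt n%:R * lam n by rewrite !mulr_ge0 ?sqrtr_ge0// ltW.
  rewrite -(@ler_pXn2r _ 2) ?nnegrE// !exprMn sqr_sqrtr ?ler0n// real_normK ?num_real//.
  by rewrite -mulrA; apply: ltW; apply: le_lt_trans Hn; rewrite lerDl.
- exact: ifg2.
- apply: aeW => x n _; rewrite /= ger0_norm ?mulr_ge0// lee_fin ler_wpM2l//.
  by have /andP[] := large_itv c n x.
rewrite integral0 => H; rewrite /Rintegral.
by have /fine_cvgP[_] := H.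
Unshelve. all: by end_near. Qed.

(** The truncated square is at most |gap| + W large(X). The first term has mean e k, which vanishes
    in Cesaro mean; the second has mean \int f large, whatever k. *)
Let lindeberg c : 0 < c ->
  n%:R^-1 * \sum_(k < n) \int[P]_w tail_square (c * Num.sqrt n%:R) (xi k w)
    @[n --> \oo] --> (0 : R).
Proof.
move=> c0.
apply: (@cvg0_le _ _ (fun n => n%:R^-1 * \sum_(k < n) e k + \int[mu]_x (f x * large c n x))); last first.
  rewrite -[X in _ --> X](addr0 0); apply: cvgD; [exact: mean_cvg|exact: large_cvg0].
near=> n; have n0 : (0 < n)%N by near: n; exact: nbhs_infty_gt.
have nR : 0 < n%:R :> R by rewrite ltr0n.
have /andP[l0 _] := lam_itv n0.
have t0 x : 0 <= tail_square (c * Num.sqrt n%:R) x.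
  by rewrite /tail_square; case: ifP => _; rewrite ?sqr_ge0.
rewrite mulr_ge0 ?invr_ge0 ?(ltW nR)//=; last first.
  by apply: sumr_ge0 => k _; apply: Rintegral_ge0.
rewrite (_ : _ + Rintegral _ _ _ = n%:R^-1 * \sum_(k < n) (e k + \int[mu]_x (f x * large c n x))); last first.
  by rewrite big_split/= sumr_const card_ord -(mulr_natl (Rintegral _ _ _)) mulrDr mulKf ?lt0r_neq0.
rewrite ler_wpM2l ?invr_ge0 ?(ltW nR)// ler_sum// => k _.
have iWl : P.-integrable setT (EFin \o (fun w => wt k.+1 w * large c n (X k.+1 w))).
  apply: (integrable_le_norm _ _ (iW2 k)).
    by apply: measurable_funM => //; exact: (measurableT_comp (@mlarge c n) (@mX k.+1)).
  by move=> w; rewrite ger0_norm ?(mulr_ge0 (wt0 _ _) (large0 _ _ _))// ler_wpM2l//; have /andP[] := large_itv c n (X k.+1 w).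
have -> : \int[mu]_x (f x * large c n x) = \int[P]_w (wt k.+1 w * large c n (X k.+1 w)).
  rewrite /Rintegral (ge0_integral_weight k (@mlarge c n))//.
have ign : P.-integrable setT (EFin \o (fun w => `|gap k w|)) by exact: integrable_norm (igap k).
rewrite -eE -RintegralD//.
have pw w : tail_square (c * Num.sqrt n%:R) (xi k w) <= `|gap k w| + wt k.+1 w * large c n (X k.+1 w).
  rewrite /tail_square; case: ifPn => [big|_]; last by rewrite addr_ge0// mulr_ge0.
  rewrite xi2E lerD ?ler_norm// /large ifT// -ltr_pdivlMr//.
  apply: (lt_le_trans big); rewrite /weighted_term normrM (ger0_norm (wt0 k w)) [leRHS]mulrAC.
  rewrite ler_wpM2r// (le_trans (wtle k w))// ler_pM2l// lef_pV2 ?posrE//.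
  exact: density_floor_ge.
apply: le_Rintegral => //; last exact: integrable_addr.
apply: (integrable_le_norm _ _ (ixi2 k)).
  apply: measurable_fun_ifT => //.
    apply: measurable_fun_ltr => //; apply: measurableT_comp => //; exact: measurable_weighted_term.
  by apply: measurable_funX; exact: measurable_weighted_term.
by move=> w; rewrite ger0_norm// /tail_square; case: ifP => _; rewrite ?sqr_ge0.
Unshelve. all: by end_near. Qed.

Lemma weighted_total_clt t al :
  \int[P]_w cos (t * (S n w / Num.sqrt n%:R) + al) @[n --> \oo] -->
    cos al * expR (- (v * t ^+ 2 / 2)).
Proof.
exact: (martingale_clt measurable_weighted_term v0 ixi2 xi_centered xi_var e_cvg0 lindeberg).
Qed.

(** Orthogonality again, but g may be unbounded: integrability of S_n^2 is carried along the
    induction. *)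
Lemma weighted_total_second_moment n :
  P.-integrable setT (EFin \o (fun w => S n w ^+ 2)) /\
  \int[P]_w (S n w ^+ 2) <= \sum_(k < n) (v + e k).
Proof.
elim: n => [|n [iS2 ES2]].
  rewrite /weighted_total; under eq_fun do rewrite big_ord0 expr0n/=.
  rewrite big_ord0 /Rintegral integral0; split => //.
  exact: (integrable_probability_cst P 0).
have iS : P.-integrable setT (EFin \o S n).
  apply: (integrable_le_norm (g := fun w => 1 + S n w ^+ 2)); first exact: measurable_weighted_total.
    move=> w; rewrite -(real_normK (num_real (S n w))).
    have := sqr_ge0 (`|S n w| - 1); have := normr_ge0 (S n w); nra.
  by apply: integrable_addr => //; exact: (integrable_probability_cst P 1).
have [iSx ESx] := integral_weight (@mSpast n) iS mg fg_lty.
rewrite g_centered mulr0 in ESx.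
have iSx2 : P.-integrable setT (EFin \o (fun w => 2 * (S n w * xi n w))) by exact: integrable_mulrl.
have E w : S n.+1 w ^+ 2 = S n w ^+ 2 + (2 * (S n w * xi n w) + xi n w ^+ 2).
  by rewrite /weighted_total big_ord_recr/=; ring.
have i3 : P.-integrable setT (EFin \o (fun w => 2 * (S n w * xi n w) + xi n w ^+ 2)).
  exact: (integrable_addr iSx2 (ixi2 n)).
under eq_fun do rewrite E.
split; first exact: (integrable_addr iS2 i3).
rewrite RintegralD// (RintegralD _ iSx2 (ixi2 n))// (RintegralZl _ measurableT iSx) ESx mulr0 add0r.
by rewrite big_ord_recr/= lerD// weighted_term_second_moment.
Qed.

Variable Z : nat -> Omega -> R.
Hypothesis mZ : forall n, measurable_fun setT (Z n).
Hypothesis ZE : forall n w, 0 < wt_sum n w -> Z n w = Num.sqrt n%:R * (S n w / wt_sum n w).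

Let Y n w := S n w / Num.sqrt n%:R.
Let M n w := wt_sum n w / n%:R.
(** Bounds the mean square of M - 1; four times it bounds the probability that M < 1/2. *)
Let s n := c1 / (n%:R * lam n).

Let mY n : measurable_fun setT (Y n).
Proof. by apply: measurable_funM => //; apply: measurable_weighted_total. Qed.

Let mM n : measurable_fun setT (M n).
Proof. by apply: measurable_funM => //; apply: measurable_weight_sum. Qed.

Let sqrt_neq0 n : (1 <= n)%N -> Num.sqrt n%:R != 0 :> R.
Proof. by move=> n1; rewrite lt0r_neq0// sqrtr_gt0 ltr0n. Qed.

(** The estimate is prescribed only where the sum of weights is positive, which M >= 1/2
    guarantees. *)
Let ratioE : \forall n \near \oo, forall w, 1 / 2 <= M n w -> Z n w = Y n w / M n w.
Proof.
near=> n => w Mw; have n1 : (1 <= n)%N by near: n; exact: nbhs_infty_gt.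
have n0 : 0 < n%:R :> R by rewrite ltr0n.
have t0 : 0 < wt_sum n w.
  by rewrite -(@pmulr_lgt0 _ n%:R^-1) ?invr_gt0//; apply: lt_le_trans Mw; rewrite divr_gt0.
rewrite ZE// /Y /M; have r0 := sqrt_neq0 n1.
have nE : n%:R = Num.sqrt n%:R ^+ 2 :> R by rewrite sqr_sqrtr// ler0n.
set r := Num.sqrt n%:R in r0 nE *; rewrite nE.
by field; rewrite r0 lt0r_neq0.
Unshelve. all: by end_near. Qed.

Let s_cvg0 : s n @[n --> \oo] --> (0 : R).
Proof.
apply: (@cvg0_le _ _ (fun n => c1 * (n%:R * lam n ^+ 2)^-1)); last first.
  by rewrite -[X in _ --> X](mulr0 c1); apply: cvgM => //; exact: cvg_cst.
near=> n; have n1 : (1 <= n)%N by near: n; exact: nbhs_infty_gt.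
have /andP[l0 l1] := lam_itv n1; have n0 : 0 < n%:R :> R by rewrite ltr0n.
rewrite /s divr_ge0 ?(ltW c1_gt0) ?mulr_ge0 ?(ltW l0)//=.
by rewrite ler_pM2l// lef_pV2 ?posrE ?mulr_gt0 ?exprn_gt0// ler_pM2l// expr2 ler_piMr// ltW.
Unshelve. all: by end_near. Qed.

Let badM : \forall n \near \oo, (P (~` [set w | (1 / 2 <= M n w)%R]) <= (4 * s n)%:E)%E.
Proof.
near=> n; have n1 : (1 <= n)%N by near: n; exact: nbhs_infty_gt.
have -> : [set w | 1 / 2 <= M n w] = good_weights n.
  apply/seteqP; split => w; rewrite /good_weights /M /= ler_pdivlMr ?ltr0n// mul1r mulrC//.
have -> : 4 * s n = 4 * c1 / (n%:R * lam n) by rewrite mulrA.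
by apply: bad_weights_le.
Unshelve. all: by end_near. Qed.

Let varM : \forall n \near \oo, [/\ 0 < s n,
  P.-integrable setT (EFin \o (fun w => (M n w - 1) ^+ 2)) &
  \int[P]_w ((M n w - 1) ^+ 2) <= s n].
Proof.
near=> n; have n1 : (1 <= n)%N by near: n; exact: nbhs_infty_gt.
have /andP[l0 l1] := lam_itv n1; have n0 : 0 < n%:R :> R by rewrite ltr0n.
have [i V] := weight_sum_variance n1.
have ME w : (M n w - 1) ^+ 2 = n%:R ^- 2 * (\sum_(a < n) (wt a.+1 w - 1)) ^+ 2.
  rewrite sumrB sumr_const card_ord /M wt_sumE; field; exact: lt0r_neq0.
split; first by rewrite divr_gt0// mulr_gt0.
  by under eq_fun do rewrite ME; exact: integrable_mulrl.
under eq_Rintegral do rewrite ME.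
rewrite RintegralZl//.
apply: (@le_trans _ _ (n%:R ^- 2 * (n%:R * (c1 / lam n)))).
  by rewrite ler_wpM2l// invr_ge0 sqr_ge0.
rewrite le_eqVlt; apply/orP; left; apply/eqP; rewrite /s; field.
by rewrite !lt0r_neq0.
Unshelve. all: by end_near. Qed.

Let momentY : \forall n \near \oo, P.-integrable setT (EFin \o (fun w => Y n w ^+ 2)) /\
  \int[P]_w (Y n w ^+ 2) <= v + 1.
Proof.
have ve : n%:R^-1 * \sum_(k < n) (v + e k) @[n --> \oo] --> v.
  apply: (@mean_cvg _ (fun k => v + e k)); rewrite -[X in _ --> X]addr0; apply: cvgD => //; exact: cvg_cst.
have /cvgr_le/(_ (v + 1)) ve1 := ve.
near=> n; have n1 : (1 <= n)%N by near: n; exact: nbhs_infty_gt.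
have n0 : 0 < n%:R :> R by rewrite ltr0n.
have [i V] := weighted_total_second_moment n.
have YE w : Y n w ^+ 2 = n%:R^-1 * S n w ^+ 2.
  by rewrite /Y expr_div_n sqr_sqrtr ?ler0n// mulrC.
split; first by under eq_fun do rewrite YE; exact: integrable_mulrl.
under eq_Rintegral do rewrite YE.
rewrite RintegralZl//; apply: (@le_trans _ _ (n%:R^-1 * \sum_(k < n) (v + e k))).
  by rewrite ler_wpM2l// invr_ge0 ltW.
by near: n; apply: ve1; rewrite ltrDl.
Unshelve. all: by end_near. Qed.

Let pb_cvg0 : 4 * s n @[n --> \oo] --> (0 : R).
Proof. by rewrite -[X in _ --> X](mulr0 4); apply: cvgM s_cvg0; exact: cvg_cst. Qed.

Let cosY t al : \int[P]_w cos (t * Y n w + al) @[n --> \oo] -->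
  cos al * expR (- (v * t ^+ 2 / 2)).
Proof.
exact: weighted_total_clt.
Qed.

Lemma self_normalized_clt : cvg_in_distribution P Z (normal_law 0 v).
Proof.
have C0 : 0 < v + 1 by rewrite ltr_pwDr.
split => // phi cphi [B phiB].
apply: (cvg_cos_in_distribution mZ _ _ cphi phiB).
  move=> t al; rewrite integral_normal_law_cos//.
  exact: (ratio_cos (L := fun t al => cos al * expR (- (v * t ^+ 2 / 2))) mY mM mZ ratioE badM pb_cvg0 varM s_cvg0 momentY cosY).
exact: (ratio_tight mM mZ C0 ratioE badM pb_cvg0 varM momentY).
Qed.

End integrand.

End subsampling.

(** * Rates and conclusion *)

Section rates.
Context {R : realType}.

Variables (d : nat) (h lam : nat -> R) (ell : nat -> nat) (Hm eps c1 Bf CK Cb Cq : R).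
Hypothesis h_gt0 : forall k, (1 <= k)%N -> 0 < h k.
Hypothesis h_le : forall k, (1 <= k)%N -> h k <= Hm.
Hypothesis lam_itv : forall k, (1 <= k)%N -> 0 < lam k <= 1.
Hypothesis ell_gt0 : forall k, (1 <= k)%N -> (0 < ell k)%N.
Let a n := Num.sqrt (ln n%:R / (n%:R * h n ^+ d)).
Hypothesis eps0 : 0 < eps.
Hypothesis rate1 : much_smaller (fun n => a n ^+ 2 * (n%:R / (ell n)%:R) + a n + h n ^+ 4)
  (fun n => lam n `^ (1 + eps)).
Hypothesis rate2 : much_smaller (fun n => lam n `^ (1 + eps)) (fun=> 1).
Hypotheses (c1_gt0 : 0 < c1) (Bf0 : 0 <= Bf) (CK0 : 0 < CK).

(** Since lam <= 1, eps may be lowered. Being at most 1, ep gives lam^2 <= lam^(1 + ep), which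
    absorbs the squared share of q0 in the mixture, and keeps ep/4 below 1. *)
Let ep := Num.min eps 1.
Let ep0 : 0 < ep. Proof. by rewrite lt_min eps0 ltr01. Qed.
Let ep1 : ep <= 1. Proof. by rewrite ge_min lexx orbT. Qed.

Lemma lam_cvg0 : lam n @[n --> \oo] --> (0 : R).
Proof.
apply: (@powR_cvg0_inv _ lam (1 + eps)); first by rewrite addr_gt0.
  by near=> n; have /andP[/ltW] : 0 < lam n <= 1 by apply: lam_itv; near: n; exact: nbhs_infty_gt.
by move: rate2; rewrite /much_smaller; under eq_fun do rewrite divr1.
Unshelve. all: by end_near. Qed.

(** Once ln n >= 1, a_n^2 n/l_n dominates 1/(l_n h_n^d) and a_n^2 dominates 1/(n h_n^d). Each
    nonnegative term of the rate is bounded separately; the one in a_n is then squared. *)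
Lemma rates_eventually : \forall n \near \oo,
  [/\ (1 <= n)%N, ((ell n)%:R * h n ^+ d)^-1 <= lam n `^ (1 + ep),
      h n ^+ 4 <= lam n `^ (1 + ep) & (n%:R * h n ^+ d)^-1 <= (lam n `^ (1 + ep)) ^+ 2].
Proof.
move/cvgr0Pnorm_lt : rate1 => /(_ 1 ltr01) ev.
near=> n; have n3 : (3 <= n)%N by near: n; exact: nbhs_infty_ge.
have n1 : (1 <= n)%N by exact: leq_trans n3.
have nR : 0 < n%:R :> R by rewrite ltr0n.
have /andP[l0 l1] := lam_itv n1; have hn := h_gt0 n1; have el0 := ell_gt0 n1.
have hd : 0 < h n ^+ d by rewrite exprn_gt0.
have lR : 0 < (ell n)%:R :> R by rewrite ltr0n.
have ln1 : 1 <= ln (n%:R : R).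
  rewrite -[leLHS]expRK ler_ln ?posrE ?expR_gt0//.
  by near: n; exact: nbhs_infty_ger.
have a20 : a n ^+ 2 = ln n%:R / (n%:R * h n ^+ d).
  by rewrite sqr_sqrtr// divr_ge0 ?mulr_ge0 ?(ltW hd)// (le_trans _ ln1).
have a0 : 0 <= a n by exact: sqrtr_ge0.
have t10 : 0 <= a n ^+ 2 * (n%:R / (ell n)%:R) by rewrite mulr_ge0 ?sqr_ge0.
have h40 : 0 <= h n ^+ 4 by rewrite exprn_ge0// ltW.
have L : lam n `^ (1 + eps) <= lam n `^ (1 + ep).
  by rewrite ger_powR// ?l0// lerD2l ge_min lexx.
have : `|(a n ^+ 2 * (n%:R / (ell n)%:R) + a n + h n ^+ 4) / lam n `^ (1 + eps)| < 1.
  by near: n.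
rewrite ger0_norm; last by rewrite divr_ge0 ?powR_ge0// !addr_ge0.
rewrite ltr_pdivrMr ?powR_gt0// mul1r => /ltW/le_trans/(_ L) H.
have aL : a n <= lam n `^ (1 + ep) by lra.
split => //; [|lra|].
- apply: (@le_trans _ _ (a n ^+ 2 * (n%:R / (ell n)%:R))); last by lra.
  rewrite a20 [leRHS](_ : _ = ln n%:R * ((ell n)%:R * h n ^+ d)^-1); last first.
    by field; rewrite !lt0r_neq0.
  by rewrite -[leLHS]mul1r ler_wpM2r// invr_ge0 mulr_ge0// ltW.
- apply: (@le_trans _ _ (a n ^+ 2)); last by rewrite ler_pXn2r ?nnegrE ?powR_ge0.
  by rewrite a20 -[leLHS]mul1r ler_wpM2r// invr_ge0 mulr_ge0// ltW.
Unshelve. all: by end_near. Qed.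

(** Collects the coefficients of lam^(1 + ep) in the terms of the deviation bound. [Hm ^+ d] comes
    from writing 1/(n lam) as h^d/(n h^d lam); the final 1 makes the constant positive. *)
Definition deviation_const : R :=
  2 * (6 * (CK * Bf) + 24 * c1 * (CK * Bf) + 24 * c1 * Bf ^+ 2 * Hm ^+ d + 3 * Cb ^+ 2) +
  2 * Cq ^+ 2 + 1.

Let Hm0 : 0 <= Hm.
Proof. by rewrite (le_trans _ (h_le (leqnn 1)))// ltW// h_gt0. Qed.

Lemma deviation_const_gt0 : 0 < deviation_const.
Proof.
have c10 := ltW c1_gt0; have CK00 := ltW CK0; have Hd : 0 <= Hm ^+ d by exact: exprn_ge0.
have t1 : 0 <= CK * Bf by exact: mulr_ge0.
have t2 : 0 <= 24 * c1 * (CK * Bf) by rewrite mulr_ge0// mulr_ge0.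
have t3 : 0 <= 24 * c1 * Bf ^+ 2 * Hm ^+ d by rewrite mulr_ge0// mulr_ge0 ?sqr_ge0// mulr_ge0.
have := sqr_ge0 Cb; have := sqr_ge0 Cq; rewrite /deviation_const; lra.
Qed.

Lemma deviation_bound_le : \forall n \near \oo,
  @deviation_bound R d h lam ell c1 Bf CK Cb Cq n <= deviation_const * lam n `^ (1 + ep).
Proof.
have ev := rates_eventually.
near=> n; have [n1 r1 r2 r3] : [/\ (1 <= n)%N, ((ell n)%:R * h n ^+ d)^-1 <= lam n `^ (1 + ep),
      h n ^+ 4 <= lam n `^ (1 + ep) & (n%:R * h n ^+ d)^-1 <= (lam n `^ (1 + ep)) ^+ 2] by near: n.
have nR : 0 < n%:R :> R by rewrite ltr0n.
have /andP[l0 l1] := lam_itv n1; have hn := h_gt0 n1; have el0 := ell_gt0 n1.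
have hd : 0 < h n ^+ d by rewrite exprn_gt0.
have lR : 0 < (ell n)%:R :> R by rewrite ltr0n.
set L := lam n `^ (1 + ep) in r1 r2 r3 *.
have Lp : 0 <= L by exact: powR_ge0.
have Ll : L <= lam n.
  by rewrite -[leRHS](powRr1 (ltW l0)) ger_powR ?l0// lerDl ltW.
have lL : lam n ^+ 2 <= L.
  rewrite -(powR_mulrn 2) ?(ltW l0)// ger_powR ?l0//.
  by have := ep1; lra.
(* 1/(n h^d) <= L^2 and L <= lam: one factor L pays for the division by lam. *)
have s1 : (n%:R * h n ^+ d * lam n)^-1 <= L.
  rewrite invfM ler_pdivrMr// (le_trans r3)// expr2 ler_wpM2l//.
have s2 : (n%:R * lam n)^-1 <= Hm ^+ d * L.
  apply: (@le_trans _ _ (h n ^+ d * (n%:R * h n ^+ d * lam n)^-1)).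
    by rewrite (_ : h n ^+ d * _ = (n%:R * lam n)^-1)//; field; rewrite !lt0r_neq0.
  apply: ler_pM => //; first exact: ltW.
    by rewrite invr_ge0 !mulr_ge0// ltW.
  by rewrite lerXn2r ?nnegrE ?(ltW hn)// h_le.
have c10 := ltW c1_gt0; have CK00 := ltW CK0.
have t1 : 0 <= CK * Bf by exact: mulr_ge0.
rewrite /deviation_bound.
have -> : 6 * (CK * Bf / h n ^+ d) / (ell n)%:R = 6 * (CK * Bf) * ((ell n)%:R * h n ^+ d)^-1.
  by field; rewrite !lt0r_neq0.
have -> : 24 * c1 / (n%:R * lam n) * (CK * Bf / h n ^+ d + Bf ^+ 2) =
   24 * c1 * (CK * Bf) * (n%:R * h n ^+ d * lam n)^-1 + 24 * c1 * Bf ^+ 2 * (n%:R * lam n)^-1.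
  by field; rewrite !lt0r_neq0.
have e1 : 6 * (CK * Bf) * ((ell n)%:R * h n ^+ d)^-1 <= 6 * (CK * Bf) * L.
  by rewrite ler_wpM2l// mulr_ge0.
have e2 : 24 * c1 * (CK * Bf) * (n%:R * h n ^+ d * lam n)^-1 <= 24 * c1 * (CK * Bf) * L.
  by rewrite ler_wpM2l// mulr_ge0// mulr_ge0.
have e3 : 24 * c1 * Bf ^+ 2 * (n%:R * lam n)^-1 <= 24 * c1 * Bf ^+ 2 * (Hm ^+ d * L).
  by rewrite ler_wpM2l// mulr_ge0 ?sqr_ge0// mulr_ge0.
have e4 : 3 * Cb ^+ 2 * h n ^+ 4 <= 3 * Cb ^+ 2 * L.
  by rewrite ler_wpM2l// mulr_ge0 ?sqr_ge0.
have e5 : (lam n * Cq) ^+ 2 <= Cq ^+ 2 * L.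
  by rewrite exprMn mulrC ler_wpM2l ?sqr_ge0.
rewrite /deviation_const; lra.
Unshelve. all: by end_near. Qed.

(** 1/(n lam^2) is h^d times (n h^d)^-1/lam^2; the squared rate of a_n beats lam^2 and leaves Hm^d
    lam^(2 ep). *)
Lemma inv_nlam2_cvg0 : (n%:R * lam n ^+ 2)^-1 @[n --> \oo] --> (0 : R).
Proof.
have ev := rates_eventually.
apply: (@cvg0_le _ _ (fun n => Hm ^+ d * lam n `^ (2 * ep))); last first.
  rewrite -[X in _ --> X](mulr0 (Hm ^+ d)); apply: cvgM; first exact: cvg_cst.
  apply: powR_cvg0 lam_cvg0; first by rewrite mulr_gt0.
  by near=> n; have /andP[/ltW] : 0 < lam n <= 1 by apply: lam_itv; near: n; exact: nbhs_infty_gt.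
near=> n; have [n1 r1 r2 r3] : [/\ (1 <= n)%N, ((ell n)%:R * h n ^+ d)^-1 <= lam n `^ (1 + ep),
      h n ^+ 4 <= lam n `^ (1 + ep) & (n%:R * h n ^+ d)^-1 <= (lam n `^ (1 + ep)) ^+ 2] by near: n.
have nR : 0 < n%:R :> R by rewrite ltr0n.
have /andP[l0 l1] := lam_itv n1; have hn := h_gt0 n1.
have hd : 0 < h n ^+ d by rewrite exprn_gt0.
have l2 : 0 < lam n ^+ 2 by rewrite exprn_gt0.
rewrite invr_ge0 mulr_ge0 ?(ltW l2) ?(ltW nR)//=.
rewrite (_ : (n%:R * _)^-1 = h n ^+ d * ((n%:R * h n ^+ d)^-1 / lam n ^+ 2)); last first.
  by field; rewrite !lt0r_neq0.
apply: ler_pM; [exact: ltW|by rewrite divr_ge0 ?invr_ge0 ?mulr_ge0// ltW|..].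
  by rewrite lerXn2r ?nnegrE ?(ltW hn)// h_le.
rewrite ler_pdivrMr// (le_trans r3)//.
rewrite -(powR_mulrn 2) ?powR_ge0// -(powR_mulrn 2) ?(ltW l0)// -powRrM -powRD; last first.
  by rewrite (gt_eqF l0) implybT.
by rewrite (_ : (1 + ep) * 2 = 2 * ep + 2)//; ring.
Unshelve. all: by end_near. Qed.

(** Small enough that (1 + ep)(1 - eta) > 1: the power of the deviation bound then beats the
    division by lam. *)
Let eta := ep / 4.

Lemma error_coef_cvg0 c :
  c1 * (c1 / lam n + 1) * (4 * c1 / (n%:R * lam n)) +
  c ^+ 2 * (4 * (deviation_const * lam n `^ (1 + ep))) `^ (1 - eta) / lam n @[n --> \oo] --> (0 : R).
Proof.
have ep0' := ep0; have ep1' := ep1.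
have lamp : \forall n \near \oo, 0 < lam n <= 1.
  by near=> n; apply: lam_itv; near: n; exact: nbhs_infty_gt.
rewrite -[X in _ --> X](addr0 0); apply: cvgD.
  apply: (@cvg0_le _ _ (fun n => 4 * c1 ^+ 2 * (c1 + 1) * (n%:R * lam n ^+ 2)^-1)); last first.
    rewrite -[X in _ --> X](mulr0 (4 * c1 ^+ 2 * (c1 + 1))); apply: cvgM; first exact: cvg_cst.
    exact: inv_nlam2_cvg0.
  near=> n; have /andP[l0 l1] : 0 < lam n <= 1 by near: n.
  have n1 : (0 < n)%N by near: n; exact: nbhs_infty_gt.
  have nR : 0 < n%:R :> R by rewrite ltr0n.
  have c10 := ltW c1_gt0.
  have nl : 0 < n%:R * lam n by rewrite mulr_gt0.
  have p1 : 0 <= 4 * c1 / (n%:R * lam n) by rewrite divr_ge0 ?mulr_ge0// ltW.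
  have p2 : 0 <= c1 / lam n by rewrite divr_ge0// ltW.
  rewrite mulr_ge0//=; last by rewrite mulr_ge0// addr_ge0.
  rewrite [leRHS](_ : _ = c1 * ((c1 + 1) / lam n) * (4 * c1 / (n%:R * lam n))); last first.
    by field; rewrite !lt0r_neq0.
  by rewrite ler_wpM2r// ler_wpM2l// mulrDl lerD2l div1r -[leLHS]invr1 lef_pV2 ?posrE.
pose s := (1 + ep) * (1 - eta) - 1.
have s0 : 0 < s by rewrite /s /eta; nra.
have C0 := deviation_const_gt0.
apply: (@cvg0_le _ _ (fun n => c ^+ 2 * (4 * deviation_const) `^ (1 - eta) * lam n `^ s)); last first.
  rewrite -[X in _ --> X](mulr0 (c ^+ 2 * (4 * deviation_const) `^ (1 - eta))).
  apply: cvgM; first exact: cvg_cst.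
  by apply: powR_cvg0 lam_cvg0 => //; near=> n; have /andP[/ltW] : 0 < lam n <= 1 by near: n.
near=> n; have /andP[l0 l1] : 0 < lam n <= 1 by near: n.
rewrite divr_ge0 ?(ltW l0)//=; last by rewrite mulr_ge0 ?sqr_ge0// powR_ge0.
rewrite mulrA powRM ?powR_ge0//; last by rewrite mulr_ge0// ltW.
rewrite -powRrM mulrA -(mulrA _ _ (lam n)^-1) ler_wpM2l ?(mulr_ge0 (sqr_ge0 c) (powR_ge0 _ _))//.
rewrite /s powRD; last by rewrite (gt_eqF l0) implybT.
by rewrite powR_inv1// ltW.
Unshelve. all: by end_near. Qed.

Lemma deviation_const_cvg0 : deviation_const * lam n `^ (1 + ep) @[n --> \oo] --> (0 : R).
Proof.
rewrite -[X in _ --> X](mulr0 deviation_const); apply: cvgM; first exact: cvg_cst.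
apply: powR_cvg0 lam_cvg0; first by rewrite addr_gt0.
by near=> n; have /andP[/ltW] : 0 < lam n <= 1 by apply: lam_itv; near: n; exact: nbhs_infty_gt.
Unshelve. all: by end_near. Qed.

Lemma rates_summary : exists (eta : R) (D : nat -> R), [/\ 0 < eta < 1,
  (forall k, (1 <= k)%N -> 0 < D k),
  \forall k \near \oo, @deviation_bound R d h lam ell c1 Bf CK Cb Cq k <= D k,
  D k @[k --> \oo] --> (0 : R) &
  forall c, c1 * (c1 / lam n + 1) * (4 * c1 / (n%:R * lam n)) +
    c ^+ 2 * (4 * D n) `^ (1 - eta) / lam n @[n --> \oo] --> (0 : R)].
Proof.
exists eta, (fun n => deviation_const * lam n `^ (1 + ep)); split.
- by rewrite /eta; have := ep0; have := ep1; lra.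
- move=> k k1; have /andP[l0 _] := lam_itv k1.
  by rewrite mulr_gt0 ?deviation_const_gt0// powR_gt0.
- exact: deviation_bound_le.
- exact: deviation_const_cvg0.
- exact: error_coef_cvg0.
Qed.

End rates.

(** * Passage from fU to the normalised density *)

Section normalization.
Context {R : realType} {d : nat} {disp : measure_display}
  {Omega : measurableType disp} {P : probability Omega R}.
Variables (fU f q0 K : 'rV[R]_d -> R) (h lam : nat -> R) (ell : nat -> nat).
Variables (X : nat -> {RV P >-> 'rV[R]_d}) (Xs : nat -> nat -> {RV P >-> 'rV[R]_d}).
Variable c : R.
Hypotheses (c_gt0 : 0 < c) (fE : forall x, fU x = c * f x).

Lemma weight_scale k w :
  weight fU q0 K h lam ell X Xs k w = c * weight f q0 K h lam ell X Xs k w.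
Proof. by rewrite /weight fE mulrA. Qed.

Lemma weight_sum_scale n w :
  weight_sum fU q0 K h lam ell X Xs n w = c * weight_sum f q0 K h lam ell X Xs n w.
Proof. by rewrite /weight_sum mulr_sumr; apply: eq_bigr => k _; rewrite weight_scale. Qed.

Lemma nweight_scale n k w :
  nweight fU q0 K h lam ell X Xs n k w = nweight f q0 K h lam ell X Xs n k w.
Proof.
rewrite /nweight weight_scale weight_sum_scale invfM mulrACA mulfV ?mul1r//.
exact: lt0r_neq0.
Qed.

Lemma bootstrap_step_scale k : bootstrap_step fU q0 K h lam ell X Xs k ->
  bootstrap_step f q0 K h lam ell X Xs k.
Proof.
move=> boot B mB; have := boot B mB.
have -> : [set w | 0 < weight_sum fU q0 K h lam ell X Xs k w] =
    [set w | 0 < weight_sum f q0 K h lam ell X Xs k w].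
  by apply/seteqP; split => w /=; rewrite weight_sum_scale pmulr_rgt0.
have -> // : (fun w => \prod_(i < ell k) weighted_empirical fU q0 K h lam ell X Xs k w (B i))%E =
    (fun w => \prod_(i < ell k) weighted_empirical f q0 K h lam ell X Xs k w (B i))%E.
apply/funext => w; apply: eq_bigr => i _; apply: eq_bigr => j _.
by rewrite nweight_scale.
Qed.

Lemma weighted_estimate_scale g n w :
  weighted_estimate fU q0 K h lam ell X Xs g n w = weighted_estimate f q0 K h lam ell X Xs g n w.
Proof. by apply: eq_bigr => k _; rewrite nweight_scale. Qed.

End normalization.

(** * Centring of the integrand *)

Section centering.
Context {R : realType} {d : nat}.
Variables (f q0 g : 'rV[R]_d -> R) (c1 : R).
Local Notation mu := (@lebesgue_rV R d).
Hypotheses (Hf : is_density f) (Hq0 : is_density q0).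
Hypotheses (fq0 : forall x, f x <= c1 * q0 x).
Hypotheses (mg : measurable_fun setT g) (gq0 : (\int[mu]_x (g x ^+ 2 * q0 x)%:E < +oo)%E).
Let m := \int[mu]_x (g x * f x).

Let mf : measurable_fun setT f. Proof. by case: Hf. Qed.
Let f0 x : 0 <= f x. Proof. by case: Hf. Qed.
Let q00 x : 0 <= q0 x. Proof. by case: Hq0. Qed.

Let idensity (p : 'rV[R]_d -> R) : is_density p -> mu.-integrable setT (EFin \o p).
Proof.
move=> [mp p0 p1]; apply/integrableP; split; first exact/measurable_EFinP.
rewrite (eq_integral (fun x => (p x)%:E)) ?p1 ?ltry//.
by move=> x _; rewrite /= ger0_norm.
Qed.

Let ig2q0 : mu.-integrable setT (EFin \o (fun x => g x ^+ 2 * q0 x)).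
Proof.
have [mq0 _ _] := Hq0.
apply/integrableP; split.
  by apply/measurable_EFinP; apply: measurable_funM => //; exact: measurable_funX.
rewrite (_ : integral _ _ _ = \int[mu]_x (g x ^+ 2 * q0 x)%:E)%E//.
by apply: eq_integral => x _; rewrite /= ger0_norm// mulr_ge0 ?sqr_ge0.
Qed.

Let ig2f : mu.-integrable setT (EFin \o (fun x => g x ^+ 2 * f x)).
Proof.
apply: (integrable_le_norm _ _ (integrable_mulrl c1 ig2q0)).
  by apply: measurable_funM => //; exact: measurable_funX.
by move=> x; rewrite ger0_norm ?(mulr_ge0 (sqr_ge0 _) (f0 _))// mulrCA ler_wpM2l ?sqr_ge0.
Qed.

Let igf : mu.-integrable setT (EFin \o (fun x => g x * f x)).
Proof.
apply: (integrable_le_norm _ _ (integrable_addr (idensity Hf) ig2f)); first exact: measurable_funM.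
move=> x; rewrite normrM (ger0_norm (f0 x)) -{2}(mul1r (f x)) -mulrDl ler_wpM2r//.
rewrite -(real_normK (num_real (g x))); have := sqr_ge0 (`|g x| - 1); nra.
Qed.

Lemma centered_square_lty c : (\int[mu]_x ((g x - c) ^+ 2 * q0 x)%:E < +oo)%E.
Proof.
have [mq0 _ _] := Hq0.
have i : mu.-integrable setT (EFin \o (fun x => (g x - c) ^+ 2 * q0 x)).
  apply: (integrable_le_norm _ _ (integrable_addr (integrable_mulrl 2 ig2q0)
    (integrable_mulrl (2 * c ^+ 2) (idensity Hq0)))).
    by apply: measurable_funM => //; apply: measurable_funX; exact: measurable_funB.
  move=> x; rewrite ger0_norm ?(mulr_ge0 (sqr_ge0 _) (q00 _))// mulrA -mulrDl ler_wpM2r//.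
  have := sqr_ge0 (g x + c); nra.
have /integrableP[_] := i.
rewrite (_ : integral _ _ _ = \int[mu]_x ((g x - c) ^+ 2 * q0 x)%:E)%E//.
by apply: eq_integral => x _; rewrite /= ger0_norm// mulr_ge0 ?sqr_ge0.
Qed.

Let mass1 : \int[mu]_x f x = 1.
Proof. by case: Hf => _ _ f1; rewrite /Rintegral f1. Qed.

Lemma centered_mean : \int[mu]_x (f x * (g x - m)) = 0.
Proof.
have E x : f x * (g x - m) = g x * f x - m * f x by ring.
under eq_Rintegral do rewrite E.
rewrite (RintegralB _ igf (integrable_mulrl m (idensity Hf)))//.
by rewrite (RintegralZl _ measurableT (idensity Hf)) mass1 mulr1 subrr.
Qed.

Lemma centered_variance : \int[mu]_x (f x * (g x - m) ^+ 2) = asymptotic_variance f g.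
Proof.
have E x : f x * (g x - m) ^+ 2 = g x ^+ 2 * f x - 2 * m * (g x * f x) + m ^+ 2 * f x by ring.
under eq_Rintegral do rewrite E.
have i1 := integrable_mulrl (2 * m) igf; have i2 := integrable_mulrl (m ^+ 2) (idensity Hf).
rewrite (RintegralD _ (integrable_subr ig2f i1) i2)// (RintegralB _ ig2f i1)//.
rewrite (RintegralZl _ measurableT igf) (RintegralZl _ measurableT (idensity Hf)) mass1.
by rewrite /asymptotic_variance -/m; ring.
Qed.

End centering.

Theorem theorem9 (R : realType) (d : nat) (hd : (0 < d)%N)
  (disp : measure_display) (Omega : measurableType disp)
  (P : probability Omega R)
  (fU q0 K : 'rV[R]_d -> R)
  (mfU : measurable_fun setT fU) (fU_ge0 : forall x, 0 <= fU x)
  (fU_int : (0 < \int[lebesgue_rV d]_x (fU x)%:E < +oo)%E)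
  (f : 'rV[R]_d -> R)
  (fE : f = fun x => fU x / (\int[lebesgue_rV d]_y fU y))
  (h lam : nat -> R) (ell : nat -> nat)
  (h_gt0 : forall k, (1 <= k)%N -> 0 < h k)
  (h_bounded : exists M : R, forall k, (1 <= k)%N -> h k <= M)
  (lam_itv : forall k, (1 <= k)%N -> 0 < lam k <= 1)
  (lam_nincr : forall j k, (1 <= j)%N -> (j <= k)%N -> lam k <= lam j)
  (ell_itv : forall k, (1 <= k)%N -> (1 <= ell k <= k)%N)
  (ell_ndecr : forall j k, (1 <= j)%N -> (j <= k)%N -> (ell j <= ell k)%N)
  (a : nat -> R)
  (aE : a = fun n => Num.sqrt (ln n%:R / (n%:R * h n ^+ d)))
  (H1 : smooth_target f)
  (H2 : reference_density f q0)
  (H3 : smoothing_kernel K)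
  (X : nat -> {RV P >-> 'rV[R]_d}) (Xs : nat -> nat -> {RV P >-> 'rV[R]_d})
  (scheme : subsampling_scheme fU q0 K h lam ell X Xs)
  (rates : exists2 eps : R, 0 < eps &
     much_smaller (fun n => a n ^+ 2 * (n%:R / (ell n)%:R) + a n + h n ^+ 4)
                  (fun n => lam n `^ (1 + eps)) /\
     much_smaller (fun n => lam n `^ (1 + eps)) (fun=> 1))
  (g : 'rV[R]_d -> R) (mg : measurable_fun setT g)
  (g_int : (\int[lebesgue_rV d]_x (g x ^+ 2 * q0 x)%:E < +oo)%E) :
  cvg_in_distribution P
    (fun n w => Num.sqrt n%:R *
       (weighted_estimate fU q0 K h lam ell X Xs g n w -
        \int[lebesgue_rV d]_x (g x * f x)))
    (normal_law 0 (asymptotic_variance f g)).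
Proof.
case: rates => eps eps0 [rate1 rate2]; rewrite aE in rate1.
have [Hf [df ddf] [Mf ddfM]] := H1; have [mf f0 _] := Hf.
have [Hq0 fq tail_q0] := H2; have [mq0 q00 _] := Hq0.
have [bootU sampling] := scheme.
have [_ _ _ _ tail_K] := H3; have mK := kernel_measurable H3.
have I0 : 0 < \int[lebesgue_rV d]_y fU y by exact: fine_gt0.
set I := \int[lebesgue_rV d]_y fU y in fE I0.
have fUE x : fU x = I * f x by rewrite fE mulrC divfK// lt0r_neq0.
have boot k (k0 : (1 <= k)%N) := bootstrap_step_scale I0 fUE (bootU k k0).
(* At eta = 1 the tail condition reads f <= c1 q0: it bounds the weights by c1/lam and, q0 being
   bounded, f itself. *)
have [c1 c10 fq1] := fq 1 (introT andP (conj ltr01 (lexx 1))).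
have fq0 x : f x <= c1 * q0 x by have := fq1 x; rewrite powRr1.
have [C0 C00 q0C] := polynomial_tail_bounded tail_q0.
have [CK CK0 KC] := polynomial_tail_bounded tail_K.
have fC x : f x <= c1 * C0 by rewrite (le_trans (fq0 x))// ler_pM2l.
have q0fC x : `|q0 x - f x| <= C0 + c1 * C0.
  by rewrite (le_trans (ler_normB _ _))// !ger0_norm// lerD.
have f0C x : 0 <= f x <= c1 * C0 by rewrite f0 fC.
have [Cb _ bias] := kernel_bias H3 mf f0C (fun i => proj1 (df i)) (fun i j => proj1 (ddf i j)) ddfM.
have [Hm hHm] := h_bounded.
have ell_gt0 k : (1 <= k)%N -> (0 < ell k)%N by move=> /ell_itv/andP[].
have Bf0 : 0 <= c1 * C0 by rewrite mulr_ge0// ltW.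
have [eta [D [eta01 D0 devD D_cvg0 coef_cvg0]]] :=
  rates_summary Cb (C0 + c1 * C0) h_gt0 hHm lam_itv ell_gt0 eps0 rate1 rate2 c10 Bf0 CK0.
have nlam2 := @inv_nlam2_cvg0 _ _ _ _ _ _ _ h_gt0 hHm lam_itv ell_gt0 eps0 rate1 rate2.
have eta1 : 0 < eta <= 1 by case/andP: eta01 => e0 e1; rewrite e0 ltW.
(* The tail condition again, at the small eta dictated by the rates. *)
have [c _ fceta] := fq eta eta1.
pose B n := c1 * (c1 / lam n + 1) * (4 * c1 / (n%:R * lam n)) +
  c ^+ 2 * (4 * D n) `^ (1 - eta) / lam n.
have B0 : \forall k \near \oo, 0 <= B k.
  near=> k; have k1 : (1 <= k)%N by near: k; exact: nbhs_infty_gt.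
  have /andP[l0 _] := lam_itv _ k1.
  have c1l : 0 <= c1 / lam k by rewrite divr_ge0 ?(ltW c10) ?(ltW l0).
  apply: addr_ge0; apply: mulr_ge0; rewrite ?invr_ge0 ?(ltW l0)//.
  - by apply: mulr_ge0; [exact: ltW|exact: addr_ge0].
  - by apply: divr_ge0; apply: mulr_ge0; rewrite ?(ltW c10) ?(ltW l0).
  - by apply: mulr_ge0; [exact: sqr_ge0|exact: powR_ge0].
have error_le : \forall k \near \oo, forall x,
    (\int[P]_w (`|f x ^+ 2 / sampling_density q0 K h lam ell Xs k w x - f x|)%:E <=
    (B k * q0 x + Num.min (3 * c1 * q0 x) (2 * Num.sqrt (D k)))%:E)%E.
  near=> k => x; have k1 : (1 <= k)%N by near: k; exact: nbhs_infty_gt.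
  apply: (weight_error H3 Hf Hq0 c10 fq0 h_gt0 lam_itv lam_nincr sampling ell_gt0 boot
    fC KC CK0 (fun s x => @bias s x) q0fC x k1 eta01 fceta (D0 k k1)).
  by near: k.
set m := \int[lebesgue_rV d]_x (g x * f x).
pose g0 x := g x - m.
have mg0 : measurable_fun setT g0 by exact: measurable_funB.
have g0q0 : (\int[lebesgue_rV d]_x (g0 x ^+ 2 * q0 x)%:E < +oo)%E.
  exact: (centered_square_lty Hq0 mg g_int).
have e_cvg0 := @square_error_cvg0 _ _ _ _ _ _ _ _ _ _ _ _ _ _ H3 Hf Hq0 c10 fq0 h_gt0 lam_itv
  sampling _ mg0 g0q0 _ _ error_le B0 (coef_cvg0 c) D_cvg0.
rewrite -(centered_variance Hf Hq0 fq0 mg g_int) -/m.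
apply: (self_normalized_clt H3 Hf Hq0 c10 fq0 h_gt0 lam_itv lam_nincr sampling mg0 g0q0
  (centered_mean Hf Hq0 fq0 mg g_int) e_cvg0 nlam2).
- move=> n; apply: measurable_funM => //; apply: measurable_funB => //.
  rewrite (funext (weighted_estimate_scale _ _ _ _ _ _ _ I0 fUE g n)) /weighted_estimate.
  under eq_fun do rewrite big_add1 big_mkord.
  apply: measurable_sum => k; apply: measurable_funM; last exact: (measurableT_comp mg (measurable_funPT (X k.+1))).
  by apply: measurable_nweight.
- move=> n w t0; rewrite (weighted_estimate_scale _ _ _ _ _ _ _ I0 fUE) /weighted_estimate big_add1 big_mkord /=.
  (* The normalised weights sum to 1 where their sum is positive, so subtracting m amounts to
     centring g. *)
  rewrite -[X in _ - X](mulr1) -(sum_nweight t0) mulr_sumr -sumrB /weighted_total mulr_suml.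
  congr (_ * _); apply: eq_bigr => k _; rewrite /nweight /weighted_term /g0; ring.
Unshelve. all: by end_near. Qed.
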